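(* Let $c\in \mathbb{C}\setminus \mathbb{Q}(i)$ and let $\varepsilon>0$ be sufficiently small. Then there exists an increasing sequence of natural numbers $(M_k)_{k\in \mathbb{N}}$ such that the following holds. If $0\le P_1<P_2\le M_k$, $\omega_1<\omega_2\le \omega_1+2\pi$ and $M_k^{\varepsilon-1/12}<\delta_k\le 1/2$, then $$\pi^{\ast}(P_1,P_2,\omega_1,\omega_2;\delta_k,c) = 4\delta_k^2\,\pi(P_1,P_2,\omega_1,\omega_2)+o\left(\frac{\delta_k^2 M_k^2}{\log M_k}\right)$$ as $k\to \infty$.
   Context: For $0\le a<b$ and real $\gamma_1<\gamma_2$, $D(a,b,\gamma_1,\gamma_2):=\{Re^{i\theta}: a<R\le b,\ \gamma_1<\theta\le\gamma_2\}$. $\pi(P_1,P_2,\omega_1,\omega_2)$ denotes the number of Gaussian primes (prime elements of $\mathbb{Z}[i]$) in $D(P_1,P_2,\omega_1,\omega_2)$. For $\delta>0$ and $c\in\mathbb{C}$, $\pi^{\ast}(P_1,P_2,\omega_1,\omega_2;\delta,c)$ denotes the number of Gaussian primes $p\in D(P_1,P_2,\omega_1,\omega_2)$ such that $\min_{q\in \mathbb{Z}[i]} \max(|\Re(pc-q)|,|\Im(pc-q)|) \le \delta$. *)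

(* Defs.v *)
From Stdlib Require Import Reals ZArith QArith Qreals List ClassicalEpsilon.
Open Scope R_scope.

Definition gint : Type := (Z * Z)%type.

Definition gmul (u v : gint) : gint :=
  ((fst u * fst v - snd u * snd v)%Z, (fst u * snd v + snd u * fst v)%Z).

Definition gone : gint := (1%Z, 0%Z).
Definition gzero : gint := (0%Z, 0%Z).

Definition gdvd (d a : gint) : Prop := exists q : gint, a = gmul d q.
Definition gunit (u : gint) : Prop := exists v : gint, gmul u v = gone.

Definition gaussian_prime (p : gint) : Prop :=
  p <> gzero /\ ~ gunit p /\
  forall a b : gint, gdvd p (gmul a b) -> gdvd p a \/ gdvd p b.

Definition cplx : Type := (R * R)%type.

Definition inD (a b g1 g2 : R) (z : cplx) : Prop :=
  exists r theta : R, a < r <= b /\ g1 < theta <= g2 /\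
    fst z = r * cos theta /\ snd z = r * sin theta.

Definition gtoC (p : gint) : cplx := (IZR (fst p), IZR (snd p)).

Definition gmulC (p : gint) (c : cplx) : cplx :=
  (IZR (fst p) * fst c - IZR (snd p) * snd c,
   IZR (fst p) * snd c + IZR (snd p) * fst c).

(* min over q in Z[i] of max(|Re(pc - q)|, |Im(pc - q)|) <= delta
   (the minimum is attained, so this is: some q achieves <= delta) *)
Definition close_to_lattice (delta : R) (c : cplx) (p : gint) : Prop :=
  exists q : gint,
    Rmax (Rabs (fst (gmulC p c) - IZR (fst q)))
         (Rabs (snd (gmulC p c) - IZR (snd q))) <= delta.

Definition decP (P : Prop) : bool :=
  if excluded_middle_informative P then true else false.

Definition zrange (N : nat) : list Z :=
  map (fun n => (Z.of_nat n - Z.of_nat N)%Z) (seq 0 (2 * N + 1)).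
Definition gbox (N : nat) : list gint := list_prod (zrange N) (zrange N).

(* Number of Gaussian integers z satisfying P, where P z forces |z| <= b:
   all such z lie in the box [-N,N]^2 with N = up b, which is enumerated
   without repetition. *)
Definition count_upto (b : R) (P : gint -> Prop) : nat :=
  length (filter (fun z => decP (P z)) (gbox (Z.to_nat (up b)))).

Definition pi_count (P1 P2 w1 w2 : R) : nat :=
  count_upto P2 (fun p => gaussian_prime p /\ inD P1 P2 w1 w2 (gtoC p)).

Definition pi_star (P1 P2 w1 w2 delta : R) (c : cplx) : nat :=
  count_upto P2 (fun p => gaussian_prime p /\ inD P1 P2 w1 w2 (gtoC p)
                          /\ close_to_lattice delta c p).

Definition in_Qi (c : cplx) : Prop :=
  exists q1 q2 : Q, fst c = Q2R q1 /\ snd c = Q2R q2.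

(* Main.v *)
(* Let q be the denominator of a good Gaussian rational approximation to c. Then the points l c with
   0 < |l| << |q| stay at distance >> 1/|q| from Z[i] (the condition [spaced]), and M is chosen as
   the integer part of |q|^(5/3). Since M^(-1/12) <= delta, the box of side 2 delta is approximated
   from both sides by trigonometric polynomials of degree M^(1/12 + small), obtained by convolving
   its indicator, on a finite grid, with an even power of a Dirichlet kernel. The constant terms
   give 4 delta^2 pi, and it remains to show that the sums of e(Re(p theta)) over the primes p of
   the sector, with theta = c h for the nonzero frequencies h, are O(M^(9/5)) up to logarithms.

   For this one uses Vaughan's identity in Z[i]. All inner sums run over z in Z[i] with a weight
   such as the indicator of z n in the sector (divided by log |z n|^2), which has bounded variation
   along rows and along columns, so that summation by parts bounds them by the number of rows times
   the inverse of the distance of theta d to the lattice. The spacing of the multiples of theta then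
   controls the sum over d; in the bilinear terms it is applied after Cauchy's inequality, on
   dyadic ranges of the shorter variable, which may be taken of size at most M^(1/2). *)
Require Import Defs.
From Stdlib Require Import Reals ZArith QArith Qreals List ClassicalEpsilon FinFun Lra Lia Psatz.
From Coquelicot Require Import Coquelicot.
From HB Require Import structures.
From mathcomp Require all_boot zify_ssreflect.
Open Scope R_scope.

(** The exponents leave only a narrow window. Let the denominator be Q = M^q, let n, about M^(1/12),
    be the degree of the polynomials, and let u be the cut in Vaughan's identity. Multiplying c by a
    frequency of size n shrinks the range of well-spaced multiples from Q to about Q/n, and the
    bilinear terms need this range to reach M^(1/2); hence q > 7/12. Up to logarithms the prime sums
    are bounded by M^2/u, M^(3/2) Q^(1/2) and M Q. The Fourier coefficients multiply them by about
    (n delta)^2, so they must stay below M^2/n^2 = M^(11/6); hence u > M^(1/6) and q < 2/3. The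
    choice q = 3/5, u = M^(1/5) satisfies all this and makes the first two bounds equal. All
    constants are independent of the sector and of delta, which gives the uniformity of the error
    term. *)

Module GaussianPrimes.
Import all_boot zify_ssreflect.SsreflectZifyInstances.Exports.

(** * Finite sums in R and C *)

Set Implicit Arguments.
Unset Strict Implicit.
Unset Printing Implicit Defensive.
Open Scope R_scope.
Notation decP := Defs.decP.
Delimit Scope R_scope with Rr.

Fact Z_eqP : Equality.axiom Z.eqb.
Proof. by move=> x y; apply: (iffP idP); move/Z.eqb_eq. Qed.
HB.instance Definition _ := hasDecEq.Build Z Z_eqP.
HB.instance Definition _ := Equality.copy gint (Z * Z)%type.

Fact RplusA : associative Rplus. Proof. by move=> x y z; ring. Qed.
Fact RplusC : commutative Rplus. Proof. by move=> x y; ring. Qed.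
Fact Rplus0 : left_id 0 Rplus. Proof. by move=> x; ring. Qed.
HB.instance Definition _ := Monoid.isComLaw.Build R 0 Rplus RplusA RplusC Rplus0.
Fact CplusA : associative Cplus. Proof. by move=> x y z; ring. Qed.
Fact CplusC : commutative Cplus. Proof. by move=> x y; ring. Qed.
Fact Cplus0 : left_id (RtoC 0) Cplus. Proof. by move=> x; ring. Qed.
HB.instance Definition _ := Monoid.isComLaw.Build C (RtoC 0) Cplus CplusA CplusC Cplus0.

Notation "\rsum_ ( i <- r ) F" := (\big[Rplus/IZR 0]_(i <- r) F%Rr)
  (at level 41, F at level 41, i, r at level 50) : R_scope.
Notation "\csum_ ( i <- r ) F" := (\big[Cplus/RtoC 0]_(i <- r) F%C)
  (at level 41, F at level 41, i, r at level 50) : R_scope.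

Definition ind (P : Prop) : R := if decP P then 1 else 0.

Lemma decPP (P : Prop) : reflect P (decP P).
Proof. by rewrite /decP; case: excluded_middle_informative => h; constructor. Qed.

Lemma indT (P : Prop) : P -> ind P = 1.
Proof. by move=> h; rewrite /ind; case: decPP. Qed.

Lemma indF (P : Prop) : ~ P -> ind P = 0.
Proof. by move=> h; rewrite /ind; case: decPP. Qed.

Lemma ind_bound (P : Prop) : 0 <= ind P <= 1.
Proof. by rewrite /ind; case: ifP => _; lra. Qed.

Lemma ind_sq_le1 (P : Prop) : ind P * ind P <= 1.
Proof. by have := ind_bound P; nra. Qed.

Lemma ind_and (P Q : Prop) : ind (P /\ Q) = ind P * ind Q.
Proof.
case: (classic P) => hp; last by rewrite (indF hp) (@indF (P /\ Q)); [ring | tauto].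
case: (classic Q) => hq; last by rewrite (indF hq) (@indF (P /\ Q)); [ring | tauto].
by rewrite !indT //; ring.
Qed.

Lemma ind_not (P : Prop) : ind (~ P) = 1 - ind P.
Proof.
by case: (classic P) => h; [rewrite (indT h) indF; [ring | tauto] | rewrite (indF h) indT //; ring].
Qed.

Lemma ind_iff (P Q : Prop) : (P <-> Q) -> ind P = ind Q.
Proof.
move=> h; case: (classic P) => hp; first by rewrite !indT //; tauto.
by rewrite !indF //; tauto.
Qed.

Section RealSums.
Variables (I : Type).
Implicit Types (l : seq I) (F G : I -> R).

Lemma rsum_distl l (c : R) F : c * (\rsum_(i <- l) F i) = \rsum_(i <- l) (c * F i).
Proof. by elim: l => [|a l ih]; rewrite ?big_nil ?big_cons -?ih; ring. Qed.

Lemma rsum_distr l (c : R) F : (\rsum_(i <- l) F i) * c = \rsum_(i <- l) (F i * c).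
Proof. by elim: l => [|a l ih]; rewrite ?big_nil ?big_cons -?ih; ring. Qed.

Lemma rsum_ge0 l F : (forall i, 0 <= F i) -> 0 <= \rsum_(i <- l) F i.
Proof.
by move=> h; elim: l => [|a l ih]; rewrite ?big_nil ?big_cons; [lra | have := h a; lra].
Qed.

Lemma rsum_le l F G : (forall i, F i <= G i) -> \rsum_(i <- l) F i <= \rsum_(i <- l) G i.
Proof.
by move=> h; elim: l => [|a l ih]; rewrite ?big_nil ?big_cons; [lra | have := h a; lra].
Qed.

Lemma rsum_sub l F G :
  \rsum_(i <- l) (F i - G i) = (\rsum_(i <- l) F i) - \rsum_(i <- l) G i.
Proof. by elim: l => [|a l ih]; rewrite ?big_nil ?big_cons ?ih; ring. Qed.

Lemma rsum_abs l F : Rabs (\rsum_(i <- l) F i) <= \rsum_(i <- l) Rabs (F i).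
Proof.
elim: l => [|a l ih]; rewrite ?big_nil ?big_cons; first by rewrite Rabs_R0; lra.
by have := Rabs_triang (F a) (\rsum_(i <- l) F i); lra.
Qed.

Lemma rsum_const l (c : R) : \rsum_(i <- l) c = INR (size l) * c.
Proof. by elim: l => [|a l ih]; rewrite ?big_nil ?big_cons ?[size _]/= ?ih ?S_INR /=; ring. Qed.

Lemma rsum_CS l F G :
  Rabs (\rsum_(i <- l) (F i * G i)) <=
  sqrt (\rsum_(i <- l) (F i * F i)) * sqrt (\rsum_(i <- l) (G i * G i)).
Proof.
have hS H : 0 <= \rsum_(i <- l) (H i * H i) by apply: rsum_ge0 => i; nra.
suff h : (\rsum_(i <- l) (F i * G i)) ^ 2 <=
    (\rsum_(i <- l) (F i * F i)) * (\rsum_(i <- l) (G i * G i)).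
  rewrite -sqrt_mult //; first apply: Rle_trans (sqrt_le_1_alt _ _ h).
  by rewrite sqrt_pow2_abs || (rewrite -Rsqr_pow2 sqrt_Rsqr_abs; lra).
elim: l {hS} => [|a l]; rewrite ?big_nil ?big_cons; first lra.
set S := \rsum_(i <- l) _; set A := \rsum_(i <- l) _; set B := \rsum_(i <- l) _ => ih.
have hA : 0 <= A by apply: rsum_ge0 => i; nra.
have hB : 0 <= B by apply: rsum_ge0 => i; nra.
set f := F a; set g := G a.
(* This is the inequality of arithmetic and geometric means, given S^2 <= A B; it is checked after
   squaring. *)
suff : 2 * S * (f * g) <= f * f * B + g * g * A by nra.
have h1 : (2 * S * (f * g)) ^ 2 <= (f * f * B + g * g * A) ^ 2.
  have : 4 * (f * g) ^ 2 * S ^ 2 <= 4 * (f * g) ^ 2 * (A * B).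
    by apply: Rmult_le_compat_l => //; nra.
  by have := pow2_ge_0 (f * f * B - g * g * A); nra.
have h2 : 0 <= f * f * B + g * g * A by nra.
by nra.
Qed.

End RealSums.

Section ComplexSums.
Variables (I : Type).
Implicit Types (l : seq I) (F G : I -> C).

Lemma csum_distl l (c : C) F : (c * (\csum_(i <- l) F i))%C = \csum_(i <- l) (c * F i).
Proof. by elim: l => [|a l ih]; rewrite ?big_nil ?big_cons -?ih; ring. Qed.

Lemma csum_distr l (c : C) F : ((\csum_(i <- l) F i) * c)%C = \csum_(i <- l) (F i * c).
Proof. by elim: l => [|a l ih]; rewrite ?big_nil ?big_cons -?ih; ring. Qed.

Lemma csum_add l F G :
  \csum_(i <- l) (F i + G i) = ((\csum_(i <- l) F i) + \csum_(i <- l) G i)%C.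
Proof. exact: big_split. Qed.

Lemma csum_sub l F G :
  \csum_(i <- l) (F i - G i) = ((\csum_(i <- l) F i) - \csum_(i <- l) G i)%C.
Proof. by elim: l => [|a l ih]; rewrite ?big_nil ?big_cons ?ih; ring. Qed.

Lemma csum_mod l F : Cmod (\csum_(i <- l) F i) <= \rsum_(i <- l) Cmod (F i).
Proof.
elim: l => [|a l ih]; rewrite ?big_nil ?big_cons; first by rewrite Cmod_0; lra.
by have := Cmod_triangle (F a) (\csum_(i <- l) F i); lra.
Qed.

Lemma csum_RtoC l (F : I -> R) : \csum_(i <- l) (RtoC (F i)) = RtoC (\rsum_(i <- l) F i).
Proof. by elim: l => [|a l ih]; rewrite ?big_nil ?big_cons // ih RtoC_plus. Qed.

Lemma csum_conj l F : Cconj (\csum_(i <- l) F i) = \csum_(i <- l) (Cconj (F i)).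
Proof.
elim: l => [|a l ih]; rewrite ?big_nil ?big_cons -?ih.
  by rewrite /Cconj /RtoC /=; f_equal; ring.
by rewrite /Cconj /Cplus /=; f_equal; ring.
Qed.

End ComplexSums.

Lemma rsum_le_in (I : eqType) (l : seq I) (F G : I -> R) :
  (forall i, i \in l -> F i <= G i) -> \rsum_(i <- l) F i <= \rsum_(i <- l) G i.
Proof.
elim: l => [|a l ih] h; rewrite ?big_nil ?big_cons; first lra.
apply: Rplus_le_compat; first by apply: h; rewrite mem_head.
by apply: ih => i hi; apply: h; rewrite inE hi orbT.
Qed.

(** Boxes serve only to make sums finite; this lets one box replace another as long as both contain
    the same part of the support. *)
Lemma sum_support (T : Type) (x0 : T) (op : Monoid.com_law x0) (I : eqType) (l m : seq I)
    (F : I -> T) : uniq l -> uniq m -> (forall i, F i <> x0 -> (i \in l) = (i \in m)) ->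
  \big[op/x0]_(i <- l) F i = \big[op/x0]_(i <- m) F i.
Proof.
move=> ul um h.
rewrite -(@big_rmcond_in _ _ _ _ l (fun i => ~~ decP (F i = x0))); last first.
  by move=> i _ /negPn /decPP.
rewrite -(@big_rmcond_in _ _ _ _ m (fun i => ~~ decP (F i = x0))); last first.
  by move=> i _ /negPn /decPP.
rewrite -[LHS]big_filter -[RHS]big_filter; apply: perm_big; apply: uniq_perm.
- exact: filter_uniq.
- exact: filter_uniq.
- move=> i; rewrite !mem_filter; case: decPP => //= hi.
  exact: h.
Qed.

(** All conditions are imposed only where [F] is nonzero, so that indicator factors inside [F] can
    carry the restrictions on the index. *)
Lemma rsum_le_inj (I J : eqType) (l : seq I) (m : seq J) (phi : I -> J)
    (F : I -> R) (G : J -> R) : uniq l ->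
  (forall i j, i \in l -> j \in l -> F i <> 0 -> F j <> 0 -> phi i = phi j -> i = j) ->
  (forall i, i \in l -> F i <> 0 -> phi i \in m /\ F i <= G (phi i)) ->
  (forall j, 0 <= G j) -> \rsum_(i <- l) F i <= \rsum_(j <- m) G j.
Proof.
move=> ul hinj hm hG.
rewrite -(@big_rmcond_in _ _ _ _ l (fun i => ~~ decP (F i = 0))); last first.
  by move=> i _ /negPn /decPP.
rewrite -big_filter; set l' := filter _ l.
have hl' i : i \in l' -> i \in l /\ F i <> 0.
  by rewrite mem_filter => /andP [/decPP ? ?].
have ul' : uniq l' by exact: filter_uniq.
have {hinj} hinj : {in l' &, injective phi}.
  by move=> i j /hl' [? ?] /hl' [? ?]; apply: hinj.
apply: (@Rle_trans _ (\rsum_(j <- map phi l') G j)).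
  by rewrite big_map; apply: rsum_le_in => i /hl' [h1 h2]; case: (hm i h1 h2).
have hu : \rsum_(j <- undup m) G j <= \rsum_(j <- m) G j.
  elim: m {hm} => [|a m ih] /=; rewrite ?big_nil; first lra.
  by case: ifP => _; rewrite ?big_cons; have := hG a; lra.
suff he : \rsum_(j <- undup m) G j = \rsum_(j <- map phi l') G j +
    \rsum_(j <- [seq j <- undup m | j \notin map phi l']) G j.
  by have := @rsum_ge0 _ [seq j <- undup m | j \notin map phi l'] G hG; lra.
rewrite -big_cat; apply: perm_big; apply: uniq_perm.
- exact: undup_uniq.
- rewrite cat_uniq map_inj_in_uniq // ul' filter_uniq ?undup_uniq // andbT /=.
  by apply/hasPn => j; rewrite mem_filter => /andP [].
- move=> j; rewrite mem_cat mem_filter mem_undup; case: (boolP (j \in map phi l')) => //=.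
  by move=> /mapP [i /hl' [h1 h2] ->]; case: (hm i h1 h2) => ->.
Qed.

(** * Arithmetic of the Gaussian integers *)

Definition gadd (u v : gint) : gint := ((u.1 + v.1)%Z, (u.2 + v.2)%Z).
Definition gopp (u : gint) : gint := ((- u.1)%Z, (- u.2)%Z).
Definition gsub (u v : gint) : gint := gadd u (gopp v).
Definition gnorm (u : gint) : Z := (u.1 * u.1 + u.2 * u.2)%Z.

Lemma gint_ring : ring_theory gzero gone gadd gmul gsub gopp (@eq gint).
Proof.
by split=> *; repeat match goal with x : gint |- _ => case: x => ? ? end;
  rewrite /gsub /gadd /gmul /gopp /gone /gzero; cbn [fst snd]; f_equal; ring.
Qed.
Add Ring gint_r : gint_ring.

Lemma gnorm_mul u v : gnorm (gmul u v) = (gnorm u * gnorm v)%Z.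
Proof. by rewrite /gnorm /gmul /=; ring. Qed.

Lemma gnorm_ge0 u : (0 <= gnorm u)%Z.
Proof. by rewrite /gnorm; nia. Qed.

Arguments gnorm_ge0 u : clear implicits.

Lemma gnorm_eq0 u : gnorm u = 0%Z -> u = gzero.
Proof. by case: u => a b; rewrite /gnorm /gzero /= => h; f_equal; nia. Qed.

Lemma gnorm_gt0 u : u <> gzero -> (1 <= gnorm u)%Z.
Proof.
by move=> h; have := gnorm_ge0 u; case: (Z.eq_dec (gnorm u) 0) => [/gnorm_eq0|] //; lia.
Qed.

Lemma gmul_eq0 u v : gmul u v = gzero -> u = gzero \/ v = gzero.
Proof.
move=> h; have : (gnorm u * gnorm v = 0)%Z by rewrite -gnorm_mul h.
by case/Z.mul_eq_0 => /gnorm_eq0; tauto.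
Qed.

Lemma gmul_neq0 u v : u <> gzero -> v <> gzero -> gmul u v <> gzero.
Proof. by move=> hu hv /gmul_eq0; tauto. Qed.

Lemma gmulI u v w : u <> gzero -> gmul u v = gmul u w -> v = w.
Proof.
move=> hu h; have : gmul u (gsub v w) = gzero.
  have -> : gmul u (gsub v w) = gsub (gmul u v) (gmul u w) by ring.
  by rewrite h; ring.
case/gmul_eq0 => // h0.
have -> : v = gadd (gsub v w) w by ring.
by rewrite h0; ring.
Qed.

Lemma gunitP u : gunit u <-> gnorm u = 1%Z.
Proof.
split=> [[v /(f_equal gnorm)]|h].
  rewrite gnorm_mul => /(Z.mul_eq_1 (gnorm u) (gnorm v)).
  by have := gnorm_ge0 u; lia.
exists (u.1, (- u.2)%Z); rewrite /gmul /gone /=; f_equal; last by ring.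
by rewrite -h /gnorm; ring.
Qed.

Lemma gunit_neq0 u : gunit u -> u <> gzero.
Proof. by move=> /gunitP h h0; move: h; rewrite h0. Qed.

Lemma gunit_mul u v : gunit u -> gunit v -> gunit (gmul u v).
Proof. by move=> /gunitP hu /gunitP hv; apply/gunitP; rewrite gnorm_mul hu hv. Qed.

Lemma gunit_mull u v : gunit (gmul u v) -> gunit u.
Proof. by move=> [w h]; exists (gmul v w); rewrite -h; ring. Qed.

Lemma gunit1 : gunit gone.
Proof. by exists gone. Qed.

Lemma gdvd_refl u : gdvd u u.
Proof. by exists gone; ring. Qed.

Lemma gdvd_mulr u v : gdvd u (gmul u v).
Proof. by exists v. Qed.

Lemma gdvd_trans u v w : gdvd u v -> gdvd v w -> gdvd u w.
Proof. by move=> [a ->] [b ->]; exists (gmul a b); ring. Qed.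

Lemma gdvd_norm u v : v <> gzero -> gdvd u v -> (gnorm u <= gnorm v)%Z.
Proof.
move=> hv [w hw]; have := gnorm_gt0 hv; have := gnorm_ge0 w; have := gnorm_ge0 u.
rewrite hw gnorm_mul; move: (gnorm u) (gnorm w) => x y hx hy hxy.
have hy1 : (1 <= y)%Z by case: (Z.eq_dec y 0) hxy => [->|]; lia.
by nia.
Qed.

Lemma gdvd_neq0 u v : v <> gzero -> gdvd u v -> u <> gzero.
Proof. by move=> hv [w hw] h0; apply: hv; rewrite hw h0; ring. Qed.

Lemma gnorm_ind (P : gint -> Prop) :
  (forall u, (forall v, (gnorm v < gnorm u)%Z -> P v) -> P u) -> forall u, P u.
Proof.
move=> h; suff : forall n u, (Z.to_nat (gnorm u) < n)%N -> P u.
  by move=> H u; apply: (H (Z.to_nat (gnorm u)).+1).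
elim=> [//|n ih] u hu; apply: h => v hv; apply: ih.
by have := gnorm_ge0 v; have := gnorm_ge0 u; lia.
Qed.

Lemma min_norm (P : gint -> Prop) u : P u ->
  exists g, P g /\ forall v, P v -> (gnorm g <= gnorm v)%Z.
Proof.
move: u; apply: (gnorm_ind (P := fun u => P u -> _)) => u ih hu.
case: (classic (exists v, P v /\ (gnorm v < gnorm u)%Z)) => [[v [hv hlt]]|hn].
  exact: ih hlt hv.
exists u; split=> // v hv; apply: Znot_gt_le => hlt; apply: hn; exists v; split=> //; lia.
Qed.

Lemma round_div (x n : Z) : (0 < n)%Z -> exists q, (- n <= 2 * (x - q * n) <= n)%Z.
Proof.
move=> hn; exists ((2 * x + n) / (2 * n))%Z.
have := Z.div_mod (2 * x + n) (2 * n) ltac:(lia).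
have := Z.mod_pos_bound (2 * x + n) (2 * n) ltac:(lia).
by nia.
Qed.

(** Rounding both coordinates of a conj(b) / N(b) to nearest integers leaves a remainder of norm at
    most N(b)/2. *)
Lemma euclid a b : b <> gzero -> exists q, (gnorm (gsub a (gmul b q)) < gnorm b)%Z.
Proof.
move=> hb; have hN := gnorm_gt0 hb.
case: (@round_div (a.1 * b.1 + a.2 * b.2)%Z (gnorm b) ltac:(lia)) => q1.
case: (@round_div (a.2 * b.1 - a.1 * b.2)%Z (gnorm b) ltac:(lia)) => q2.
set X := (X in (_ <= 2 * X <= _)%Z) => h2; set Y := (X in (_ <= 2 * X <= _)%Z) => h1.
exists (q1, q2).
have e : (gnorm b * gnorm (gsub a (gmul b (q1, q2))) = X * X + Y * Y)%Z.
  by rewrite /X /Y /gnorm /gsub /gadd /gopp /gmul /=; ring.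
have : (4 * (X * X + Y * Y) <= 2 * (gnorm b * gnorm b))%Z by nia.
by rewrite -e; nia.
Qed.

(** A nonzero element of least norm generates, by division with remainder. It yields Bezout
    relations for primes here, and later the reduction of a fraction a/q to lowest terms. *)
Lemma ideal_gen (P : gint -> Prop) u : P u -> u <> gzero ->
  (forall x y, P x -> P y -> P (gsub x y)) -> (forall x y, P x -> P (gmul x y)) ->
  exists g, [/\ P g, g <> gzero & forall v, P v -> gdvd g v].
Proof.
move=> hu hu0 hsub hmul.
case: (@min_norm (fun v => P v /\ v <> gzero) u) => [//|g [[hg hg0] hmin]].
exists g; split=> // v hv.
have [q hq] := @euclid v g hg0.
have hr : P (gsub v (gmul g q)) by apply: hsub => //; apply: hmul.
case: (classic (gsub v (gmul g q) = gzero)) => [h0|h0].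
  exists q; have e : v = gadd (gsub v (gmul g q)) (gmul g q) by ring.
  by rewrite e h0; ring.
by have := hmin _ (conj hr h0); lia.
Qed.

(** * Primes of Z[i] and lengths of factorizations *)

Notation gprime := gaussian_prime.

(** The ideal generated by p and a has a generator g dividing p. If g is associate to p, then p
    divides a; if g is a unit, the Bezout relation multiplied by b shows that p divides b. *)
Lemma irreducible_prime p : p <> gzero -> ~ gunit p ->
  (forall d, gdvd d p -> gunit d \/ gdvd p d) -> gprime p.
Proof.
move=> hp0 hpu hirr; split=> //; split=> // a b hab.
case: (@ideal_gen (fun z => exists x y, z = gadd (gmul p x) (gmul a y)) p).
- by exists gone, gzero; ring.
- exact: hp0.
- move=> x y [x1 [y1 ->]] [x2 [y2 ->]].
  by exists (gsub x1 x2), (gsub y1 y2); ring.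
- by move=> x y [x1 [y1 ->]]; exists (gmul x1 y), (gmul y1 y); ring.
move=> g [[x [y hg]] hg0 hall].
have hgp : gdvd g p by apply: hall; exists gone, gzero; ring.
have hga : gdvd g a by apply: hall; exists gzero, gone; ring.
case: (hirr g hgp) => [[v hv]|h]; last by left; apply: gdvd_trans h hga.
right; case: hab => w hw; exists (gmul v (gadd (gmul x b) (gmul w y))).
transitivity (gmul (gmul g v) b); first by rewrite hv; ring.
transitivity (gmul v (gadd (gmul (gmul p x) b) (gmul y (gmul a b)))); first by rewrite hg; ring.
by rewrite hw; ring.
Qed.

(** A non-unit divisor of least norm is irreducible, hence prime. *)
Lemma prime_divisor n : n <> gzero -> ~ gunit n -> exists p, gprime p /\ gdvd p n.
Proof.
move=> hn hu.
case: (@min_norm (fun d => gdvd d n /\ ~ gunit d) n) => [|p [[hpn hpu] hmin]].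
  by split=> //; apply: gdvd_refl.
have hp0 := gdvd_neq0 hn hpn.
exists p; split=> //; apply: irreducible_prime => // d hd.
case: (classic (gunit d)) => hdu; first by left.
right; case: (hd) => t ht.
have hle := hmin _ (conj (gdvd_trans hd hpn) hdu).
have hd0 := gdvd_neq0 hp0 hd.
have : gunit t.
  apply/gunitP; have := gnorm_gt0 hd0; have := gnorm_ge0 t; have := gnorm_gt0 hp0.
  by move: hle; rewrite ht gnorm_mul; nia.
move=> [s hs]; exists s; rewrite ht.
have -> : gmul (gmul d t) s = gmul d (gmul t s) by ring.
by rewrite hs; ring.
Qed.

Lemma prime_neq0 p : gprime p -> p <> gzero. Proof. by case. Qed.

Lemma prime_norm p : gprime p -> (2 <= gnorm p)%Z.
Proof.
move=> [h0 [hu _]]; have := gnorm_gt0 h0.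
have h1 : gnorm p <> 1%Z by move/gunitP.
by lia.
Qed.

Lemma gauss_prime p k m : gprime p -> ~ gdvd p k -> gdvd k (gmul p m) -> gdvd k m.
Proof.
move=> [hp0 [_ hp]] hk [t ht].
case: (hp k t) => [|//|[s hs]]; first by rewrite -ht; apply: gdvd_mulr.
by exists s; apply: (gmulI hp0); rewrite ht hs; ring.
Qed.

Lemma prime_unit_factor p t : gprime (gmul p t) -> gprime p -> gunit t.
Proof.
move=> hpt hp; have hp0 := prime_neq0 hp.
case: (hpt) => h0 [_ h]; case: (h p t); first exact: gdvd_refl.
- move=> [s hs]; exists s.
  apply: (gmulI hp0); transitivity p; last by ring.
  by rewrite {2}hs; ring.
move=> [s hs]; case: hp => _ [hu _]; case: hu; exists s.
have ht0 : t <> gzero by move=> ht; apply: h0; rewrite ht; ring.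
apply: (gmulI ht0); transitivity t; last by ring.
by rewrite {2}hs; ring.
Qed.

(** The Moebius function only needs the parity of the number of prime factors, so a factorization is
    recorded by its length alone; uniqueness up to units and order never has to be formulated. *)
Inductive fact : gint -> nat -> Prop :=
| fact_unit u : gunit u -> fact u 0
| fact_prime p m k : gprime p -> fact m k -> fact (gmul p m) k.+1.

Lemma fact_unitmul n k t : fact n k -> gunit t -> fact (gmul t n) k.
Proof.
move=> h ht; elim: h => [u hu|p m j hp _ ih].
  by apply: fact_unit; apply: gunit_mul.
have -> : gmul t (gmul p m) = gmul p (gmul t m) by ring.
exact: fact_prime.
Qed.

Lemma fact_ex n : n <> gzero -> exists k, fact n k.
Proof.
move: n; apply: gnorm_ind => n ih hn.
case: (classic (gunit n)) => [hu|hu]; first by exists 0%N; apply: fact_unit.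
have [p [hp [m hm]]] := prime_divisor hn hu.
have hm0 : m <> gzero by move=> h0; apply: hn; rewrite hm h0; ring.
case: (ih m) => [||k hk] //; last by exists k.+1; rewrite hm; apply: fact_prime.
by have := prime_norm hp; have := gnorm_gt0 hm0; rewrite hm gnorm_mul; nia.
Qed.

Lemma prime_ndvd_unit p u : gprime p -> gunit u -> ~ gdvd p u.
Proof.
move=> hp /[dup] hu /gunitP h1 hd; have := gdvd_norm (gunit_neq0 hu) hd.
by have := prime_norm hp; lia.
Qed.

Lemma fact_div n k p : fact n k -> gprime p -> gdvd p n ->
  exists m j, [/\ n = gmul p m, fact m j & k = j.+1].
Proof.
move=> h hp; elim: h => [u hu|r m j hr hm ih] hd.
  by case: (prime_ndvd_unit hp hu hd).
case: (hp) => _ [_ /(_ _ _ hd)] [[t ht]|hpm].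
  exists (gmul t m), j; split=> //; first by rewrite ht; ring.
  by apply: fact_unitmul => //; apply: (@prime_unit_factor p) => //; rewrite -ht.
have [m' [j' [e1 e2 ->]]] := ih hpm.
exists (gmul r m'), j'.+1; split=> //; first by rewrite e1; ring.
exact: fact_prime.
Qed.

Lemma fact_inv n k : fact n k -> match k with
  | O => gunit n
  | S j => exists p m, [/\ gprime p, n = gmul p m & fact m j]
  end.
Proof. by case=> [u //|p m j hp hm]; exists p, m. Qed.

Lemma fact_uniq n k k' : fact n k -> fact n k' -> k = k'.
Proof.
elim: k n k' => [|k ih] n k' /fact_inv.
  move=> hu; case: k' => // k' /fact_inv [p [m [hp e _]]].
  by case: (prime_ndvd_unit hp hu); rewrite e; apply: gdvd_mulr.
move=> [p [m [hp e hm]]] h'; have hd : gdvd p n by rewrite e; apply: gdvd_mulr.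
have [m' [j [e1 e2 ->]]] := fact_div h' hp hd.
by move: e2; rewrite -(gmulI (prime_neq0 hp) (etrans (esym e) e1)) => /(ih _ _ hm) ->.
Qed.

(** * The Moebius function *)

Definition bigomega (n : gint) : nat := epsilon (inhabits 0%N) (fact n).

Lemma bigomegaP n k : fact n k -> bigomega n = k.
Proof.
by move=> h; apply: (fact_uniq _ h); apply: epsilon_spec; exists k.
Qed.

(** Zero is listed with the elements that are not squarefree, because it has no factorization and
    [bigomega gzero] is an arbitrary number. *)
Definition mu (n : gint) : R :=
  if decP (n = gzero \/ exists p, gprime p /\ gdvd (gmul p p) n) then 0
  else (-1) ^ (bigomega n).

Lemma mu_abs n : Rabs (mu n) <= 1.
Proof.
by rewrite /mu; case: decPP => _; [rewrite Rabs_R0; lra | rewrite pow_1_abs; lra].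
Qed.

Lemma mu0 : mu gzero = 0.
Proof. by rewrite /mu; case: decPP => //; tauto. Qed.

Lemma mu_unit u : gunit u -> mu u = 1.
Proof.
move=> hu; rewrite /mu; case: decPP => [[h|[p [hp hd]]]|_].
- by case: (gunit_neq0 hu h).
- by case: (prime_ndvd_unit hp hu); apply: gdvd_trans hd; apply: gdvd_mulr.
- by rewrite (bigomegaP (fact_unit hu)).
Qed.

Lemma mu_primeM_dvd p d : gprime p -> gdvd p d -> mu (gmul p d) = 0.
Proof.
move=> hp [t ht]; rewrite /mu; case: decPP => // h; case: h; right; exists p.
by split=> //; exists t; rewrite ht; ring.
Qed.

Lemma mu_primeM_ndvd p d : gprime p -> ~ gdvd p d -> mu (gmul p d) = - mu d.
Proof.
move=> hp hd.
have hd0 : d <> gzero by move=> h; apply: hd; exists gzero; rewrite h; ring.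
have e : (gmul p d = gzero \/ (exists r, gprime r /\ gdvd (gmul r r) (gmul p d))) <->
         (d = gzero \/ (exists r, gprime r /\ gdvd (gmul r r) d)).
  split=> [[h|[r [hr h]]]|[h|[r [hr h]]]].
  - by case: (gmul_neq0 (prime_neq0 hp) hd0).
  - right; exists r; split=> //; apply: (gauss_prime hp _ h) => h1.
    case: (hp) => hp0 [_ h2]; have [t ht] : gdvd p r by case: (h2 _ _ h1).
    apply: hd; case: h => s hs; exists (gmul (gmul t t) s).
    by apply: (gmulI hp0); rewrite hs ht; ring.
  - by case: hd0.
  - right; exists r; split=> //; case: h => s ->; exists (gmul p s); ring.
rewrite /mu; case: decPP => [/e h|h]; case: decPP => [h'|h'] //; try (by ring);
  try (by case: h; apply/e); try (by case: h').
have [k hk] := fact_ex hd0.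
by rewrite (bigomegaP hk) (bigomegaP (fact_prime hp hk)) /=; ring.
Qed.

(** * Boxes and divisor sums *)

Lemma InP (T : eqType) (x : T) (l : seq T) : reflect (List.In x l) (x \in l).
Proof.
elim: l => [|a l ih] /=; first by constructor.
rewrite inE; apply: (iffP orP) => [[/eqP ->|/ih h]|[->|/ih h]]; rewrite ?eqxx;
  by [left | right].
Qed.

Lemma uniq_NoDup (T : eqType) (l : seq T) : reflect (List.NoDup l) (uniq l).
Proof.
apply: (iffP idP) => [|h]; last first.
  by elim: h => [|x m h _ ih] //=; rewrite ih andbT; apply/negP => /InP.
elim: l => [|x l ih] /=; first by constructor.
by move=> /andP [h /ih hl]; constructor => // /InP h'; rewrite h' in h.
Qed.

Lemma mem_zrange N x : reflect (Z.abs x <= Z.of_nat N)%Z (x \in zrange N).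
Proof.
apply: (iffP (InP _ _)); rewrite /zrange List.in_map_iff.
  by move=> [n [<- /List.in_seq]]; lia.
move=> h; exists (Z.to_nat (x + Z.of_nat N)); split; first by lia.
by apply/List.in_seq; lia.
Qed.

Lemma zrange_uniq N : uniq (zrange N).
Proof.
apply/uniq_NoDup; apply: FinFun.Injective_map_NoDup; last exact: List.seq_NoDup.
by move=> x y; lia.
Qed.

Lemma mem_gbox N z :
  reflect ((Z.abs z.1 <= Z.of_nat N)%Z /\ (Z.abs z.2 <= Z.of_nat N)%Z) (z \in gbox N).
Proof.
case: z => x y; apply: (iffP (InP _ _)); rewrite /gbox List.in_prod_iff.
  by move=> [/InP/mem_zrange ? /InP/mem_zrange].
by move=> [? ?]; split; apply/InP; apply/mem_zrange.
Qed.

Lemma list_prod_big (T : Type) (x0 : T) (op : Monoid.law x0) (I J : Type) (l : seq I)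
    (m : seq J) (F : I * J -> T) :
  \big[op/x0]_(z <- list_prod l m) F z = \big[op/x0]_(x <- l) \big[op/x0]_(y <- m) F (x, y).
Proof.
elim: l => [|a l ih] /=; first by rewrite !big_nil.
rewrite big_cons -ih; have -> : forall u v : seq (I * J), List.app u v = u ++ v by [].
rewrite big_cat; congr (op _ _).
by elim: m {ih} => [|b m ih] /=; rewrite ?big_nil // !big_cons ih.
Qed.

Lemma gbox_uniq N : uniq (gbox N).
Proof.
have H (l m : seq Z) : list_prod l m = [seq (x, y) | x <- l, y <- m].
  by elim: l => [|a l /= ->].
rewrite /gbox H.
by apply: allpairs_uniq; try exact: zrange_uniq; move=> [a b] [c d].
Qed.

Lemma norm_gbox N z : (gnorm z <= Z.of_nat N * Z.of_nat N)%Z -> z \in gbox N.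
Proof. by rewrite /gnorm => h; apply/mem_gbox; nia. Qed.

Lemma dvd_gbox N d n : n <> gzero -> (gnorm n <= Z.of_nat N * Z.of_nat N)%Z ->
  gdvd d n -> d \in gbox N.
Proof.
by move=> hn hN hd; apply: norm_gbox; have := gdvd_norm hn hd; lia.
Qed.

(** Change of variables for sums over boxes: the image of a box under multiplication by d is not a
    box, and only the support of the summand has to be matched. *)
Lemma sum_reindex (T : Type) (x0 : T) (op : Monoid.com_law x0) (I J : eqType)
    (l : seq I) (m : seq J) (phi : I -> J) (G : J -> T) : uniq l -> uniq m ->
  injective phi -> (forall i, i \in l -> G (phi i) <> x0 -> phi i \in m) ->
  (forall j, j \in m -> G j <> x0 -> exists2 i, i \in l & j = phi i) ->
  \big[op/x0]_(i <- l) G (phi i) = \big[op/x0]_(j <- m) G j.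
Proof.
move=> ul um hi h1 h2; rewrite -(big_map phi predT); apply: sum_support => //.
  by rewrite map_inj_uniq.
move=> j hj; apply/idP/idP => [/mapP [i il e]|/h2 /(_ hj) [i il ->]]; last exact: map_f.
by rewrite e; apply: h1 => //; rewrite -e.
Qed.

(* Divisors are never normalized up to units, so every convolution identity below carries
   the factor [nunits] (which is 4). *)
Definition nunits : R := \rsum_(u <- gbox 1) ind (gunit u).

Lemma nunits_box N : (1 <= N)%N -> \rsum_(u <- gbox N) ind (gunit u) = nunits.
Proof.
move=> hN; apply: sum_support; try exact: gbox_uniq.
move=> u hu; have /gunitP h1 : gunit u by apply: NNPP => /indF.
by rewrite !norm_gbox // h1; lia.
Qed.

Lemma nunits_ge1 : 1 <= nunits.
Proof.
have h1 : gone \in gbox 1 by apply: norm_gbox.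
rewrite /nunits (bigD1_seq gone h1 (gbox_uniq 1)) /=.
rewrite (indT gunit1) big_mkcond /=.
have : 0 <= \rsum_(u <- gbox 1) (if u != gone then ind (gunit u) else 0); last lra.
by apply: rsum_ge0 => u; case: ifP => _; [have := ind_bound (gunit u); lra | lra].
Qed.

Lemma size_gbox N : size (gbox N) = ((2 * N + 1) * (2 * N + 1))%N.
Proof.
rewrite /gbox; have e := List.length_prod (zrange N) (zrange N); move: e.
by rewrite /zrange !List.length_map !List.length_seq.
Qed.

(** The nine points of the box are counted instead of the four units; this is the 9 in the bounds
    for [vbeta] and [vgamma] and in the passage from 81 to 729. *)
Lemma nunits_le9 : nunits <= 9.
Proof.
apply: (@Rle_trans _ (\rsum_(u <- gbox 1) 1)).
  by apply: rsum_le => u; have := ind_bound (gunit u); lra.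
by rewrite rsum_const size_gbox /=; lra.
Qed.

(** For a non-unit n fix a prime p dividing it. The divisors divisible by p are written as p d, and
    [mu (gmul p d)] is 0 or cancels the term of a divisor d not divisible by p. *)
Lemma mu_sum M n : (1 <= M)%N -> n <> gzero -> (gnorm n <= Z.of_nat M * Z.of_nat M)%Z ->
  \rsum_(d <- gbox M) (ind (gdvd d n) * mu d) = nunits * ind (gunit n).
Proof.
move=> hM hn hN; case: (classic (gunit n)) => hu.
  rewrite (indT hu) Rmult_1_r -(nunits_box hM); apply: eq_bigr => d _.
  case: (classic (gdvd d n)) => hd.
    have hdu : gunit d by case: hd => t ht; move: hu; rewrite ht; apply: gunit_mull.
    by rewrite (indT hd) (mu_unit hdu) (indT hdu); ring.
  rewrite (indF hd) indF; first by ring.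
  move=> [v hv]; apply: hd; exists (gmul v n).
  transitivity (gmul (gmul d v) n); [rewrite hv|]; ring.
rewrite (indF hu) Rmult_0_r.
have [p [hp hpn]] := prime_divisor hn hu; have hp0 := prime_neq0 hp.
have e0 : \rsum_(d <- gbox M) (ind (gdvd d n) * mu d) =
    (\rsum_(d <- gbox M) (ind (gdvd d n) * ind (gdvd p d) * mu d)) +
    \rsum_(d <- gbox M) (ind (gdvd d n) * ind (~ gdvd p d) * mu d).
  rewrite -big_split; apply: eq_bigr => d _ /=.
  by rewrite ind_not; ring.
rewrite e0; have -> : \rsum_(d <- gbox M) (ind (gdvd d n) * ind (gdvd p d) * mu d) =
    \rsum_(d <- gbox M) (ind (gdvd (gmul p d) n) * ind (gdvd p (gmul p d)) * mu (gmul p d)).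
  symmetry; apply: (@sum_reindex _ _ _ _ _ (gbox M) (gbox M) (gmul p)
    (fun d => ind (gdvd d n) * ind (gdvd p d) * mu d)).
  - exact: gbox_uniq.
  - exact: gbox_uniq.
  - by move=> x y; apply: gmulI.
  - move=> d _ h; apply: (dvd_gbox hn hN); apply: NNPP => /indF h0; apply: h.
    by rewrite h0; ring.
  - move=> d _ h; have hd : gdvd d n by apply: NNPP => /indF h0; apply: h; rewrite h0; ring.
    have [t ht] : gdvd p d by apply: NNPP => /indF h0; apply: h; rewrite h0; ring.
    exists t => //; apply: (dvd_gbox hn hN); apply: gdvd_trans hd.
    by rewrite ht; exists p; ring.
rewrite -big_split; apply: big1 => d _ /=.
rewrite (indT (gdvd_mulr p d)); case: (classic (gdvd p d)) => hd.
  by rewrite (mu_primeM_dvd hp hd) ind_not (indT hd); ring.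
rewrite (mu_primeM_ndvd hp hd) ind_not (indF hd).
rewrite (@ind_iff (gdvd (gmul p d) n) (gdvd d n)); first by ring.
split=> h; first by apply: gdvd_trans h; exists p; ring.
case: hpn => m hm; have : gdvd d m by apply: (gauss_prime hp hd); rewrite -hm.
by move=> [t ht]; exists t; rewrite hm ht; ring.
Qed.

(** * The von Mangoldt function *)

Definition primary (p n : gint) : Prop :=
  [/\ gprime p, n <> gzero, gdvd p n & forall r, gprime r -> gdvd r n -> gdvd p r].

(** The logarithm of the norm of the prime is taken. The choice of the prime is harmless, since two
    candidates divide each other and have equal norms. *)
Definition Lam (n : gint) : R :=
  if decP (exists p, primary p n)
  then ln (IZR (gnorm (epsilon (inhabits gone) (fun p => primary p n)))) else 0.

Lemma Lam_primary p n : primary p n -> Lam n = ln (IZR (gnorm p)).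
Proof.
move=> h; rewrite /Lam; case: decPP => [hex|]; last by case; exists p.
have := epsilon_spec (inhabits gone) (fun p => primary p n) hex.
move: (epsilon _ _) => q [hq hn hqn hall]; case: h => hp _ hpn hallp.
have h1 := gdvd_norm (prime_neq0 hq) (hallp q hq hqn).
have h2 := gdvd_norm (prime_neq0 hp) (hall p hp hpn).
by do 2 f_equal; lia.
Qed.

Lemma Lam_not n : ~ (exists p, primary p n) -> Lam n = 0.
Proof. by rewrite /Lam; case: decPP. Qed.

Lemma Lam0 : Lam gzero = 0.
Proof. by apply: Lam_not => -[p []]. Qed.

Lemma prime_primary p : gprime p -> primary p p.
Proof.
move=> hp; split=> //; [exact: prime_neq0 | exact: gdvd_refl | move=> r hr [t ht]].
have [s hs] : gunit t by apply: (@prime_unit_factor r) => //; rewrite -ht.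
exists s; rewrite ht; transitivity (gmul r (gmul t s)); [rewrite hs|]; ring.
Qed.

Lemma ln_norm_ge0 n : 0 <= ln (IZR (gnorm n)).
Proof.
case: (classic (n = gzero)) => [->|/gnorm_gt0 /IZR_le h].
  (* At zero the claim holds because [ln] takes the default value 0 outside the positive reals. *)
  by rewrite /ln; case: Rlt_dec => h; [case: (Rlt_irrefl 0) | lra].
rewrite -ln_1; case: (Req_dec 1 (IZR (gnorm n))) => [<-|h1]; first lra.
by left; apply: ln_increasing; lra.
Qed.

Lemma ln_norm_le m n : n <> gzero -> (gnorm m <= gnorm n)%Z ->
  ln (IZR (gnorm m)) <= ln (IZR (gnorm n)).
Proof.
move=> hn hmn; case: (classic (m = gzero)) => [->|/gnorm_gt0 /IZR_le h].
  have -> : ln (IZR (gnorm gzero)) = 0; last exact: ln_norm_ge0.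
  by rewrite /ln; case: Rlt_dec => h //; case: (Rlt_irrefl 0).
by apply: ln_le; [lra | apply: IZR_le].
Qed.

Lemma Lam_ge0 n : 0 <= Lam n.
Proof.
case: (classic (exists p, primary p n)) => [[p /Lam_primary ->]|/Lam_not ->]; last lra.
exact: ln_norm_ge0.
Qed.

Lemma Lam_le n : Lam n <= ln (IZR (gnorm n)).
Proof.
case: (classic (exists p, primary p n)) => [[p h]|/Lam_not ->]; last exact: ln_norm_ge0.
by rewrite (Lam_primary h); case: h => *; apply: ln_norm_le => //; apply: gdvd_norm.
Qed.

Fixpoint gpow (p : gint) (k : nat) : gint := if k is j.+1 then gmul p (gpow p j) else gone.

(** [primary] speaks of divisibility only; stripping factors p one at a time recovers the exponent
    and the unit. *)
Lemma primary_pow p n : primary p n -> exists u j, gunit u /\ n = gmul (gpow p j) u.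
Proof.
suff H n' : n' <> gzero -> gprime p -> (forall r, gprime r -> gdvd r n' -> gdvd p r) ->
    exists u j, gunit u /\ n' = gmul (gpow p j) u.
  by case=> *; apply: H.
move: n'; apply: gnorm_ind => m ih hm hp h.
case: (classic (gunit m)) => hu; first by exists m, O; split=> //=; ring.
have [r [hr hrm]] := prime_divisor hm hu.
have [t ht] := gdvd_trans (h r hr hrm) hrm.
have ht0 : t <> gzero by move=> h0; apply: hm; rewrite ht h0; ring.
case: (ih t) => //.
- by have := prime_norm hp; have := gnorm_gt0 ht0; rewrite ht gnorm_mul; nia.
- by move=> s hs hst; apply: h => //; apply: gdvd_trans hst _; exists p; rewrite ht; ring.
- move=> u [j [huu e]]; exists u, j.+1; split=> //; rewrite ht e /=; ring.
Qed.

Lemma gpow_neq0 p j : p <> gzero -> gpow p j <> gzero.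
Proof. by move=> hp; elim: j => [|j ih] //=; apply: gmul_neq0. Qed.

Lemma gpow_norm p j : gprime p -> (Z.of_nat j < gnorm (gpow p j))%Z.
Proof.
move=> /prime_norm hp; elim: j => [|j ih] //; rewrite [gpow _ _]/= gnorm_mul; nia.
Qed.

Lemma gpow_dvd p i j : (i <= j)%N -> gdvd (gpow p i) (gpow p j).
Proof.
elim: j i => [|j ih] [|i] // h; try (by exists (gpow p j.+1); rewrite /=; ring).
- exact: gdvd_refl.
- by have [t ht] := ih i h; exists t; rewrite /= ht; ring.
Qed.

Lemma gpow_prime_dvd p j r : gprime p -> gprime r -> gdvd r (gpow p j) -> gdvd p r.
Proof.
move=> hp hr; elim: j => [|j ih] /= h; first by case: (prime_ndvd_unit hr gunit1 h).
case: (hr) => _ [_ /(_ _ _ h)] [h1|/ih //].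
by case: (prime_primary hp) => _ _ _ /(_ r hr h1).
Qed.

Lemma max_pow p n : n <> gzero -> gprime p -> exists v,
  gdvd (gpow p v) n /\ ~ gdvd (gpow p v.+1) n.
Proof.
move=> hn hp; apply: NNPP => hno.
have H v : gdvd (gpow p v) n.
  elim: v => [|v ih]; first by exists n; rewrite /=; ring.
  by apply: NNPP => h; apply: hno; exists v.
have := gdvd_norm hn (H (Z.to_nat (gnorm n))).
by have := gpow_norm (Z.to_nat (gnorm n)) hp; have := gnorm_ge0 n; lia.
Qed.

Lemma primary_unit u : gunit u -> ~ exists p, primary p u.
Proof. by move=> hu [p [hp _ hd _]]; apply: (prime_ndvd_unit hp hu hd). Qed.

(** Induction from m to n = p m. If p^v is the exact power of p in n, the primary divisors of n that
    do not divide m are the associates of p^v: there are [nunits] of them, each of weight log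
    N(p). *)
Lemma Lam_sum M n : (1 <= M)%N -> n <> gzero -> (gnorm n <= Z.of_nat M * Z.of_nat M)%Z ->
  \rsum_(k <- gbox M) (ind (gdvd k n) * Lam k) = nunits * ln (IZR (gnorm n)).
Proof.
move=> hM; move: n; apply: gnorm_ind => n ih hn hN.
case: (classic (gunit n)) => hu.
  move/gunitP: (hu) => ->; rewrite ln_1 Rmult_0_r; apply: big1 => k _.
  case: (classic (gdvd k n)) => [[t ht]|/indF ->]; last by ring.
  by rewrite (@Lam_not k); [ring | apply: primary_unit; move: hu; rewrite ht; apply: gunit_mull].
have [p [hp hpn]] := prime_divisor hn hu; have hp0 := prime_neq0 hp.
case: (hpn) => m hm.
have hm0 : m <> gzero by move=> h0; apply: hn; rewrite hm h0; ring.
have hNm : (gnorm n = gnorm p * gnorm m)%Z by rewrite hm gnorm_mul.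
have hp2 := prime_norm hp; have hm1 := gnorm_gt0 hm0.
have hdm k : gdvd k m -> gdvd k n by move=> [t ht]; exists (gmul p t); rewrite hm ht; ring.
have {ih} ihm := ih m ltac:(nia) hm0 ltac:(nia).
have -> : ln (IZR (gnorm n)) = ln (IZR (gnorm p)) + ln (IZR (gnorm m)).
  by rewrite hNm mult_IZR ln_mult //; apply: IZR_lt; lia.
rewrite Rmult_plus_distr_l -ihm.
have [v [hv hv1]] := max_pow hn hp.
have hk0 := @gpow_neq0 p v hp0.
have -> : nunits * ln (IZR (gnorm p)) =
    \rsum_(k <- gbox M) (ind (exists u, gunit u /\ k = gmul (gpow p v) u) * ln (IZR (gnorm p))).
  rewrite -rsum_distr; congr (_ * _); rewrite -(nunits_box hM).
  rewrite -(@sum_reindex _ _ _ _ _ (gbox M) (gbox M) (gmul (gpow p v))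
    (fun k => ind (exists u, gunit u /\ k = gmul (gpow p v) u))).
  - apply: eq_bigr => u _; apply: ind_iff; split=> [h|[w [h1 h2]]]; first by exists u.
    by rewrite (gmulI hk0 h2).
  - exact: gbox_uniq.
  - exact: gbox_uniq.
  - by move=> x y; apply: gmulI.
  - move=> u _ h; have [w [hw e]] : exists w, gunit w /\ gmul (gpow p v) u = gmul (gpow p v) w.
      by apply: NNPP => /indF.
    rewrite e; apply: norm_gbox; rewrite gnorm_mul; move/gunitP: hw => ->.
    by have := gdvd_norm hn hv; lia.
  - move=> k _ h; have [w [hw e]] : exists w, gunit w /\ k = gmul (gpow p v) w.
      by apply: NNPP => /indF.
    by exists w => //; apply: norm_gbox; move/gunitP: hw => ->; lia.
rewrite -big_split; apply: eq_bigr => k _ /=.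
case: (classic (exists u, gunit u /\ k = gmul (gpow p v) u)) => hk.
  case: (hk) => u [hu1 e]; case: (hu1) => w hw.
  have ek : gpow p v = gmul k w.
    by rewrite e; transitivity (gmul (gpow p v) (gmul u w)); [rewrite hw|]; ring.
  have h1 : gdvd k n by apply: gdvd_trans hv; rewrite ek; exists w.
  have h2 : ~ gdvd k m.
    move=> [t ht]; apply: hv1; exists (gmul u t); rewrite hm ht e /=; ring.
  have hv0 : v <> O.
    by move=> h0; apply: hv1; rewrite h0 /=; case: hpn => t ht; exists t; rewrite ht; ring.
  have hpk : primary p k.
    split=> //; first by rewrite e; apply: gmul_neq0 => //; apply: gunit_neq0.
    - case: v hv0 e {hv hv1 hk0 hk ek} => // v _ e.
      by exists (gmul (gpow p v) u); rewrite e /=; ring.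
    - move=> r hr hrk; apply: (@gpow_prime_dvd _ v) => //; apply: gdvd_trans hrk _.
      by exists w.
  by rewrite (indT h1) (indF h2) (indT hk) (Lam_primary hpk); ring.
rewrite (indF hk).
case: (classic (gdvd k n)) => h1; last first.
  by rewrite (indF h1) indF; [ring | move/hdm].
case: (classic (gdvd k m)) => h2; first by rewrite (indT h1) (indT h2); ring.
rewrite Lam_not; first by ring.
move=> [q hq]; apply: hk; case: (hq) => hq1 hkz hqk hall.
have hpk : gdvd p k.
  by apply: NNPP => h; apply: h2; apply: (gauss_prime hp h); rewrite -hm.
have hqp : gdvd q p by apply: hall.
have hpq : gdvd p q by case: (prime_primary hp) => _ _ _ /(_ q hq1 hqp).
have hpp : primary p k by split=> // r hr hrk; apply: gdvd_trans hpq _; apply: hall.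
have [u [j [hu1 e]]] := primary_pow hpp.
suff -> : v = j by exists u.
have hjk : gdvd (gpow p j) k by rewrite e; exists u.
(* An exponent j > v contradicts the maximality of v, and j < v would make k divide m. *)
case: (ltngtP j v) => // hjv; last first.
  by case: hv1; apply: gdvd_trans (gdvd_trans hjk h1); apply: gpow_dvd.
case: h2; case: v hjv hv {hv1 hk0} => // v hjv [t ht].
have : m = gmul (gpow p v) t by apply: (gmulI hp0); rewrite -hm ht /=; ring.
move=> em; case: (hu1) => w hw; have [s hs] := @gpow_dvd p j v hjv.
exists (gmul w (gmul s t)); rewrite em e hs.
by transitivity (gmul (gmul u w) (gmul (gmul (gpow p j) s) t)); [rewrite hw|]; ring.
Qed.

(** * Vaughan's identity *)

(** Under this condition every variable of a multiple sum of F(d e) may range over the same box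
    [gbox M], because divisors of a point of the disc lie in the disc. *)
Definition supported (M : nat) (F : gint -> C) : Prop :=
  forall n, F n <> RtoC 0 -> n <> gzero /\ (gnorm n <= Z.of_nat M * Z.of_nat M)%Z.

Lemma supported_mul M F d : supported M F -> supported M (fun n => F (gmul d n)).
Proof.
move=> h n /h [h0 hN].
have hd : d <> gzero by move=> e; apply: h0; rewrite e; ring.
have hn : n <> gzero by move=> e; apply: h0; rewrite e; ring.
by split=> //; move: hN; rewrite gnorm_mul; have := gnorm_gt0 hd; have := gnorm_gt0 hn; nia.
Qed.

Lemma sum_multiples M F d : supported M F ->
  \csum_(e <- gbox M) F (gmul d e) = \csum_(n <- gbox M) (ind (gdvd d n) * F n).
Proof.
move=> hF; case: (classic (d = gzero)) => [->|hd].
  rewrite !big1 // => n _.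
    case: (classic (F n = RtoC 0)) => [->|/hF [hn _]]; first by ring.
    by rewrite indF; [ring | move=> [t ht]; apply: hn; rewrite ht; ring].
  by apply: NNPP => /hF [h _]; apply: h; ring.
rewrite -(@sum_reindex _ _ _ _ _ (gbox M) (gbox M) (gmul d)
  (fun n => (ind (gdvd d n) * F n)%C)).
- apply: eq_bigr => e _; rewrite indT; [ring | exact: gdvd_mulr].
- exact: gbox_uniq.
- exact: gbox_uniq.
- by move=> x y; apply: gmulI.
- move=> e _ h; have /hF [h1 h2] : F (gmul d e) <> RtoC 0.
    by move=> h0; apply: h; rewrite h0; ring.
  exact: norm_gbox.
- move=> n _ h; have /hF [h1 h2] : F n <> RtoC 0 by move=> h0; apply: h; rewrite h0; ring.
  have [t ht] : gdvd d n by apply: NNPP => /indF h0; apply: h; rewrite h0; ring.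
  exists t => //; apply: (dvd_gbox h1 h2); exists d; rewrite ht; ring.
Qed.

Lemma sum_conv M (a : gint -> R) F : supported M F ->
  \csum_(d <- gbox M) (a d * \csum_(e <- gbox M) F (gmul d e)) =
  \csum_(n <- gbox M) (RtoC (\rsum_(d <- gbox M) (ind (gdvd d n) * a d)) * F n).
Proof.
move=> hF; under eq_bigr => d _ do rewrite (sum_multiples d hF) csum_distl.
rewrite exchange_big /=; apply: eq_bigr => n _.
rewrite -csum_RtoC csum_distr; apply: eq_bigr => d _.
by rewrite RtoC_mult; ring.
Qed.

Arguments supported_mul [M F] d _ _ _.

Lemma gmul_assoc (u v w : gint) : gmul u (gmul v w) = gmul (gmul u v) w. Proof. by ring. Qed.
Lemma gmul_comm (u v : gint) : gmul u v = gmul v u. Proof. by ring. Qed.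

Lemma gmulK (z u v : gint) : gmul u v = gone -> gmul (gmul z u) v = z.
Proof. by move=> h; transitivity (gmul z (gmul u v)); [|rewrite h]; ring. Qed.

Lemma gmulKV (z u v : gint) : gmul u v = gone -> gmul (gmul z v) u = z.
Proof. by move=> h; transitivity (gmul z (gmul u v)); [|rewrite h]; ring. Qed.

Lemma Lam_unit u n : gunit u -> Lam (gmul n u) = Lam n.
Proof.
move=> [v hv].
have h a b p : gmul a b = gone -> primary p n -> primary p (gmul n a).
  move=> hab [hp hn hpn hall]; split=> //.
  - apply: gmul_neq0 => //; apply: gunit_neq0; by exists b.
  - by apply: gdvd_trans hpn _; apply: gdvd_mulr.
  - move=> r hr hrn; apply: hall => //; apply: gdvd_trans hrn _; exists b.
    by transitivity (gmul n (gmul a b)); [rewrite hab|]; ring.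
case: (classic (exists p, primary p n)) => [[p hp]|hn].
  by rewrite (Lam_primary hp) (Lam_primary (h _ _ _ hv hp)).
rewrite !Lam_not // => -[p [hp hn0 hpn hall]]; apply: hn; exists p.
have e : n = gmul (gmul n u) v by rewrite gmulK.
split=> //.
- by move=> h0; apply: hn0; rewrite h0; ring.
- by rewrite e; apply: gdvd_trans hpn _; apply: gdvd_mulr.
- by move=> r hr hrn; apply: hall => //; apply: gdvd_trans hrn _; apply: gdvd_mulr.
Qed.

Lemma sum_Lam_unit M F u : supported M F -> gunit u ->
  \csum_(k <- gbox M) (Lam k * F (gmul k u)) = \csum_(k <- gbox M) (Lam k * F k).
Proof.
move=> hF hu; case: (hu) => v hv.
rewrite -[RHS](@sum_reindex _ _ _ _ _ (gbox M) (gbox M) (fun k => gmul k u)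
  (fun k => (Lam k * F k)%C)).
- by apply: eq_bigr => k _; rewrite Lam_unit.
- exact: gbox_uniq.
- exact: gbox_uniq.
- move=> x y /(f_equal (gmul v)) h; have e z : gmul v (gmul z u) = z.
    by rewrite -[RHS](gmulK z hv); ring.
  by move: h; rewrite !e.
- move=> k _ h; have /hF [h1 h2] : F (gmul k u) <> RtoC 0.
    by move=> h0; apply: h; rewrite h0; ring.
  exact: norm_gbox.
- move=> k _ h; have /hF [h1 h2] : F k <> RtoC 0 by move=> h0; apply: h; rewrite h0; ring.
  have e := esym (gmulKV k hv).
  by exists (gmul k v) => //; apply: (dvd_gbox h1 h2); exists u.
Qed.

Section Vaughan.
Variables (M : nat) (F : gint -> C) (Y : Z).
Hypotheses (hM : (1 <= M)%N) (hF : supported M F).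

Definition lo (d : gint) : R := ind (gnorm d <= Y)%Z.
Definition hi (d : gint) : R := ind (~ (gnorm d <= Y)%Z).
(* Grouping the long variable as [m = k e] with [Lam k] inside makes both coefficients of the
   bilinear term, [mu] and [vbeta], pointwise at most logarithmic: no divisor bound is needed. *)
Definition vbeta (m : gint) : R := \rsum_(k <- gbox M) (ind (gdvd k m) * (hi k * Lam k)).
Definition vgamma (r : gint) : R :=
  \rsum_(k <- gbox M) \rsum_(d <- gbox M) (ind (r = gmul k d) * (lo k * Lam k * (lo d * mu d))).

Local Notation B := (gbox M).

Lemma sum_Lam_conv (G : gint -> C) : supported M G ->
  \csum_(k <- B) (Lam k * \csum_(e <- B) G (gmul k e)) =
  (nunits * \csum_(n <- B) (ln (IZR (gnorm n)) * G n))%C.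
Proof.
move=> hG; rewrite sum_conv // csum_distl; apply: eq_bigr => n _.
case: (classic (G n = RtoC 0)) => [->|/hG [h1 h2]]; first by ring.
by rewrite Lam_sum // RtoC_mult; ring.
Qed.

Lemma sum_mu_conv (G : gint -> C) : supported M G ->
  \csum_(k <- B) (mu k * \csum_(e <- B) G (gmul k e)) =
  (nunits * \csum_(n <- B) (ind (gunit n) * G n))%C.
Proof.
move=> hG; rewrite sum_conv // csum_distl; apply: eq_bigr => n _.
case: (classic (G n = RtoC 0)) => [->|/hG [h1 h2]]; first by ring.
by rewrite mu_sum // RtoC_mult; ring.
Qed.

Let T (k d : gint) : C := \csum_(e <- B) F (gmul (gmul k d) e).

(** Summing [mu] over d leaves only units e, with one factor [nunits]; as [Lam] is invariant under
    units, the sum over these units gives the second one. *)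
Lemma vaughan_total :
  \csum_(k <- B) (Lam k * \csum_(d <- B) (mu d * T k d)) =
  (nunits * (nunits * \csum_(n <- B) (Lam n * F n)))%C.
Proof.
have e k : \csum_(d <- B) (mu d * T k d) =
    (nunits * \csum_(u <- B) (ind (gunit u) * F (gmul k u)))%C.
  rewrite -(sum_mu_conv (supported_mul k hF)); apply: eq_bigr => d _; congr (_ * _)%C.
  by apply: eq_bigr => x _; rewrite gmul_assoc.
under eq_bigr => k _ do rewrite e csum_distl csum_distl.
rewrite exchange_big /=.
set S := \csum_(n <- B) (Lam n * F n).
transitivity (nunits * \csum_(u <- B) (ind (gunit u) * S))%C; last first.
  by rewrite -csum_distr csum_RtoC (nunits_box hM).
rewrite csum_distl; apply: eq_bigr => u _.
case: (classic (gunit u)) => hu.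
  rewrite (indT hu) /S -(sum_Lam_unit hF hu) !csum_distl; apply: eq_bigr => k _; ring.
by rewrite (indF hu) big1 => [|k _]; ring.
Qed.

Lemma vgammaE :
  \csum_(k <- B) \csum_(d <- B) (RtoC (lo k * Lam k * (lo d * mu d)) * T k d) =
  \csum_(r <- B) (vgamma r * \csum_(e <- B) F (gmul r e)).
Proof.
have -> : \csum_(r <- B) (vgamma r * \csum_(e <- B) F (gmul r e)) =
    \csum_(r <- B) \csum_(k <- B) \csum_(d <- B) (ind (r = gmul k d) *
      RtoC (lo k * Lam k * (lo d * mu d)) * T k d).
  apply: eq_bigr => r _; rewrite -csum_RtoC csum_distr; apply: eq_bigr => k _.
  rewrite -csum_RtoC csum_distr; apply: eq_bigr => d _; rewrite RtoC_mult.
  case: (classic (r = gmul k d)) => [->|/indF ->]; first by rewrite /T; ring.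
  by ring.
rewrite [RHS]exchange_big /=; apply: eq_bigr => k _.
rewrite [RHS]exchange_big /=; apply: eq_bigr => d _.
rewrite -csum_distr; case: (classic (gmul k d \in B)) => hkd.
  congr (_ * _)%C; rewrite (bigD1_seq (gmul k d) hkd (gbox_uniq M)) /=.
  rewrite indT // big1 => [|r /eqP hr]; first by ring.
  by rewrite (indF hr); ring.
have -> : T k d = RtoC 0; last by ring.
rewrite /T big1 // => x _; apply: NNPP => /hF [h1 h2]; apply: hkd.
by apply: (dvd_gbox h1 h2); apply: gdvd_mulr.
Qed.

(** The identity 1 = lo d + lo k - lo k lo d + hi k hi d is inserted in the triple sum over k, d, e
    of [vaughan_total]. In the first part the sum of [Lam] over k gives a logarithm, in the second
    the sum of [mu] over d leaves units, in the third k d is grouped into r, and in the fourth k e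
    into m. *)
Lemma vaughan :
  (nunits * (nunits * \csum_(n <- B) (Lam n * F n)))%C =
  (nunits * (\csum_(d <- B) (RtoC (lo d * mu d) *
                \csum_(n <- B) (ln (IZR (gnorm n)) * F (gmul d n))))
   + nunits * (\csum_(k <- B) (RtoC (lo k * Lam k) *
                \csum_(u <- B) (ind (gunit u) * F (gmul k u))))
   - (\csum_(r <- B) (vgamma r * \csum_(e <- B) F (gmul r e)))
   + (\csum_(d <- B) (RtoC (hi d * mu d) * \csum_(m <- B) (vbeta m * F (gmul d m)))))%C.
Proof.
rewrite -vaughan_total -vgammaE !csum_distl.
have e1 d : (nunits * (RtoC (lo d * mu d) *
    \csum_(n <- B) (ln (IZR (gnorm n)) * F (gmul d n))))%C =
    \csum_(k <- B) (RtoC (Lam k * (lo d * mu d)) * T k d).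
  transitivity (RtoC (lo d * mu d) * (nunits *
    \csum_(n <- B) (ln (IZR (gnorm n)) * F (gmul d n))))%C; first by ring.
  rewrite -(sum_Lam_conv (supported_mul d hF)) csum_distl; apply: eq_bigr => k _.
  rewrite !RtoC_mult /T; have -> : \csum_(x <- B) F (gmul (gmul k d) x) =
      \csum_(x <- B) F (gmul d (gmul k x)) by apply: eq_bigr => x _; rewrite gmul_assoc (gmul_comm d).
  by ring.
have e2 k : (nunits * (RtoC (lo k * Lam k) *
    \csum_(u <- B) (ind (gunit u) * F (gmul k u))))%C =
    \csum_(d <- B) (RtoC (lo k * Lam k * mu d) * T k d).
  transitivity (RtoC (lo k * Lam k) * (nunits *
    \csum_(u <- B) (ind (gunit u) * F (gmul k u))))%C; first by ring.
  rewrite -(sum_mu_conv (supported_mul k hF)) csum_distl; apply: eq_bigr => d _.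
  rewrite !RtoC_mult /T; have -> : \csum_(x <- B) F (gmul (gmul k d) x) =
      \csum_(x <- B) F (gmul k (gmul d x)) by apply: eq_bigr => x _; rewrite gmul_assoc.
  by ring.
have e3 d : (RtoC (hi d * mu d) * \csum_(m <- B) (vbeta m * F (gmul d m)))%C =
    \csum_(k <- B) (RtoC (hi k * Lam k * (hi d * mu d)) * T k d).
  rewrite /vbeta -(sum_conv _ (supported_mul d hF)) csum_distl; apply: eq_bigr => k _.
  rewrite !RtoC_mult /T; have -> : \csum_(x <- B) F (gmul (gmul k d) x) =
      \csum_(x <- B) F (gmul d (gmul k x)) by apply: eq_bigr => x _; rewrite gmul_assoc (gmul_comm d).
  by ring.
under [X in (X + _ - _ + _)%C]eq_bigr => d _ do rewrite e1.
under [X in (_ + X - _ + _)%C]eq_bigr => k _ do rewrite e2.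
under [X in (_ + _ - _ + X)%C]eq_bigr => d _ do rewrite e3.
rewrite [X in (X + _ - _ + _)%C]exchange_big [X in (_ + _ - _ + X)%C]exchange_big /=.
rewrite -big_split -csum_sub -big_split; apply: eq_bigr => k _ /=.
rewrite -big_split -csum_sub -big_split csum_distl; apply: eq_bigr => d _ /=.
rewrite /hi /lo !ind_not !(RtoC_mult, RtoC_minus); ring.
Qed.

End Vaughan.

(** * Exponential sums with weights of bounded variation *)

Definition e (t : R) : C := (cos (2 * PI * t), sin (2 * PI * t)).

Lemma e_add a b : e (a + b) = (e a * e b)%C.
Proof.
by rewrite /e Rmult_plus_distr_l cos_plus sin_plus /Cmult /=; f_equal; ring.
Qed.

Lemma e0 : e 0 = RtoC 1.
Proof. by rewrite /e Rmult_0_r cos_0 sin_0. Qed.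

Lemma e_mod t : Cmod (e t) = 1.
Proof.
rewrite /Cmod /e /= !Rmult_1_r -[_ * _]/(Rsqr _) -[_ * _ in X in _ + X]/(Rsqr _).
by rewrite Rplus_comm sin2_cos2 sqrt_1.
Qed.

Lemma e_opp t : e (- t) = Cconj (e t).
Proof. by rewrite /e /Cconj /= Ropp_mult_distr_r_reverse cos_neg sin_neg. Qed.

Lemma e_int (k : Z) : e (IZR k) = RtoC 1.
Proof.
have h (n : nat) : e (INR n) = RtoC 1.
  elim: n => [|n ih]; first exact: e0.
  rewrite S_INR e_add ih /e Rmult_1_r cos_2PI sin_2PI; apply: injective_projections => /=; ring.
case: (Z_le_dec 0 k) => hk; first by rewrite -(Z2Nat.id k hk) -INR_IZR_INZ.
have -> : IZR k = - INR (Z.to_nat (- k)).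
  by rewrite INR_IZR_INZ Z2Nat.id; [rewrite opp_IZR; ring | lia].
by rewrite e_opp h /Cconj /=; apply: injective_projections => /=; ring.
Qed.

(** This replaces the distance to the nearest integer: it equals 2 |sin(PI t)|, is at least twice
    that distance ([dis_lower]), and is exactly the factor produced by summation by parts. *)
Definition dis (t : R) : R := Cmod (1 - e t)%C.

Lemma dis_ge0 t : 0 <= dis t. Proof. exact: Cmod_ge_0. Qed.

Lemma dis_sin t : dis t = 2 * Rabs (sin (PI * t)).
Proof.
rewrite /dis /Cmod /e /=; have -> : 2 * PI * t = 2 * (PI * t) by ring.
rewrite cos_2a_sin sin_2a; set s := sin _; set c := cos _.
have h : s * s + c * c = 1 by have := sin2_cos2 (PI * t); rewrite /Rsqr.
have -> : 2 * Rabs s = sqrt (Rsqr (2 * s)).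
  by rewrite sqrt_Rsqr_abs Rabs_mult (Rabs_pos_eq 2); lra.
congr sqrt; rewrite /Rsqr; transitivity (4 * (s * s) * (s * s + c * c)); first by ring.
by rewrite h; ring.
Qed.

Lemma dis_opp t : dis (- t) = dis t.
Proof. by rewrite !dis_sin Ropp_mult_distr_r_reverse sin_neg Rabs_Ropp. Qed.

Lemma dis_shift t (k : Z) : dis (t - IZR k) = dis t.
Proof.
rewrite /dis /Rminus e_add -opp_IZR e_int; congr Cmod; ring.
Qed.

(** Here a = PI u satisfies 3 u <= a <= 2, and on that range the Taylor polynomial of degree 7, a
    lower bound for the sine, is at least a/3. *)
Lemma sin_lower u : 0 <= u <= 1/2 -> u <= sin (PI * u).
Proof.
move=> hu; have p1 := PI_4; have p2 := PI2_3_2; set a := PI * u.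
have ha : 3 * u <= a <= 2 by rewrite /a; nra.
clearbody a.
have [h _] := SIN a ltac:(lra) ltac:(nra).
apply: Rle_trans h; rewrite /sin_lb /sin_approx /sum_f_R0 /sin_term /=.
have hx : a * a <= 4 by nra.
have h1 : a / 3 <= a * (1 - a * a / 6 + (a * a) * (a * a) / 120 - (a * a) * (a * a) * (a * a) / 5040).
  have : 0 <= a * a by nra.
  move: hx; move: (a * a) => x hx hx0.
  have h2 : 0 <= x * x * (42 - x) by apply: Rmult_le_pos; nra.
  have -> : 1 - x / 6 + x * x / 120 - x * x * x / 5040 =
    1 - x / 6 + x * x * (42 - x) / 5040 by field.
  by rewrite /Rdiv; apply: Rmult_le_compat_l; lra.
apply: Rle_trans (Rle_trans _ _ _ (_ : u <= a / 3) h1) _; first by lra.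
by right; field.
Qed.

Lemma round_int x : exists k : Z, Rabs (x - IZR k) <= 1/2.
Proof.
exists (up (x - 1/2)); have [h1 h2] := archimed (x - 1/2).
by apply: Rabs_le; lra.
Qed.

Lemma dis_lower t (k : Z) : Rabs (t - IZR k) <= 1/2 -> 2 * Rabs (t - IZR k) <= dis t.
Proof.
rewrite -(dis_shift t k); move: (t - IZR k) => u hu.
have -> : dis u = dis (Rabs u) by rewrite /Rabs; case: Rcase_abs => _ //; rewrite dis_opp.
rewrite dis_sin; have h := Rabs_pos u.
have h1 := @sin_lower (Rabs u) ltac:(lra).
by have := Rle_abs (sin (PI * Rabs u)); lra.
Qed.

Definition near (s x : R) : Prop := exists k : Z, Rabs (x - IZR k) < s.

Lemma dis_not_near s x : ~ near s x -> 2 * s <= dis x.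
Proof.
move=> h; have [k hk] := round_int x; apply: Rle_trans (dis_lower hk).
by apply: Rmult_le_compat_l; [lra | apply: Rnot_lt_le => h1; apply: h; exists k].
Qed.

Lemma sum_iotaS (T : Type) (x0 : T) (op : Monoid.law x0) n (F : nat -> T) :
  \big[op/x0]_(i <- iota 0 n.+1) F i = op (\big[op/x0]_(i <- iota 0 n) F i) (F n).
Proof. by rewrite -addn1 iotaD big_cat /= big_cons big_nil Monoid.mulm1. Qed.

Lemma sum_zrange (T : Type) (x0 : T) (op : Monoid.law x0) N (F : Z -> T) :
  \big[op/x0]_(x <- zrange N) F x =
  \big[op/x0]_(i <- iota 0 (2 * N + 1)) F (Z.of_nat i - Z.of_nat N)%Z.
Proof.
rewrite /zrange; have -> : List.seq 0 (2 * N + 1) = iota 0 (2 * N + 1).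
  by move: (2 * N + 1)%N 0%N; elim=> [|n ih] m //=; rewrite ih.
by rewrite -(big_map (fun n => (Z.of_nat n - Z.of_nat N)%Z) predT).
Qed.

Definition bv (c : R) (w : Z -> R) : Prop := forall (a : Z) (n : nat),
  \rsum_(i <- iota 0 n) Rabs (w (a + Z.of_nat i + 1)%Z - w (a + Z.of_nat i)%Z) <= c.

Lemma abel (w : nat -> R) (b phi : R) n :
  ((1 - e phi) * \csum_(i <- iota 0 n.+1) (w i * e (b + INR i * phi)))%C =
  (w 0%N * e b - w n * e (b + INR n.+1 * phi) +
   \csum_(i <- iota 0 n) (RtoC (w i.+1 - w i) * e (b + INR i.+1 * phi)))%C.
Proof.
have e1 i : e (b + INR i.+1 * phi) = (e phi * e (b + INR i * phi))%C.
  by rewrite -e_add S_INR; congr e; ring.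
elim: n => [|n ih].
  rewrite /iota !big_cons !big_nil e1 [INR 0]/=; have -> : b + 0 * phi = b by ring.
  by ring.
rewrite sum_iotaS Cmult_plus_distr_l ih (e1 n.+1) [X in _ = (_ + X)%C]sum_iotaS -![Monoid.Law.sort _]/Cplus RtoC_minus; ring.
Qed.

(** Summation by parts: the two boundary terms give 2, the variation of the weight gives c. *)
Lemma row_sum c w b phi N : bv c w -> (forall y, Rabs (w y) <= 1) ->
  dis phi * Cmod (\csum_(y <- zrange N) (w y * e (b + IZR y * phi))) <= c + 2.
Proof.
move=> hb h1; rewrite /dis -Cmod_mult sum_zrange.
have -> : \csum_(i <- iota 0 (2 * N + 1)) (w (Z.of_nat i - Z.of_nat N)%Z *
     e (b + IZR (Z.of_nat i - Z.of_nat N) * phi)) =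
   \csum_(i <- iota 0 (2 * N).+1) (w (Z.of_nat i - Z.of_nat N)%Z *
     e ((b - INR N * phi) + INR i * phi)).
  rewrite addn1; apply: eq_bigr => i _; rewrite minus_IZR -!INR_IZR_INZ.
  by congr (_ * e _)%C; ring.
rewrite (abel (fun i => w (Z.of_nat i - Z.of_nat N)%Z)).
apply: Rle_trans (Cmod_triangle _ _) _.
have h2 : Cmod (\csum_(i <- iota 0 (2 * N)) (RtoC (w (Z.of_nat i.+1 - Z.of_nat N)%Z -
    w (Z.of_nat i - Z.of_nat N)%Z) * e (b - INR N * phi + INR i.+1 * phi))) <= c.
  apply: Rle_trans (csum_mod _ _) _; apply: Rle_trans (hb (- Z.of_nat N)%Z (2 * N)%N).
  apply: rsum_le => i; rewrite Cmod_mult e_mod Rmult_1_r Cmod_R; right.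
  by congr (Rabs (w _ - w _)); lia.
have h3 u v x y : Rabs u <= 1 -> Rabs v <= 1 -> Cmod (u * e x - v * e y)%C <= 2.
  move=> hu hv; apply: Rle_trans (Cmod_triangle _ _) _.
  by rewrite Cmod_opp !Cmod_mult !e_mod !Cmod_R; lra.
by have := h3 _ _ (b - INR N * phi) (b - INR N * phi + INR (2 * N).+1 * phi)
  (h1 (Z.of_nat 0 - Z.of_nat N)%Z) (h1 (Z.of_nat (2 * N) - Z.of_nat N)%Z); lra.
Qed.

Lemma size_zrange N : size (zrange N) = (2 * N + 1)%N.
Proof. by have := List.length_map (fun n => (Z.of_nat n - Z.of_nat N)%Z)
  (List.seq 0 (2 * N + 1)); rewrite List.length_seq. Qed.

Lemma nat_floor U : 0 <= U -> exists K : nat, INR K <= U < INR K + 1.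
Proof.
move=> hU; have [h1 h2] := archimed U.
have hup : (0 < up U)%Z by apply: lt_IZR; lra.
exists (Z.to_nat (up U - 1)); rewrite INR_IZR_INZ Z2Nat.id; last by lia.
by rewrite minus_IZR; lra.
Qed.

Lemma zabs_le_nat (x : Z) U K : INR K <= U < INR K + 1 -> Rabs (IZR x) <= U ->
  (Z.abs x <= Z.of_nat K)%Z.
Proof.
move=> h hx; rewrite -abs_IZR in hx.
suff : (Z.abs x < Z.of_nat K + 1)%Z by lia.
by apply: lt_IZR; rewrite plus_IZR -INR_IZR_INZ; lra.
Qed.

Lemma count_zrange N U : 0 <= U ->
  \rsum_(x <- zrange N) ind (Rabs (IZR x) <= U) <= 2 * U + 1.
Proof.
move=> hU; have [K hK] := nat_floor hU.
apply: (@Rle_trans _ (\rsum_(x <- zrange K) 1)).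
  apply: (@rsum_le_inj _ _ _ _ id) => //; first exact: zrange_uniq.
  - move=> x _ h; have hx : Rabs (IZR x) <= U by apply: NNPP => /indF.
    by rewrite indT //; split; [apply/mem_zrange; apply: zabs_le_nat hK hx | lra].
  - by move=> *; lra.
by rewrite rsum_const size_zrange plus_INR mult_INR /=; lra.
Qed.

(** A ball of the sup norm, which fits the enumeration by rows and columns and the cells of the
    spacing argument. *)
Definition inball (U : R) (n : gint) : Prop := Rabs (IZR n.1) <= U /\ Rabs (IZR n.2) <= U.

Lemma count_gbox N U : 0 <= U -> \rsum_(n <- gbox N) ind (inball U n) <= (2 * U + 1) ^ 2.
Proof.
move=> hU; rewrite list_prod_big /inball.
have -> : \rsum_(x <- zrange N) \rsum_(y <- zrange N)
    ind (Rabs (IZR (x, y).1) <= U /\ Rabs (IZR (x, y).2) <= U) =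
  (\rsum_(x <- zrange N) ind (Rabs (IZR x) <= U)) *
  \rsum_(x <- zrange N) ind (Rabs (IZR x) <= U).
  rewrite rsum_distr; apply: eq_bigr => x _; rewrite rsum_distl; apply: eq_bigr => y _.
  by rewrite ind_and.
have h := count_zrange N hU.
have : 0 <= \rsum_(x <- zrange N) ind (Rabs (IZR x) <= U).
  by apply: rsum_ge0 => x; case: (ind_bound (Rabs (IZR x) <= U)).
by move: h; move: (\rsum_(x <- _) _) => r; nra.
Qed.

Definition kap (al : cplx) : R := Rmax (dis (fst al)) (dis (snd al)).

(** Summation along rows gains [dis] of the imaginary part of al, summation along columns that of
    the real part; the better of the two gives [kap]. At most 2 U + 1 <= 3 U rows or columns meet
    the support. *)
Lemma lin_sum c (W : gint -> R) (al : cplx) N U :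
  (forall x, bv c (fun y => W (x, y))) -> (forall y, bv c (fun x => W (x, y))) ->
  (forall n, Rabs (W n) <= 1) -> (forall n, W n <> 0 -> inball U n) -> 1 <= U -> 0 <= c ->
  kap al * Cmod (\csum_(n <- gbox N) (W n * e (fst (gmulC n al)))) <= 3 * U * (c + 2).
Proof.
move=> hr hc h1 hs hU hc0; set S := \csum_(n <- _) _.
have key (w : Z -> Z -> R) (f : Z -> R) phi : (forall x, bv c (w x)) ->
    (forall x y, Rabs (w x y) <= 1) -> (forall x y, w x y <> 0 -> Rabs (IZR x) <= U) ->
    dis phi * Cmod (\csum_(x <- zrange N) \csum_(y <- zrange N)
      (w x y * e (f x + IZR y * phi))) <= 3 * U * (c + 2).
  move=> hb hw hsup.
  apply: (@Rle_trans _ (dis phi * \rsum_(x <- zrange N) Cmod (\csum_(y <- zrange N)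
      (w x y * e (f x + IZR y * phi))))).
    by apply: Rmult_le_compat_l; [exact: dis_ge0 | exact: csum_mod].
  rewrite rsum_distl.
  apply: (@Rle_trans _ (\rsum_(x <- zrange N) (ind (Rabs (IZR x) <= U) * (c + 2)))).
    apply: rsum_le => x; case: (classic (Rabs (IZR x) <= U)) => hx.
      by rewrite indT // Rmult_1_l; apply: row_sum.
    rewrite indF // big1 => [|y _]; first by rewrite Cmod_0; lra.
    have -> : w x y = 0 by apply: NNPP => /hsup.
    by ring.
  rewrite -rsum_distr; apply: Rmult_le_compat_r; first lra.
  by apply: Rle_trans (count_zrange N _) _; lra.
have k2 : dis (snd al) * Cmod S <= 3 * U * (c + 2).
  rewrite -dis_opp; apply: Rle_trans (key (fun x y => W (x, y))
    (fun x => IZR x * fst al) (- snd al) _ _ _) => //; last by move=> x y /hs [].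
  rewrite /S list_prod_big; right; do 2 f_equal.
  apply: eq_bigr => x _; apply: eq_bigr => y _; rewrite /gmulC /=.
  by congr (_ * e _)%C; ring.
have k1 : dis (fst al) * Cmod S <= 3 * U * (c + 2).
  apply: Rle_trans (key (fun y x => W (x, y))
    (fun y => - (IZR y * snd al)) (fst al) _ _ _) => //; last by move=> x y /hs [].
  rewrite /S list_prod_big exchange_big /=; right; do 2 f_equal.
  apply: eq_bigr => x _; apply: eq_bigr => y _; rewrite /gmulC /=.
  by congr (_ * e _)%C; ring.
by rewrite /kap /Rmax; case: Rle_dec.
Qed.

(** * Well-spaced multiples *)

Definition ainv (x : Z) : R := / Rmax 1 (Rabs (IZR x)).

Lemma ainv_gt0 x : 0 < ainv x.
Proof. by apply: Rinv_0_lt_compat; have := Rmax_l 1 (Rabs (IZR x)); lra. Qed.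

Lemma ainv_le1 x : ainv x <= 1.
Proof. by rewrite -[X in _ <= X]Rinv_1; apply: Rinv_le_contravar; [lra | exact: Rmax_l]. Qed.

Lemma harmonic_step (n : nat) : (1 <= n)%N -> / INR n.+1 <= ln (INR n.+1) - ln (INR n).
Proof.
move=> hn; have h0 : 1 <= INR n by have := le_INR 1 n ltac:(lia).
rewrite S_INR -ln_div; try lra.
have h : 0 < INR n / (INR n + 1) by apply: Rdiv_lt_0_compat; lra.
have -> : (INR n + 1) / INR n = / (INR n / (INR n + 1)) by field; lra.
rewrite ln_Rinv //; have := exp_ineq1_le (ln (INR n / (INR n + 1))).
rewrite exp_ln //; have -> : INR n / (INR n + 1) = 1 - / (INR n + 1) by field; lra.
by lra.
Qed.

Lemma harmonic N : (1 <= N)%N -> \rsum_(x <- zrange N) ainv x <= 3 + 2 * ln (INR N).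
Proof.
elim: N => [//|N ih] _; case: N ih => [_|N ih].
  apply: (@Rle_trans _ (\rsum_(x <- zrange 1) 1)); first exact: (rsum_le _ ainv_le1).
  by rewrite rsum_const size_zrange /= ln_1; lra.
have h := ih isT; have hs := @harmonic_step N.+1 isT.
have e1 z : Z.abs z = Z.of_nat N.+2 -> ainv z = / INR N.+2.
  move=> hz; rewrite /ainv -abs_IZR hz -INR_IZR_INZ Rmax_right // S_INR.
  by have := pos_INR N.+1; lra.
have -> : \rsum_(x <- zrange N.+2) ainv x =
    \rsum_(x <- [:: Z.of_nat N.+2, (- Z.of_nat N.+2)%Z & zrange N.+1]) ainv x.
  apply: perm_big; apply: uniq_perm; first exact: zrange_uniq.
    rewrite 2!cons_uniq zrange_uniq andbT in_cons negb_or; apply/andP; split.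
      by apply/andP; split; [apply/eqP; lia | apply/negP => /mem_zrange; lia].
    by apply/negP => /mem_zrange; lia.
  move=> x; rewrite 2!in_cons; apply/idP/idP.
    move=> h0; have hx := elimT (mem_zrange N.+2 x) h0; apply/orP; case: (Z.eq_dec (Z.abs x) (Z.of_nat N.+2)) => h1.
      case: (Z.eq_dec x (Z.of_nat N.+2)) => h2; [left | right; apply/orP; left];
        by apply/eqP; lia.
    by right; apply/orP; right; apply: (introT (mem_zrange N.+1 x)); lia.
  move=> /orP [/eqP h1|/orP [/eqP h1|h1]]; apply: (introT (mem_zrange N.+2 x)); try lia.
  by have := elimT (mem_zrange N.+1 x) h1; lia.
by rewrite 2!big_cons !e1; [lra | lia | lia].
Qed.

Definition spaced (th : cplx) (r s : R) : Prop := forall n : gint, n <> gzero ->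
  inball r n -> ~ (near s (fst (gmulC n th)) /\ near s (snd (gmulC n th))).

Lemma spaced_kap th r s n : spaced th r s -> n <> gzero -> inball r n ->
  2 * s <= kap (gmulC n th).
Proof.
move=> h hn hr; have := h n hn hr => h1.
have := Rmax_l (dis (fst (gmulC n th))) (dis (snd (gmulC n th))).
have := Rmax_r (dis (fst (gmulC n th))) (dis (snd (gmulC n th))); rewrite -/(kap _).
case: (classic (near s (fst (gmulC n th)))) => h2.
  by have := @dis_not_near s (snd (gmulC n th)) ltac:(tauto); lra.
by have := dis_not_near h2; lra.
Qed.

Lemma gmulC_sub m n (th : cplx) :
  gmulC (gsub m n) th = (fst (gmulC m th) - fst (gmulC n th), snd (gmulC m th) - snd (gmulC n th)).
Proof.
by rewrite /gmulC /gsub /gadd /gopp /= !plus_IZR !opp_IZR; f_equal; ring.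
Qed.

Lemma gmulC_mul m n (th : cplx) : gmulC (gmul m n) th = gmulC m (gmulC n th).
Proof.
by rewrite /gmulC /gmul /= !(plus_IZR, minus_IZR, mult_IZR); f_equal; ring.
Qed.

Lemma inball_gbox K n : inball (INR K) n <-> n \in gbox K.
Proof.
rewrite /inball -!abs_IZR INR_IZR_INZ; split.
  by move=> [/le_IZR h1 /le_IZR h2]; apply/mem_gbox.
by move=> /mem_gbox [h1 h2]; split; apply: IZR_le.
Qed.

Lemma inball_sub U m n : inball U m -> inball U n -> inball (2 * U) (gsub m n).
Proof.
move=> [h1 h2] [h3 h4]; rewrite /inball /gsub /gadd /gopp /= !plus_IZR !opp_IZR.
split; apply: Rle_trans (Rabs_triang _ _) _; rewrite Rabs_Ropp; lra.
Qed.

Lemma inball_le U V n : U <= V -> inball U n -> inball V n.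
Proof. by move=> h []; split; lra. Qed.

Lemma gsub_eq0 m n : gsub m n = gzero -> m = n.
Proof.
by move=> h; transitivity (gadd (gsub m n) n); [ring | rewrite h; ring].
Qed.

Definition frac (x : R) : R := x - IZR (epsilon (inhabits 0%Z) (fun k => Rabs (x - IZR k) <= 1/2)).

Lemma fracP x : exists k, frac x = x - IZR k /\ Rabs (x - IZR k) <= 1/2.
Proof.
rewrite /frac; exists (epsilon (inhabits 0%Z) (fun k => Rabs (x - IZR k) <= 1/2)); split=> //.
exact: (epsilon_spec (inhabits 0%Z) (fun k => Rabs (x - IZR k) <= 1/2) (round_int x)).
Qed.

Definition cell (s x : R) : Z := (up (frac x / s) - 1)%Z.

Lemma cellP s x : 0 < s -> s * IZR (cell s x) <= frac x < s * IZR (cell s x) + s.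
Proof.
move=> hs; rewrite /cell minus_IZR; have [h1 h2] := archimed (frac x / s).
have e : frac x = s * (frac x / s) by field; lra.
move: e h1 h2; move: (frac x / s) (IZR (up _)) => t k -> h1 h2.
by split; nra.
Qed.

Lemma cell_near s x y : 0 < s -> cell s x = cell s y -> near s (x - y).
Proof.
move=> hs h; have := cellP x hs; have := cellP y hs; rewrite h.
have [k [-> _]] := fracP x; have [l [-> _]] := fracP y => h1 h2.
by exists (k - l)%Z; rewrite minus_IZR; apply: Rabs_def1; lra.
Qed.

Lemma cell_bound s x : 0 < s -> s * Rabs (IZR (cell s x)) <= Rabs (frac x) + s.
Proof.
move=> hs; have := cellP x hs; move: (IZR _) => c h.
have hm : s * Rabs c = Rabs (s * c) by rewrite Rabs_mult (Rabs_pos_eq s); lra.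
by rewrite hm /Rabs; case: Rcase_abs; case: Rcase_abs; lra.
Qed.

Lemma frac_dis x : 2 * Rabs (frac x) <= dis x.
Proof. by have [k [-> h]] := fracP x; apply: dis_lower. Qed.

(* Multiples of [th] by elements of the box lie in distinct cells of side [s], and
   [1 / max(1,|i|,|j|)^2 <= ainv i * ainv j]. *)
Lemma spaced_sum th r s K M : spaced th r s -> 0 < s -> 2 * INR K <= r ->
  / (2 * s) + 1 <= INR M -> (1 <= M)%N ->
  \rsum_(n <- gbox K) (ind (n <> gzero) * / (kap (gmulC n th) * kap (gmulC n th))) <=
  (3 + 2 * ln (INR M)) ^ 2 / (s * s).
Proof.
move=> hsp hs hK hM hM1.
apply: (@Rle_trans _ (\rsum_(z <- gbox M) (ainv z.1 * ainv z.2 / (s * s)))); last first.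
  rewrite list_prod_big /Rdiv.
  have -> : \rsum_(x <- zrange M) \rsum_(y <- zrange M) (ainv (x, y).1 * ainv (x, y).2 * / (s * s))
     = (\rsum_(x <- zrange M) ainv x) * (\rsum_(x <- zrange M) ainv x) * / (s * s).
    rewrite !rsum_distr; apply: eq_bigr => x _; rewrite rsum_distl rsum_distr.
    by apply: eq_bigr => y _ /=.
  have hA := harmonic hM1; have hA0 : 0 <= \rsum_(x <- zrange M) ainv x.
    by apply: rsum_ge0 => x; have := ainv_gt0 x; lra.
  apply: Rmult_le_compat_r; last by nra.
  by apply: Rlt_le; apply: Rinv_0_lt_compat; nra.
pose phi (n : gint) : gint := (cell s (fst (gmulC n th)), cell s (snd (gmulC n th))).
apply: (@rsum_le_inj _ _ _ _ phi); first exact: gbox_uniq.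
- move=> m n /inball_gbox hm /inball_gbox hn _ _ [] h1 h2; apply: NNPP => hmn.
  apply: (hsp (gsub m n)); first by move/gsub_eq0.
  + by apply: inball_le (inball_sub hm hn).
  + by rewrite gmulC_sub /=; split; apply: cell_near.
- move=> n /inball_gbox hn hne; have hn0 : n <> gzero.
    by apply: NNPP => h; apply: hne; rewrite indF //; ring.
  have hk := spaced_kap hsp hn0 (@inball_le (INR K) r n ltac:(have := pos_INR K; lra) hn).
  (* A cell of index i satisfies s |i| <= |frac x| + s, and both 2 |frac x| and 2 s are at most
     [kap], the latter by spacing; hence s max(1,|i|) <= [kap]. The lower bound on M keeps all
     indices in the box. *)
  have hx x : dis x <= kap (gmulC n th) -> s * Rmax 1 (Rabs (IZR (cell s x))) <= kap (gmulC n th)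
      /\ (Z.abs (cell s x) <= Z.of_nat M)%Z.
    move=> hx; have h1 := frac_dis x; have h2 := cell_bound x hs.
    split; first by rewrite /Rmax; case: Rle_dec => _; lra.
    apply: le_IZR; rewrite abs_IZR -INR_IZR_INZ; apply: Rle_trans hM.
    have [k [ek h3]] := fracP x; rewrite -ek in h3.
    apply: (Rmult_le_reg_l s) => //.
    have -> : s * (/ (2 * s) + 1) = 1/2 + s by field; lra.
    by lra.
  have [h1 h1'] := hx _ (Rmax_l (dis (fst (gmulC n th))) (dis (snd (gmulC n th)))).
  have [h2 h2'] := hx _ (Rmax_r (dis (fst (gmulC n th))) (dis (snd (gmulC n th)))).
  split; first by apply/mem_gbox.
  rewrite (indT hn0) Rmult_1_l /phi /ainv /=.
  have p1 := Rmax_l 1 (Rabs (IZR (cell s (fst (gmulC n th))))).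
  have p2 := Rmax_l 1 (Rabs (IZR (cell s (snd (gmulC n th))))).
  move: p1 p2 h1 h2; set u := Rmax 1 _; set v := Rmax 1 _ => p1 p2 h1 h2.
  have -> : / u * / v / (s * s) = / ((s * u) * (s * v)) by field; lra.
  apply: Rinv_le_contravar; first by apply: Rmult_lt_0_compat; nra.
  by apply: Rmult_le_compat; nra.
- move=> z; have := ainv_gt0 z.1; have := ainv_gt0 z.2 => h1 h2.
  apply: Rlt_le; apply: Rdiv_lt_0_compat; nra.
Qed.

(** * Type I and type II sums *)

Definition nrm (n : gint) : R := IZR (gnorm n).

Lemma nrm_mul m n : nrm (gmul m n) = nrm m * nrm n.
Proof. by rewrite /nrm gnorm_mul mult_IZR. Qed.

Lemma nrm_ge1 n : n <> gzero -> 1 <= nrm n.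
Proof. by move=> /gnorm_gt0 /IZR_le. Qed.

Lemma nrmE n : nrm n = IZR n.1 * IZR n.1 + IZR n.2 * IZR n.2.
Proof. by rewrite /nrm /gnorm plus_IZR !mult_IZR. Qed.

Lemma inball_nrm U n : 0 <= U -> nrm n <= U * U -> inball U n.
Proof. by move=> hU; rewrite nrmE => h; split; apply: Rabs_le; nra. Qed.

Lemma inball_small U n : U < 1 -> inball U n -> n = gzero.
Proof.
move=> hU; rewrite /inball -!abs_IZR => -[h1 h2].
have [k1 k2] : (Z.abs n.1 < 1)%Z /\ (Z.abs n.2 < 1)%Z by split; apply: lt_IZR; lra.
by case: n h1 h2 k1 k2 => x y /= *; rewrite /gzero; f_equal; lia.
Qed.

Lemma inball_floor U : 0 <= U -> exists K : nat, INR K <= U /\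
  forall n, inball U n -> n \in gbox K.
Proof.
move=> hU; have [K hK] := nat_floor hU; exists K; split; first by lra.
by move=> n [h1 h2]; apply/mem_gbox; split; apply: zabs_le_nat hK _.
Qed.

Lemma inv_nrm_sum M : (1 <= M)%N ->
  \rsum_(n <- gbox M) (ind (n <> gzero) * / nrm n) <= (3 + 2 * ln (INR M)) ^ 2.
Proof.
move=> hM; apply: (@Rle_trans _ (\rsum_(n <- gbox M) (ainv n.1 * ainv n.2))).
  apply: rsum_le => n; case: (classic (n = gzero)) => hn.
    by rewrite indF //; have := ainv_gt0 n.1; have := ainv_gt0 n.2; nra.
  rewrite indT // Rmult_1_l /ainv; have := nrm_ge1 hn; rewrite nrmE.
  have p1 := Rmax_l 1 (Rabs (IZR n.1)); have p2 := Rmax_l 1 (Rabs (IZR n.2)).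
  move=> h; rewrite -Rinv_mult; apply: Rinv_le_contravar; first by nra.
  have sq z : Rabs z * Rabs z = z * z by rewrite -Rabs_mult Rabs_pos_eq; nra.
  have a1 := Rabs_pos (IZR n.1); have a2 := Rabs_pos (IZR n.2).
  have s1 := sq (IZR n.1); have s2 := sq (IZR n.2).
  rewrite /Rmax; case: Rle_dec => h1; case: Rle_dec => h2; nra.
rewrite list_prod_big.
have -> : \rsum_(x <- zrange M) \rsum_(y <- zrange M) (ainv (x, y).1 * ainv (x, y).2)
     = (\rsum_(x <- zrange M) ainv x) * (\rsum_(x <- zrange M) ainv x).
  by rewrite !rsum_distr; apply: eq_bigr => x _; rewrite rsum_distl.
have hA := harmonic hM; have hA0 : 0 <= \rsum_(x <- zrange M) ainv x.
  by apply: rsum_ge0 => x; have := ainv_gt0 x; lra.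
by nra.
Qed.

Section Bounds.
Variables (M : nat) (th : cplx) (r s c0 : R).
Hypotheses (hM : (1 <= M)%N) (hsp : spaced th r s) (hs : 0 < s)
  (hsM : / (2 * s) + 1 <= INR M) (hc0 : 0 <= c0).

Let m : R := INR M.
Let L : R := 3 + 2 * ln (INR M).
Let ph (n : gint) : C := e (fst (gmulC n th)).

Fact m_ge1 : 1 <= m. Proof. by have := le_INR 1 M ltac:(lia). Qed.
Fact L_ge3 : 3 <= L.
Proof.
rewrite /L; have : 0 <= ln (INR M); last lra.
by rewrite -ln_1; apply: ln_le; [lra | exact: m_ge1].
Qed.

Definition bvW (w : gint -> R) : Prop :=
  (forall x, bv c0 (fun y => w (x, y))) /\ (forall y, bv c0 (fun x => w (x, y))).

Definition weight_supp (w : gint -> R) : Prop :=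
  (forall n, Rabs (w n) <= 1) /\ (forall n, w n <> 0 -> n <> gzero /\ nrm n <= m * m).

Lemma lin_sum_dil (w : gint -> R) (d : gint) : d <> gzero -> bvW w ->
  (forall n, Rabs (w n) <= 1) ->
  (forall n, w n <> 0 -> gmul d n <> gzero /\ nrm (gmul d n) <= m * m) ->
  kap (gmulC d th) * Cmod (\csum_(n <- gbox M) (w n * ph (gmul d n))) <=
  3 * (m / sqrt (nrm d)) * (c0 + 2).
Proof.
move=> hd [h1 h2] h3 h4; have hN := nrm_ge1 hd.
have hq : 1 <= sqrt (nrm d) by rewrite -sqrt_1; apply: sqrt_le_1_alt.
have hqq : sqrt (nrm d) * sqrt (nrm d) = nrm d by apply: sqrt_sqrt; lra.
have hm := m_ge1; set U := m / sqrt (nrm d).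
have hU0 : 0 < U by apply: Rdiv_lt_0_compat; lra.
have hUU : U * U * nrm d = m * m by rewrite -hqq /U; field; lra.
have hsupp n : w n <> 0 -> n <> gzero /\ inball U n.
  move=> /h4 [h5 h6]; split; first by move=> h0; apply: h5; rewrite h0; ring.
  apply: inball_nrm; first lra.
  by rewrite nrm_mul in h6; apply: (Rmult_le_reg_l (nrm d)); lra.
(* A square of half-side less than 1 contains only zero, where the weight vanishes; [lin_sum] needs
   1 <= U. *)
case: (Rlt_le_dec U 1) => hU.
  rewrite big1 => [|n _].
    by rewrite Cmod_0 Rmult_0_r; apply: Rmult_le_pos; lra.
  suff -> : w n = 0 by ring.
  by apply: NNPP => /hsupp [h0]; move/(inball_small hU).
have -> : \csum_(n <- gbox M) (w n * ph (gmul d n)) =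
    \csum_(n <- gbox M) (w n * e (fst (gmulC n (gmulC d th)))).
  by apply: eq_bigr => n _; rewrite /ph -gmulC_mul gmul_comm.
by apply: lin_sum => // n /hsupp [].
Qed.

Lemma kap_ge0 al : 0 <= kap al.
Proof. by apply: Rle_trans (dis_ge0 (fst al)) _; apply: Rmax_l. Qed.

Lemma type1 (c : gint -> R) (w : gint -> gint -> R) A U : 0 <= U -> 2 * U <= r -> 0 <= A ->
  (forall d, Rabs (c d) <= A) -> (forall d, c d <> 0 -> inball U d) ->
  (forall d, d <> gzero -> bvW (w d)) -> (forall d n, Rabs (w d n) <= 1) ->
  (forall d n, w d n <> 0 -> gmul d n <> gzero /\ nrm (gmul d n) <= m * m) ->
  \rsum_(d <- gbox M) (Rabs (c d) * Cmod (\csum_(n <- gbox M) (w d n * ph (gmul d n)))) <=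
  A * (3 * m * (c0 + 2)) * (L * (L / s)).
Proof.
move=> hU hr hA hcA hcU hb h1 h2.
have [K [hK hKU]] := inball_floor hU.
have hL := L_ge3; have hm := m_ge1.
pose k d := kap (gmulC d th).
apply: (@Rle_trans _ (\rsum_(d <- gbox M) (A * (3 * m * (c0 + 2)) *
   ((ind (d <> gzero) * / sqrt (nrm d)) * (ind (d <> gzero /\ inball U d) * / k d))))).
  apply: rsum_le => d; case: (classic (c d = 0)) => hcd.
    rewrite hcd Rabs_R0 Rmult_0_l; apply: Rmult_le_pos.
      by apply: Rmult_le_pos => //; apply: Rmult_le_pos; lra.
    case: (classic (d = gzero)) => hd; first by rewrite indF //; lra.
    have hinv : 0 < / sqrt (nrm d).
      by apply: Rinv_0_lt_compat; apply: sqrt_lt_R0; have := nrm_ge1 hd; lra.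
    rewrite indT //; case: (classic (inball U d)) => hdU; last by rewrite (@indF (_ /\ _)); [lra | tauto].
    rewrite indT //; have := spaced_kap hsp hd (inball_le _ hdU) => hk.
    have : 0 < / k d by apply: Rinv_0_lt_compat; have := hk ltac:(lra); rewrite /k; lra.
    by nra.
  case: (classic (d = gzero)) => hd.
    rewrite indF // !(Rmult_0_l, Rmult_0_r) big1 => [|n _]; first by rewrite Cmod_0; lra.
    suff -> : w d n = 0 by ring.
    by apply: NNPP => /h2 [h _]; apply: h; rewrite hd; ring.
  have hdU := hcU d hcd.
  rewrite !indT // !Rmult_1_l.
  have hk : 2 * s <= k d by apply: spaced_kap hsp hd (inball_le _ hdU); lra.
  have hq : 0 < sqrt (nrm d) by apply: sqrt_lt_R0; have := nrm_ge1 hd; lra.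
  have := lin_sum_dil hd (hb d hd) (h1 d) (h2 d); rewrite -/(k d).
  set S := Cmod _ => hS; have hS0 : 0 <= S by exact: Cmod_ge_0.
  have -> : A * (3 * m * (c0 + 2)) * (/ sqrt (nrm d) * / k d) =
      A * ((3 * (m / sqrt (nrm d)) * (c0 + 2)) * / k d) by field; lra.
  apply: Rmult_le_compat => //; first exact: Rabs_pos.
  apply: (Rmult_le_reg_l (k d)); first lra.
  by apply: Rle_trans hS _; right; field; lra.
rewrite -rsum_distl; apply: Rmult_le_compat_l.
  by apply: Rmult_le_pos => //; apply: Rmult_le_pos; lra.
apply: Rle_trans (Rle_abs _) _; apply: Rle_trans (rsum_CS _ _ _) _.
apply: Rmult_le_compat; try exact: sqrt_pos.
  rewrite -[L](sqrt_Rsqr); last lra.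
  apply: sqrt_le_1_alt; rewrite /Rsqr; have := inv_nrm_sum hM; rewrite -/L.
  have -> : L ^ 2 = L * L by ring.
  apply: Rle_trans; apply: rsum_le => d; case: (classic (d = gzero)) => hd.
    by rewrite !indF //; lra.
  rewrite !indT // !Rmult_1_l -Rinv_mult sqrt_sqrt; first lra.
  by have := nrm_ge1 hd; lra.
rewrite -[L / s](sqrt_Rsqr); last by apply: Rlt_le; apply: Rdiv_lt_0_compat; lra.
apply: sqrt_le_1_alt; have := @spaced_sum th r s K M hsp hs ltac:(lra) hsM hM.
rewrite -/L; have -> : Rsqr (L / s) = L ^ 2 / (s * s) by rewrite /Rsqr; field; lra.
apply: Rle_trans.
apply: (@rsum_le_inj _ _ _ _ id) => //; first exact: gbox_uniq.
- move=> d _ h; have [hd hdU] : d <> gzero /\ inball U d.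
    by apply: NNPP => h0; apply: h; rewrite indF //; ring.
  split; first exact: hKU.
  rewrite !indT // !Rmult_1_l -Rinv_mult /k; lra.
- move=> d; case: (classic (d = gzero)) => hd; first by rewrite indF //; lra.
  rewrite indT // Rmult_1_l; case: (Req_dec (kap (gmulC d th)) 0) => [->|hk].
    by rewrite Rmult_0_l Rinv_0; lra.
  have := kap_ge0 (gmulC d th) => h0.
  by apply: Rlt_le; apply: Rinv_0_lt_compat; nra.
Qed.

(** Cauchy's inequality applied to [spaced_sum]; the factor 2 K + 1 is the square root of the number
    of points of the box. *)
Lemma inv_kap_sum K : 2 * INR K <= r ->
  \rsum_(n <- gbox K) (ind (n <> gzero) * / kap (gmulC n th)) <= (2 * INR K + 1) * (L / s).
Proof.
move=> hK; have hL := L_ge3.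
have -> : \rsum_(n <- gbox K) (ind (n <> gzero) * / kap (gmulC n th)) =
    \rsum_(n <- gbox K) (ind (n <> gzero) * (ind (n <> gzero) * / kap (gmulC n th))).
  apply: eq_bigr => n _; case: (classic (n <> gzero)) => h.
    by rewrite (indT h); ring.
  by rewrite (indF h); ring.
apply: Rle_trans (Rle_abs _) _; apply: Rle_trans (rsum_CS _ _ _) _.
apply: Rmult_le_compat; try exact: sqrt_pos.
  have hK0 := pos_INR K; rewrite -[2 * INR K + 1](sqrt_Rsqr); last lra.
  apply: sqrt_le_1_alt; have := count_gbox K hK0.
  have -> : Rsqr (2 * INR K + 1) = (2 * INR K + 1) ^ 2 by rewrite /Rsqr; ring.
  apply: Rle_trans; apply: rsum_le_in => n /inball_gbox hn; rewrite (indT hn).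
  exact: ind_sq_le1.
rewrite -[L / s](sqrt_Rsqr); last by apply: Rlt_le; apply: Rdiv_lt_0_compat; lra.
apply: sqrt_le_1_alt; have := @spaced_sum th r s K M hsp hs hK hsM hM.
rewrite -/L; have -> : Rsqr (L / s) = L ^ 2 / (s * s) by rewrite /Rsqr; field; lra.
apply: Rle_trans; apply: rsum_le_in => n /inball_gbox hn.
case: (classic (n <> gzero)) => hn0; last first.
  by rewrite !(indF hn0) !Rmult_0_l; exact: Rle_refl.
by rewrite !(indT hn0) !Rmult_1_l -Rinv_mult; lra.
Qed.

Lemma gsubI (x a b : gint) : gsub x a = gsub x b -> a = b.
Proof. by move=> h; transitivity (gsub x (gsub x a)); [|rewrite h]; ring. Qed.

(** The differences n1 - n are distinct nonzero points of the ball of radius 4 V, and spacing of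
    multiples is needed up to twice that radius, whence 8 V <= r. *)
Lemma inv_kap_shift N V n1 : 0 <= V -> 8 * V <= r -> inball (2 * V) n1 ->
  \rsum_(n <- gbox N) (ind (inball (2 * V) n /\ n1 <> n) * / kap (gmulC (gsub n1 n) th)) <=
  (8 * V + 1) * (L / s).
Proof.
move=> hV hr h1; have hL := L_ge3.
have [K [hK hKV]] := @inball_floor (4 * V) ltac:(lra).
apply: (@Rle_trans _ ((2 * INR K + 1) * (L / s))); last first.
  by apply: Rmult_le_compat_r; [apply: Rlt_le; apply: Rdiv_lt_0_compat |]; lra.
apply: Rle_trans (@inv_kap_sum K ltac:(lra)).
apply: (@rsum_le_inj _ _ _ _ (gsub n1)); first exact: gbox_uniq.
- by move=> a b _ _ _ _; exact: gsubI.
- move=> n _ h; have [hn hn1] : inball (2 * V) n /\ n1 <> n.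
    by apply: NNPP => h0; apply: h; rewrite indF //; ring.
  split; last by rewrite !indT //; [lra | move/gsub_eq0].
  by apply: hKV; apply: inball_le (inball_sub h1 hn); lra.
- move=> d; case: (classic (d = gzero)) => hd; first by rewrite indF //; lra.
  rewrite indT // Rmult_1_l; case: (Req_dec (kap (gmulC d th)) 0) => [->|hk].
    by rewrite Rinv_0; lra.
  have := kap_ge0 (gmulC d th) => h0.
  by apply: Rlt_le; apply: Rinv_0_lt_compat; lra.
Qed.

Lemma Cmod_sqr z : (z * Cconj z)%C = RtoC (Cmod z * Cmod z).
Proof.
case: z => x y; rewrite /Cmod sqrt_sqrt /=; last by nra.
by rewrite /Cmult /Cconj /RtoC /=; f_equal; ring.
Qed.

Lemma ph_conj a b : (ph a * Cconj (ph b))%C = ph (gsub a b).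
Proof. by rewrite /ph -e_opp -e_add gmulC_sub. Qed.

Variable W : gint -> R.
Hypotheses (hW : weight_supp W)
  (hbW : forall n1 n2, n1 <> gzero -> n2 <> gzero ->
    bvW (fun z => W (gmul n1 z) * W (gmul n2 z))).

Let F (n : gint) : C := (W n * ph n)%C.

(* The correlations left after Cauchy-Schwarz: [z] runs over lattice points of an intersection of
   rotated regions, seen only through the variation of the weight along rows and columns. *)
Lemma corr_bound V n1 n2 : 0 < V -> 1 <= m / V -> 8 * V <= r ->
  V * V <= nrm n1 <= 4 * (V * V) -> V * V <= nrm n2 <= 4 * (V * V) ->
  Cmod (\csum_(z <- gbox M) (F (gmul n1 z) * Cconj (F (gmul n2 z)))) <=
  ind (n1 = n2) * (9 * (m / V) ^ 2) +
  ind (n1 <> n2) * (3 * (m / V) * (c0 + 2) * / kap (gmulC (gsub n1 n2) th)).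
Proof.
move=> hV hU hr h1 h2; set U := m / V in hU *; have hUV : U * V = m by rewrite /U; field; lra.
have nz n : V * V <= nrm n -> n <> gzero.
  by move=> h h0; rewrite h0 nrmE /= in h; nra.
pose w z := W (gmul n1 z) * W (gmul n2 z).
have -> : \csum_(z <- gbox M) (F (gmul n1 z) * Cconj (F (gmul n2 z))) =
    \csum_(z <- gbox M) (w z * e (fst (gmulC z (gmulC (gsub n1 n2) th)))).
  apply: eq_bigr => z _; rewrite -gmulC_mul.
  have -> : gmul z (gsub n1 n2) = gsub (gmul n1 z) (gmul n2 z) by ring.
  rewrite -/(ph _) -ph_conj /F /w RtoC_mult.
  have -> : Cconj (W (gmul n2 z) * ph (gmul n2 z))%C = (W (gmul n2 z) * Cconj (ph (gmul n2 z)))%C.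
    by rewrite /Cconj /Cmult /RtoC /=; f_equal; ring.
  by ring.
have hw1 z : Rabs (w z) <= 1.
  rewrite /w Rabs_mult; have := hW.1 (gmul n1 z); have := hW.1 (gmul n2 z).
  have := Rabs_pos (W (gmul n1 z)); have := Rabs_pos (W (gmul n2 z)); nra.
have hws z : w z <> 0 -> inball U z.
  move=> h; have : W (gmul n1 z) <> 0 by move=> h0; apply: h; rewrite /w h0; ring.
  move=> /(hW.2) [_]; rewrite nrm_mul => h3; apply: inball_nrm; first by lra.
  have : nrm z >= 0 by rewrite nrmE; nra.
  move=> h4; apply: (Rmult_le_reg_l (V * V)); first by nra.
  by apply: (@Rle_trans _ (nrm n1 * nrm z)); nra.
case: (classic (n1 = n2)) => h12.
  rewrite (indT h12) (@indF (n1 <> n2)) //.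
  rewrite Rmult_0_l Rplus_0_r Rmult_1_l; apply: Rle_trans (csum_mod _ _) _.
  apply: (@Rle_trans _ (\rsum_(z <- gbox M) ind (inball U z))).
    apply: rsum_le => z; rewrite Cmod_mult e_mod Rmult_1_r Cmod_R.
    case: (classic (inball U z)) => hz; first by rewrite indT.
    by rewrite indF // (_ : w z = 0) ?Rabs_R0; [lra | apply: NNPP => /hws].
  by apply: Rle_trans (count_gbox M _) _; nra.
rewrite (indF h12) (indT h12) Rmult_0_l Rplus_0_l Rmult_1_l.
have b1 : inball (2 * V) n1 by apply: inball_nrm; nra.
have b2 : inball (2 * V) n2 by apply: inball_nrm; nra.
have hk : 2 * s <= kap (gmulC (gsub n1 n2) th).
  apply: (spaced_kap hsp); first by move/gsub_eq0.
  by apply: inball_le (inball_sub b1 b2); lra.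
apply: (Rmult_le_reg_l (kap (gmulC (gsub n1 n2) th))); first lra.
have [hb1 hb2] := hbW (nz _ h1.1) (nz _ h2.1).
apply: Rle_trans (@lin_sum c0 w _ M U hb1 hb2 hw1 hws hU hc0) _.
by right; field; lra.
Qed.

(** The square is expanded and z summed first. At most (4 V + 1)^2 <= 25 V^2 values of n1 occur; for
    each of them the diagonal contributes 9 U^2, and the other n2 contribute (8 V + 1) (L/s) times 3
    U (c0 + 2), where 8 V + 1 <= 9 V and U V = m. *)
Lemma corr_sum V A (al : gint -> R) : 1 <= V -> 1 <= m / V -> 8 * V <= r -> 0 <= A ->
  (forall n, Rabs (al n) <= A) ->
  (forall n, al n <> 0 -> V * V <= nrm n <= 4 * (V * V)) ->
  \rsum_(z <- gbox M) (Cmod (\csum_(n <- gbox M) (al n * F (gmul n z))) *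
                       Cmod (\csum_(n <- gbox M) (al n * F (gmul n z)))) <=
  A * A * (25 * (V * V)) * (9 * (m / V) ^ 2 + 27 * m * (c0 + 2) * (L / s)).
Proof.
move=> hV hU hr hA hal hsup; set U := m / V in hU *; have hUV : U * V = m by rewrite /U; field; lra.
have hL := L_ge3.
have hLs : 0 < L / s by apply: Rdiv_lt_0_compat; lra.
set lhs := \rsum_(z <- _) _.
have hl : RtoC lhs = \csum_(n1 <- gbox M) \csum_(n2 <- gbox M) (RtoC (al n1 * al n2) *
    \csum_(z <- gbox M) (F (gmul n1 z) * Cconj (F (gmul n2 z)))).
  rewrite /lhs -csum_RtoC.
  under eq_bigr => z _ do rewrite -Cmod_sqr csum_conj csum_distr.
  rewrite exchange_big /=; apply: eq_bigr => n1 _.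
  under eq_bigr => z _ do rewrite csum_distl.
  rewrite exchange_big /=; apply: eq_bigr => n2 _; rewrite csum_distl.
  apply: eq_bigr => z _; rewrite RtoC_mult.
  have -> : Cconj (al n2 * F (gmul n2 z))%C = (al n2 * Cconj (F (gmul n2 z)))%C.
    by rewrite /Cconj /Cmult /RtoC /=; f_equal; ring.
  by ring.
have hl0 : 0 <= lhs by apply: rsum_ge0 => z; have := Cmod_ge_0
  (\csum_(n <- gbox M) (al n * F (gmul n z))); nra.
rewrite -[lhs]Rabs_pos_eq // -Cmod_R hl; apply: Rle_trans (csum_mod _ _) _.
pose ball n := inball (2 * V) n.
have hball n : al n <> 0 -> ball n by move=> /hsup h; apply: inball_nrm; nra.
pose D n1 n2 := ind (n1 = n2) * (9 * U ^ 2) +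
  ind (ball n2 /\ n1 <> n2) * / kap (gmulC (gsub n1 n2) th) * (3 * U * (c0 + 2)).
have hkinv n : 0 <= / kap (gmulC n th).
  case: (Req_dec (kap (gmulC n th)) 0) => [->|hk]; first by rewrite Rinv_0; lra.
  by have := kap_ge0 (gmulC n th) => h0; apply: Rlt_le; apply: Rinv_0_lt_compat; lra.
have hU0 : 1 <= U by exact: hU.
have hD0 n1 n2 : 0 <= D n1 n2.
  rewrite /D; apply: Rplus_le_le_0_compat.
    by apply: Rmult_le_pos; [have := ind_bound (n1 = n2); lra | nra].
  apply: Rmult_le_pos; last by apply: Rmult_le_pos; lra.
  by apply: Rmult_le_pos => //; have := ind_bound (ball n2 /\ n1 <> n2); lra.
apply: (@Rle_trans _ (\rsum_(n1 <- gbox M) (ind (ball n1) *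
    (A * A * \rsum_(n2 <- gbox M) D n1 n2)))).
  apply: rsum_le => n1; apply: Rle_trans (csum_mod _ _) _.
  rewrite !rsum_distl; apply: rsum_le => n2.
  rewrite Cmod_mult Cmod_R.
  case: (classic (al n1 = 0)) => h1.
    rewrite h1 Rmult_0_l Rabs_R0 Rmult_0_l; apply: Rmult_le_pos.
      by have := ind_bound (ball n1); lra.
    by apply: Rmult_le_pos => //; nra.
  rewrite (indT (hball _ h1)) Rmult_1_l.
  case: (classic (al n2 = 0)) => h2.
    by rewrite h2 Rmult_0_r Rabs_R0 Rmult_0_l; apply: Rmult_le_pos => //; nra.
  apply: Rmult_le_compat; [exact: Rabs_pos | exact: Cmod_ge_0 | |].
    rewrite Rabs_mult; apply: Rmult_le_compat => //; exact: Rabs_pos.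
  apply: Rle_trans (corr_bound _ hU hr (hsup _ h1) (hsup _ h2)) _; first lra.
  rewrite /D -/U; right; congr (_ + _).
  rewrite (@ind_iff (ball n2 /\ n1 <> n2) (n1 <> n2)); first by ring.
  by split=> [[]|h] //; split=> //; apply: hball.
apply: (@Rle_trans _ (\rsum_(n1 <- gbox M) (ind (ball n1) *
    (A * A * (9 * U ^ 2 + 27 * m * (c0 + 2) * (L / s)))))).
  apply: rsum_le => n1; case: (classic (ball n1)) => h1; last by rewrite indF //; lra.
  rewrite indT // !Rmult_1_l; apply: Rmult_le_compat_l; first by nra.
  rewrite /D big_split /=; apply: Rplus_le_compat.
    rewrite -rsum_distr; have h9 : 0 <= 9 * U ^ 2 by nra.
    suff : \rsum_(n2 <- gbox M) ind (n1 = n2) <= 1 by nra.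
    case: (boolP (n1 \in gbox M)) => hin.
      rewrite (bigD1_seq n1 hin (gbox_uniq M)) /= indT // big1; first by lra.
      by move=> n2 /eqP hn; rewrite indF //; apply: not_eq_sym.
    rewrite big_seq big1 ?Rplus_0_r; first by lra.
    by move=> n2 hn2; rewrite indF // => h; move: hin; rewrite h hn2.
  rewrite -rsum_distr; have := @inv_kap_shift M V n1 ltac:(lra) hr h1.
  rewrite -/(ball) => h; apply: (@Rle_trans _ ((8 * V + 1) * (L / s) * (3 * U * (c0 + 2)))).
    by apply: Rmult_le_compat_r => //; apply: Rmult_le_pos; lra.
  have -> : 27 * m * (c0 + 2) * (L / s) = (9 * V) * ((L / s) * (3 * U * (c0 + 2))).
    by rewrite -hUV; ring.
  rewrite Rmult_assoc; apply: Rmult_le_compat_r; last lra.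
  by apply: Rmult_le_pos; [lra | apply: Rmult_le_pos; lra].
rewrite -rsum_distr; have hc := @count_gbox M (2 * V) ltac:(lra).
have hE : 0 <= 9 * U ^ 2 + 27 * m * (c0 + 2) * (L / s).
  apply: Rplus_le_le_0_compat; first nra.
  by apply: Rmult_le_pos; [apply: Rmult_le_pos; [have := m_ge1; lra|lra] | lra].
rewrite -/U; set E := _ + _ in hE *.
apply: (@Rle_trans _ ((2 * (2 * V) + 1) ^ 2 * (A * A * E))).
  by apply: Rmult_le_compat_r => //; apply: Rmult_le_pos => //; nra.
have -> : A * A * (25 * (V * V)) * E = (25 * (V * V)) * (A * A * E) by ring.
by apply: Rmult_le_compat_r; [apply: Rmult_le_pos => //; nra | nra].
Qed.

(** The bound for one dyadic block at V, made uniform by replacing m/V by the larger m/u; the factor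
    15 m is (3 U)(5 V), the square roots of the numbers of z and n, with U V = m. *)
Definition type2_bound (u : R) : R :=
  15 * m * sqrt (9 * (m / u) ^ 2 + 27 * m * (c0 + 2) * (L / s)).

Definition bilinear (al be : gint -> R) : C :=
  \csum_(n <- gbox M) \csum_(z <- gbox M) (RtoC (al n * be z) * F (gmul n z)).

Lemma type2_block u V A A' (al be : gint -> R) : 1 <= u -> u <= V -> V <= m ->
  8 * V <= r -> 0 <= A -> 0 <= A' ->
  (forall n, Rabs (al n) <= A) -> (forall n, Rabs (be n) <= A') ->
  (forall n, al n <> 0 -> V * V <= nrm n <= 4 * (V * V)) ->
  Cmod (bilinear al be) <= A * A' * type2_bound u.
Proof.
move=> hu huV hVm hr hA hA' hal hbe hsup.
have hm := m_ge1; have hL := L_ge3.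
have hU : 1 <= m / V by apply: (Rmult_le_reg_r V); [lra | rewrite /Rdiv Rmult_assoc Rinv_l; lra].
set U := m / V in hU *; have hUV : U * V = m by rewrite /U; field; lra.
pose T z := \csum_(n <- gbox M) (al n * F (gmul n z)).
have -> : bilinear al be = \csum_(z <- gbox M) (be z * T z).
  rewrite /bilinear exchange_big /=; apply: eq_bigr => z _; rewrite /T csum_distl.
  by apply: eq_bigr => n _; rewrite RtoC_mult; ring.
have hT z : ~ inball U z -> T z = RtoC 0.
  move=> hz; rewrite /T big1 // => n _.
  case: (classic (al n = 0)) => [->|h]; first by ring.
  rewrite /F (_ : W (gmul n z) = 0); first by ring.
  apply: NNPP => /(hW.2) [_]; rewrite nrm_mul => h3; apply: hz.
  apply: inball_nrm; first by lra.
  have [h4 _] := hsup _ h; have h5 : nrm z >= 0 by rewrite nrmE; nra.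
  apply: (Rmult_le_reg_l (V * V)); first by nra.
  by apply: (@Rle_trans _ (nrm n * nrm z)); nra.
apply: Rle_trans (csum_mod _ _) _.
apply: (@Rle_trans _ (\rsum_(z <- gbox M) ((A' * ind (inball U z)) * Cmod (T z)))).
  apply: rsum_le => z; rewrite Cmod_mult Cmod_R.
  case: (classic (inball U z)) => hz; last by rewrite (hT _ hz) Cmod_0; lra.
  by rewrite indT // Rmult_1_r; apply: Rmult_le_compat_r => //; exact: Cmod_ge_0.
apply: Rle_trans (Rle_abs _) _; apply: Rle_trans (rsum_CS _ _ _) _.
set Q := 9 * (m / u) ^ 2 + 27 * m * (c0 + 2) * (L / s).
have hLs : 0 < L / s by apply: Rdiv_lt_0_compat; lra.
have hmu : m / V <= m / u.
  by apply: Rmult_le_compat_l; [lra | apply: Rinv_le_contravar; lra].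
have hQ : 9 * U ^ 2 + 27 * m * (c0 + 2) * (L / s) <= Q.
  by rewrite /Q; apply: Rplus_le_compat_r; rewrite -/U in hmu; nra.
have hQ0 : 0 <= Q.
  apply: Rplus_le_le_0_compat; first nra.
  by apply: Rmult_le_pos; [apply: Rmult_le_pos; lra | lra].
have -> : A * A' * type2_bound u = (A' * (3 * U)) * (A * (5 * V) * sqrt Q).
  by rewrite /type2_bound -/Q -hUV; ring.
apply: Rmult_le_compat; try exact: sqrt_pos.
  rewrite -[A' * (3 * U)](sqrt_Rsqr); last by apply: Rmult_le_pos; lra.
  apply: sqrt_le_1_alt; apply: (@Rle_trans _ (\rsum_(z <- gbox M) (A' * A' * ind (inball U z)))).
    apply: rsum_le => z; have [i0 i1] := ind_bound (inball U z).
    have -> : A' * ind (inball U z) * (A' * ind (inball U z)) =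
      A' * A' * (ind (inball U z) * ind (inball U z)) by ring.
    by apply: Rmult_le_compat_l; nra.
  rewrite -rsum_distl; have := @count_gbox M U ltac:(lra); rewrite /Rsqr => hc.
  have -> : A' * (3 * U) * (A' * (3 * U)) = A' * A' * (9 * (U * U)) by ring.
  by apply: Rmult_le_compat_l; nra.
rewrite -[A * (5 * V)](sqrt_Rsqr); last by apply: Rmult_le_pos; lra.
rewrite -sqrt_mult_alt; last exact: Rle_0_sqr.
apply: sqrt_le_1_alt.
apply: Rle_trans (@corr_sum V A al ltac:(lra) hU hr hA hal hsup) _.
rewrite -/U; have -> : Rsqr (A * (5 * V)) = A * A * (25 * (V * V)) by rewrite /Rsqr; ring.
by apply: Rmult_le_compat_l => //; nra.
Qed.

Lemma bilinear_split al al1 al2 be : (forall n, al n = al1 n + al2 n) ->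
  bilinear al be = (bilinear al1 be + bilinear al2 be)%C.
Proof.
move=> h; rewrite /bilinear -big_split; apply: eq_bigr => n _ /=.
by rewrite -big_split; apply: eq_bigr => z _ /=; rewrite h !RtoC_mult RtoC_plus; ring.
Qed.

Lemma type2_dyadic u A A' (be : gint -> R) j : 1 <= u -> 0 <= A -> 0 <= A' ->
  (forall n, Rabs (be n) <= A') ->
  (forall i, (i < j)%N -> 2 ^ i * u <= m /\ 8 * (2 ^ i * u) <= r) ->
  forall al, (forall n, Rabs (al n) <= A) ->
  (forall n, al n <> 0 -> u * u < nrm n <= (2 ^ j * u) * (2 ^ j * u)) ->
  Cmod (bilinear al be) <= INR j * (A * A' * type2_bound u).
Proof.
move=> hu hA hA' hbe; elim: j => [|j ih] hj al hal hsup.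
  rewrite Rmult_0_l /bilinear big1 ?Cmod_0; first lra.
  move=> n _; rewrite big1 // => z _; rewrite (_ : al n = 0) ?Rmult_0_l; first by ring.
  by apply: NNPP => /hsup; rewrite /= Rmult_1_l; lra.
set V := 2 ^ j * u; have h2j : 1 <= 2 ^ j by apply: pow_R1_Rle; lra.
pose P n := nrm n <= V * V.
rewrite (@bilinear_split al (fun n => al n * ind (P n)) (fun n => al n * ind (~ P n))); last first.
  by move=> n; rewrite ind_not; ring.
have hle Q n : Rabs (al n * ind Q) <= A.
  rewrite Rabs_mult (Rabs_pos_eq (ind Q)); last by have := ind_bound Q; lra.
  by have := ind_bound Q; have := hal n; have := Rabs_pos (al n); nra.
apply: Rle_trans (Cmod_triangle _ _) _.
have b1 := ih (fun i hi => hj i ltac:(lia)) (fun n => al n * ind (P n)) (fun n => hle (P n) n).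
have b2 : Cmod (bilinear (fun n => al n * ind (~ P n)) be) <= A * A' * type2_bound u.
  have [hVm hVr] := hj j (leqnn _).
  apply: (@type2_block u V) => //; first by rewrite /V; nra.
  move=> n h; have hP : ~ P n by apply: NNPP => h0; apply: h; rewrite indF //; ring.
  have /hsup [_ h3] : al n <> 0 by move=> h0; apply: h; rewrite h0; ring.
  split; first by apply: Rlt_le; apply: Rnot_le_lt.
  by apply: Rle_trans h3 _; rewrite /V /=; lra.
rewrite S_INR Rmult_plus_distr_r Rmult_1_l; apply: Rplus_le_compat => //; apply: b1.
move=> n h; have hP : P n by apply: NNPP => h0; apply: h; rewrite indF //; ring.
by split=> //; apply: (hsup n _).1 => h0; apply: h; rewrite h0; ring.
Qed.

Lemma type2 u A A' (al be : gint -> R) : 1 <= u -> 0 <= A -> 0 <= A' ->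
  8 * sqrt m <= r -> (forall n, Rabs (al n) <= A) -> (forall n, Rabs (be n) <= A') ->
  (forall n, al n <> 0 -> u * u < nrm n <= m) ->
  Cmod (bilinear al be) <= L * (A * A' * type2_bound u).
Proof.
move=> hu hA hA' hr hal hbe hsup; have hm := m_ge1.
have hq : sqrt m * sqrt m = m by apply: sqrt_sqrt; lra.
have hq1 : 1 <= sqrt m by rewrite -sqrt_1; apply: sqrt_le_1_alt.
have hB : 0 <= A * A' * type2_bound u.
  apply: Rmult_le_pos; first exact: Rmult_le_pos.
  by apply: Rmult_le_pos; [lra | exact: sqrt_pos].
have hex : exists n : nat, sqrt m <= 2 ^ n * u.
  have [n hn] := INR_unbounded (sqrt m); exists n.
  have : INR n <= 2 ^ n.
    elim: n {hn} => [|n ih]; first by rewrite /=; lra.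
    by rewrite S_INR /=; have := pow_R1_Rle 2 n ltac:(lra); lra.
  by nra.
(* By minimality of j every block starts below sqrt m, where 8 sqrt m <= r guarantees the
   spacing. *)
have [j [hj hmin]] : exists j : nat, sqrt m <= 2 ^ j * u /\
    forall i, (i < j)%N -> 2 ^ i * u < sqrt m.
  case: hex; elim=> [|n ih] hn; first by exists 0%N.
  case: (Rle_dec (sqrt m) (2 ^ n * u)) => h; first exact: ih.
  exists n.+1; split=> // i hi; apply: Rle_lt_trans (Rnot_le_lt _ _ h).
  by apply: Rmult_le_compat_r; [lra | apply: Rle_pow; [lra | lia]].
(* From 2^(j-1) < sqrt m and ln 2 >= 1/2 one gets j <= 1 + 2 ln m. *)
have hjL : INR j <= L.
  case: j hj hmin => [|j] hj hmin; first by rewrite /=; have := L_ge3; lra.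
  rewrite /L.
  have h1 := hmin j (leqnn _).
  have hm0 : 0 <= ln m by rewrite -ln_1; apply: ln_le; lra.
  have h2 : INR j * (1/2) <= ln m.
    have h3 : ln (2 ^ j) <= ln m.
      apply: ln_le; first by apply: pow_lt; lra.
      apply: (@Rle_trans _ (sqrt m)); last by nra.
      by have := pow_R1_Rle 2 j ltac:(lra); nra.
    rewrite ln_pow in h3; last lra.
    have h4 : 1/2 <= ln 2 by have := ln_lt_2; lra.
    by have := pos_INR j; nra.
  by rewrite S_INR -/m; lra.
apply: (@Rle_trans _ (INR j * (A * A' * type2_bound u))); last exact: Rmult_le_compat_r.
apply: type2_dyadic => //.
- by move=> i /hmin h; split; nra.
- move=> n /hsup [h1 h2]; split=> //; apply: Rle_trans h2 _; nra.
Qed.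

End Bounds.

(** * Sums over primes *)

Section PrimeSum.
Variables (M : nat) (th : cplx) (r s c0 : R).
Hypotheses (hM : (1 <= M)%N) (hsp : spaced th r s) (hs : 0 < s)
  (hsM : / (2 * s) + 1 <= INR M) (hc0 : 0 <= c0).

Let m : R := INR M.
Let L : R := 3 + 2 * ln (INR M).
Let ph (n : gint) : C := e (fst (gmulC n th)).

Variable W : gint -> R.
Hypotheses (hW : weight_supp M W)
  (hbW : forall n1 n2, n1 <> gzero -> n2 <> gzero ->
    bvW c0 (fun z => W (gmul n1 z) * W (gmul n2 z)))
  (hb1 : forall d, d <> gzero -> bvW c0 (fun z => W (gmul d z)))
  (hb2 : forall d, d <> gzero -> bvW c0 (fun z => W (gmul d z) * (ln (nrm z) / L))).

Let F (n : gint) : C := (W n * ph n)%C.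

Variable Y : Z.
Hypotheses (hY1 : (1 <= Y)%Z) (hYm : IZR Y <= m) (hYr : 2 * IZR Y <= r)
  (hmr : 8 * sqrt m <= r).
Let u : R := sqrt (IZR Y).

Lemma nrm_le_ln n : n <> gzero -> nrm n <= m * m -> 0 <= ln (nrm n) <= L.
Proof.
move=> hn hN; have := ln_norm_ge0 n; rewrite -/(nrm n) => h0; split=> //.
have h1 := nrm_ge1 hn; have hm := m_ge1 hM; rewrite -/m in hm.
have : ln (nrm n) <= ln (m * m) by apply: ln_le; lra.
by rewrite ln_mult /L -/m; lra.
Qed.

Lemma nrm_le_sq n : nrm n <= m * m -> (gnorm n <= Z.of_nat M * Z.of_nat M)%Z.
Proof. by rewrite /nrm /m INR_IZR_INZ -mult_IZR => /le_IZR. Qed.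

Lemma F_supported : supported M F.
Proof.
move=> n h; have /(hW.2) [h1 h2] : W n <> 0 by move=> h0; apply: h; rewrite /F h0; ring.
by split=> //; apply: nrm_le_sq.
Qed.

Lemma vbeta_bound z : z <> gzero -> nrm z <= m * m -> 0 <= vbeta M Y z <= 9 * L.
Proof.
move=> hz hN; have [h0 h1] := nrm_le_ln hz hN; split.
  apply: rsum_ge0 => k; have := ind_bound (gdvd k z); have := Lam_ge0 k.
  have := ind_bound (~ (gnorm k <= Y)%Z); rewrite -/(hi Y k) => ? ? ?.
  by apply: Rmult_le_pos; [lra | apply: Rmult_le_pos; lra].
apply: (@Rle_trans _ (nunits * ln (nrm z))).
  rewrite -(Lam_sum hM hz (nrm_le_sq hN)); apply: rsum_le => k.
  have := ind_bound (gdvd k z); have := Lam_ge0 k.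
  have := ind_bound (~ (gnorm k <= Y)%Z); rewrite -/(hi Y k) => ? ? ?.
  by apply: Rmult_le_compat_l; [lra | nra].
by have := nunits_le9; have := nunits_ge1; nra.
Qed.

Lemma vbeta_supp z : vbeta M Y z <> 0 -> z <> gzero -> IZR Y < nrm z.
Proof.
move=> h hz; apply: Rnot_le_lt => h1; apply: h; apply: big1 => k _.
case: (classic (gdvd k z)) => hk; last by rewrite (indF hk); ring.
rewrite /hi ind_not (@indT (gnorm k <= Y)%Z); first by ring.
have := gdvd_norm hz hk; have : (gnorm z <= Y)%Z by apply: le_IZR.
by lia.
Qed.

Lemma sum_at_most_one (P : gint -> Prop) (l : seq gint) : uniq l ->
  (forall a b, P a -> P b -> a = b) -> \rsum_(d <- l) ind (P d) <= 1.
Proof.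
elim: l => [|a l ih] /=; first by rewrite big_nil; lra.
move=> /andP [ha hl] hP; rewrite big_cons.
case: (classic (P a)) => hPa; last by rewrite (indF hPa); have := ih hl hP; lra.
rewrite (indT hPa) big_seq big1 => [|d hd]; first lra.
rewrite indF // => hPd; move: ha; rewrite (hP _ _ hPa hPd) => hd'; by rewrite hd in hd'.
Qed.

Lemma vgamma_supp x : vgamma M Y x <> 0 -> x <> gzero /\ nrm x <= IZR Y * IZR Y.
Proof.
move=> h; apply: NNPP => hx; apply: h; apply: big1 => k _; apply: big1 => d _.
case: (classic (x = gmul k d)) => [e0|/indF ->]; last by ring.
case: (classic (gnorm k <= Y)%Z) => hk; last by rewrite /lo (indF hk); ring.
case: (classic (gnorm d <= Y)%Z) => hd; last by rewrite /lo (@indF (gnorm d <= Y)%Z) //; ring.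
case: (classic (k = gzero)) => [->|hk0]; first by rewrite Lam0; ring.
case: (classic (d = gzero)) => [->|hd0]; first by rewrite mu0; ring.
case: hx; split; first by rewrite e0; apply: gmul_neq0.
rewrite /nrm e0 gnorm_mul -mult_IZR; apply: IZR_le.
by have := gnorm_ge0 k; have := gnorm_ge0 d; nia.
Qed.

(** Each divisor k of x leaves at most one d with x = k d, and |mu| <= 1, so the sum of [Lam] over
    the divisors of x is a bound. *)
Lemma vgamma_bound x : Rabs (vgamma M Y x) <= 9 * L.
Proof.
have hm := m_ge1 hM; rewrite -/m in hm; have hL := L_ge3 hM; rewrite -/L in hL.
have hYp : 1 <= IZR Y by apply: IZR_le.
case: (classic (vgamma M Y x = 0)) => [->|/vgamma_supp [hx hN]]; first by rewrite Rabs_R0; lra.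
have hN' : nrm x <= m * m by nra.
have [h0 h1] := nrm_le_ln hx hN'.
apply: (@Rle_trans _ (nunits * ln (nrm x))); last first.
  by have := nunits_le9; have := nunits_ge1; nra.
rewrite -(Lam_sum hM hx (nrm_le_sq hN')) /vgamma.
apply: Rle_trans (rsum_abs _ _) _; apply: rsum_le => k.
apply: Rle_trans (rsum_abs _ _) _.
have hLk := Lam_ge0 k.
case: (classic (gdvd k x)) => hk; last first.
  rewrite (indF hk) big1 => [|d _]; first lra.
  by rewrite indF ?Rmult_0_l ?Rabs_R0 // => h; apply: hk; rewrite h; apply: gdvd_mulr.
have hk0 := gdvd_neq0 hx hk.
rewrite (indT hk) Rmult_1_l; apply: (@Rle_trans _ (\rsum_(d <- gbox M) (ind (x = gmul k d) * Lam k))).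
  apply: rsum_le => d; rewrite Rabs_mult Rabs_pos_eq; last by have := ind_bound (x = gmul k d); lra.
  apply: Rmult_le_compat_l; first by have := ind_bound (x = gmul k d); lra.
  rewrite !Rabs_mult (Rabs_pos_eq (Lam k)) //.
  have h2 := ind_bound (gnorm k <= Y)%Z; have h3 := ind_bound (gnorm d <= Y)%Z.
  rewrite -/(lo Y k) -/(lo Y d) in h2 h3; rewrite (Rabs_pos_eq (lo Y k)) ?(Rabs_pos_eq (lo Y d)); try lra.
  have h4 := mu_abs d; have h5 := Rabs_pos (mu d).
  have h6 : 0 <= lo Y d * Rabs (mu d) <= 1 by nra.
  have h7 : 0 <= lo Y k * Lam k <= Lam k by nra.
  by nra.
rewrite -rsum_distr; have := @sum_at_most_one (fun d => x = gmul k d) (gbox M) (gbox_uniq M).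
move=> h; have {}h := h (fun a b ha hb => gmulI hk0 (etrans (esym ha) hb)).
by have : 0 <= \rsum_(d <- gbox M) ind (x = gmul k d); [apply: rsum_ge0 => d; have := ind_bound (x = gmul k d); lra | nra].
Qed.

Let B1 : R := 3 * m * (c0 + 2) * (L * (L / s)).

Lemma sqrt_Y : 1 <= u /\ u * u = IZR Y.
Proof.
have hYp : 1 <= IZR Y by apply: IZR_le.
split; last by apply: sqrt_sqrt; lra.
by rewrite -sqrt_1; apply: sqrt_le_1_alt.
Qed.

Lemma lo_nrm d x : lo Y d * x <> 0 -> nrm d <= IZR Y.
Proof.
move=> h; apply: IZR_le; apply: NNPP => h0; apply: h; rewrite /lo (indF h0); ring.
Qed.

Lemma lo_mul_abs d x A : Rabs x <= A -> Rabs (lo Y d * x) <= A.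
Proof.
move=> h; have [h0 h1] := ind_bound (gnorm d <= Y)%Z; rewrite -/(lo Y d) in h0 h1.
by rewrite Rabs_mult (Rabs_pos_eq (lo Y d)) //; have := Rabs_pos x; nra.
Qed.

Lemma hi_mul_abs d x A : Rabs x <= A -> Rabs (hi Y d * x) <= A.
Proof.
move=> h; have [h0 h1] := ind_bound (~ (gnorm d <= Y)%Z); rewrite -/(hi Y d) in h0 h1.
by rewrite Rabs_mult (Rabs_pos_eq (hi Y d)) //; have := Rabs_pos x; nra.
Qed.

Lemma weight_dil_supp d n x : W (gmul d n) * x <> 0 -> gmul d n <> gzero /\ nrm (gmul d n) <= m * m.
Proof. by move=> h; apply: hW.2 => h0; apply: h; rewrite h0; ring. Qed.

Lemma log_term_bound : Cmod (\csum_(d <- gbox M) (RtoC (lo Y d * mu d) *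
    \csum_(n <- gbox M) (ln (IZR (gnorm n)) * F (gmul d n)))) <= L * B1.
Proof.
have [hu1 huu] := sqrt_Y; have hL := L_ge3 hM; rewrite -/L in hL.
(* Dividing the logarithm by L makes the weight at most 1, as [type1] requires; the factor L
   reappears in front of the sum. *)
pose w (d n : gint) := if decP (d = gzero) then 0 else W (gmul d n) * (ln (nrm n) / L).
have hYp : 1 <= IZR Y by apply: IZR_le.
have hw d n : w d n <> 0 -> d <> gzero /\ W (gmul d n) * (ln (nrm n) / L) <> 0.
  by rewrite /w; case: decPP.
apply: Rle_trans (csum_mod _ _) _.
have := @type1 M th r s c0 hM hsp hs hsM hc0 (fun d => lo Y d * mu d) w 1 u.
rewrite Rmult_1_l -/m -/L -/B1 => H.
apply: (@Rle_trans _ (L * \rsum_(d <- gbox M) (Rabs (lo Y d * mu d) *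
   Cmod (\csum_(n <- gbox M) (w d n * ph (gmul d n)))))).
  rewrite rsum_distl; apply: rsum_le => d; rewrite Cmod_mult Cmod_R.
  case: (classic (d = gzero)) => hd.
    rewrite hd mu0 Rmult_0_r Rabs_R0; lra.
  have -> : \csum_(n <- gbox M) (ln (IZR (gnorm n)) * F (gmul d n)) =
      (L * \csum_(n <- gbox M) (w d n * ph (gmul d n)))%C.
    rewrite csum_distl; apply: eq_bigr => n _; rewrite /w; case: decPP => // _.
    rewrite /F -/(nrm n).
    have -> : RtoC (ln (nrm n)) = (RtoC L * RtoC (ln (nrm n) / L))%C.
      by rewrite -RtoC_mult; congr RtoC; field; lra.
    by rewrite !RtoC_mult; ring.
  by rewrite Cmod_mult Cmod_R (Rabs_pos_eq L); lra.
apply: Rmult_le_compat_l; first lra.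
apply: H; try lra.
- by nra.
- by move=> d; apply: lo_mul_abs; apply: mu_abs.
- by move=> d /lo_nrm h; apply: inball_nrm; lra.
- move=> d hd; have [h1 h2] := hb2 hd; split=> x a n; [move: (h1 x a n) | move: (h2 x a n)];
    by rewrite /w; case: decPP.
- move=> d n; case: (classic (w d n = 0)) => [->|/hw [hd h]]; first by rewrite Rabs_R0; lra.
  have -> : w d n = W (gmul d n) * (ln (nrm n) / L) by rewrite /w; case: decPP.
  have [h1 h2] := weight_dil_supp h.
  have hn : n <> gzero by move=> h0; apply: h1; rewrite h0; ring.
  have h3 : nrm n <= m * m.
    by rewrite nrm_mul in h2; have := nrm_ge1 hd; have := nrm_ge1 hn; nra.
  have [h4 h5] := nrm_le_ln hn h3.
  rewrite Rabs_mult; have h6 := hW.1 (gmul d n); have h7 := Rabs_pos (W (gmul d n)).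
  have h8 : 0 <= ln (nrm n) / L <= 1.
    split; first by apply: Rmult_le_pos => //; apply: Rlt_le; apply: Rinv_0_lt_compat; lra.
    by apply: (Rmult_le_reg_r L); [lra | rewrite /Rdiv Rmult_assoc Rinv_l; lra].
  by rewrite (Rabs_pos_eq (ln _ / _)); nra.
- by move=> d n /hw [_ /weight_dil_supp].
Qed.

Lemma unit_term_bound : Cmod (\csum_(k <- gbox M) (RtoC (lo Y k * Lam k) *
    \csum_(v <- gbox M) (ind (gunit v) * F (gmul k v)))) <= 81 * L * IZR Y.
Proof.
have [hu1 huu] := sqrt_Y; have hL := L_ge3 hM; rewrite -/L in hL.
have hm := m_ge1 hM; rewrite -/m in hm; have hYp : 1 <= IZR Y by apply: IZR_le.
apply: Rle_trans (csum_mod _ _) _.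
apply: (@Rle_trans _ (\rsum_(k <- gbox M) (ind (inball u k) * (L * 9)))).
  apply: rsum_le => k; rewrite Cmod_mult Cmod_R.
  case: (classic (lo Y k * Lam k = 0)) => [->|h].
    by rewrite Rabs_R0; have := ind_bound (inball u k); nra.
  have h1 := lo_nrm h; rewrite indT; last by apply: inball_nrm; lra.
  rewrite Rmult_1_l; apply: Rmult_le_compat; [exact: Rabs_pos | exact: Cmod_ge_0 | |].
    apply: lo_mul_abs; rewrite Rabs_pos_eq; last exact: Lam_ge0.
    have hk : k <> gzero by move=> hk; apply: h; rewrite hk Lam0; ring.
    by apply: Rle_trans (Lam_le k) _; apply: (proj2 (nrm_le_ln hk _)); nra.
  apply: Rle_trans (csum_mod _ _) _; apply: Rle_trans nunits_le9.
  rewrite -(nunits_box hM); apply: rsum_le => v; rewrite /F !Cmod_mult !Cmod_R e_mod Rmult_1_r.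
  rewrite (Rabs_pos_eq (ind _)); last by have := ind_bound (gunit v); lra.
  by have := ind_bound (gunit v); have := hW.1 (gmul k v); nra.
rewrite -rsum_distr; have := @count_gbox M u ltac:(lra) => hc.
apply: (@Rle_trans _ ((2 * u + 1) ^ 2 * (L * 9))).
  by apply: Rmult_le_compat_r; lra.
have h : (2 * u + 1) ^ 2 <= 9 * (u * u) by nra.
by apply: Rle_trans (Rmult_le_compat_r _ _ _ _ h) _; [lra | rewrite huu; lra].
Qed.

(** A product of two elements of norm at most Y has absolute value at most Y, so [type1] applies
    with radius Y; this is the origin of the condition 2 Y <= r. *)
Lemma gamma_term_bound : Cmod (\csum_(x <- gbox M) (vgamma M Y x * \csum_(n <- gbox M) F (gmul x n))) <=
  9 * L * B1.
Proof.
have [hu1 huu] := sqrt_Y; have hL := L_ge3 hM; rewrite -/L in hL.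
have hYp : 1 <= IZR Y by apply: IZR_le.
apply: Rle_trans (csum_mod _ _) _.
have := @type1 M th r s c0 hM hsp hs hsM hc0 (vgamma M Y) (fun d n => W (gmul d n)) (9 * L) (IZR Y).
rewrite -/m -/L => H; apply: Rle_trans (Rle_trans _ _ _ (_ : _ <= _) (H _ _ _ _ _ _ _ _)) _; try lra.
- by apply: rsum_le => d; rewrite Cmod_mult Cmod_R; apply: Rle_refl.
- exact: vgamma_bound.
- by move=> d /vgamma_supp [_ h]; apply: inball_nrm; lra.
- exact: hb1.
- by move=> d n; apply: hW.1.
- by move=> d n; apply: hW.2.
- by rewrite /B1; lra.
Qed.

Lemma bilinear_sym al be : bilinear M th W al be = bilinear M th W be al.
Proof.
rewrite /bilinear exchange_big; apply: eq_bigr => z _; apply: eq_bigr => n _.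
by rewrite (gmul_comm n z) (Rmult_comm (al n)).
Qed.

Lemma bilinear_ext al be al' be' :
  (forall n z, n <> gzero -> z <> gzero -> nrm n * nrm z <= m * m -> al n * be z = al' n * be' z) ->
  bilinear M th W al be = bilinear M th W al' be'.
Proof.
move=> h; apply: eq_bigr => n _; apply: eq_bigr => z _.
case: (classic (W (gmul n z) = 0)) => [->|/(hW.2) [h1]]; first by ring.
rewrite nrm_mul => h2; rewrite (h n z) // => h0; apply: h1; rewrite h0; ring.
Qed.

Lemma bilinear_term_bound : Cmod (\csum_(d <- gbox M) (RtoC (hi Y d * mu d) *
    \csum_(n <- gbox M) (vbeta M Y n * F (gmul d n)))) <=
  18 * L * L * type2_bound M s c0 u.
Proof.
have [hu1 huu] := sqrt_Y; have hL := L_ge3 hM; rewrite -/L in hL.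
have hm := m_ge1 hM; rewrite -/m in hm.
have hYp : 1 <= IZR Y by apply: IZR_le.
pose al n := hi Y n * mu n.
pose al1 n := al n * ind (nrm n <= m); pose al2 n := al n * ind (~ nrm n <= m).
(* [vbeta] is bounded by 9 L only on this disc, and the weight forces z into it. *)
pose be z := vbeta M Y z * ind (z <> gzero /\ nrm z <= m * m).
pose be1 z := be z * ind (nrm z <= m).
have -> : \csum_(d <- gbox M) (RtoC (hi Y d * mu d) *
    \csum_(n <- gbox M) (vbeta M Y n * F (gmul d n))) = bilinear M th W al (vbeta M Y).
  rewrite /bilinear; apply: eq_bigr => d _; rewrite csum_distl; apply: eq_bigr => n _.
  by rewrite /F /ph /al !RtoC_mult; ring.
have -> : bilinear M th W al (vbeta M Y) = bilinear M th W al be.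
  apply: bilinear_ext => n z hn hz h; rewrite /be indT; first by ring.
  by split=> //; have := nrm_ge1 hn; have := nrm_ge1 hz; nra.
(* As N(n) N(z) <= m^2, one of the two norms is at most m. In [al1] it is that of n; with [al2] it
   must be that of z, and the variables are exchanged. Both norms exceed Y = u^2. *)
have hsplit n : al n = al1 n + al2 n by rewrite /al1 /al2 ind_not; ring.
rewrite (bilinear_split _ _ _ _ hsplit).
have -> : bilinear M th W al2 be = bilinear M th W al2 be1.
  apply: bilinear_ext => n z hn hz h; rewrite /be1.
  case: (classic (nrm z <= m)) => hzm; first by rewrite indT //; ring.
  rewrite /al2; case: (classic (nrm n <= m)) => hnm.
    by rewrite ind_not (indT hnm); ring.
  by exfalso; have := nrm_ge1 hn; have := nrm_ge1 hz; nra.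
have hind P A x : Rabs x <= A -> Rabs (x * ind P) <= A.
  move=> h; rewrite Rabs_mult (Rabs_pos_eq (ind P)); last by have := ind_bound P; lra.
  by have := ind_bound P; have := Rabs_pos x; nra.
have hal n : Rabs (al n) <= 1 by apply: hi_mul_abs; apply: mu_abs.
have hbe z : Rabs (be z) <= 9 * L.
  rewrite /be; case: (classic (z <> gzero /\ nrm z <= m * m)) => h.
    by rewrite (indT h) Rmult_1_r; have := vbeta_bound h.1 h.2 => h1; rewrite Rabs_pos_eq; lra.
  by rewrite (indF h) Rmult_0_r Rabs_R0; lra.
have t1 : Cmod (bilinear M th W al1 be) <= L * (1 * (9 * L) * type2_bound M s c0 u).
  apply: (@type2 M th r s c0 hM hsp hs hsM hc0 W hW hbW) => //; try lra.
  - by move=> n; apply: hind.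
  - move=> n h; rewrite huu; split.
      apply: Rnot_le_lt => h1; apply: h; rewrite /al1 /al /hi ind_not (@indT (gnorm n <= Y)%Z); first by ring.
      exact: le_IZR h1.
    by apply: NNPP => h1; apply: h; rewrite /al1 (indF h1); ring.
have t2 : Cmod (bilinear M th W be1 al2) <= L * (9 * L * 1 * type2_bound M s c0 u).
  apply: (@type2 M th r s c0 hM hsp hs hsM hc0 W hW hbW) => //; try lra.
  - by move=> n; apply: hind.
  - by move=> n; apply: hind.
  - move=> n h; rewrite huu; split.
      apply: vbeta_supp; first by move=> h1; apply: h; rewrite /be1 /be h1; ring.
      by move=> h1; apply: h; rewrite /be1 /be (@indF (_ /\ _)); [ring | tauto].
    by apply: NNPP => h1; apply: h; rewrite /be1 (indF h1); ring.
apply: Rle_trans (Cmod_triangle _ _) _; rewrite [bilinear M th W al2 _]bilinear_sym.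
have -> : 18 * L * L * type2_bound M s c0 u = L * (1 * (9 * L) * type2_bound M s c0 u) +
   L * (9 * L * 1 * type2_bound M s c0 u) by ring.
exact: Rplus_le_compat t1 t2.
Qed.

(** The two factors [nunits] on the left of Vaughan's identity are at least 1 and are dropped; those
    on the right are at most 9, so that 18 = 9 + 9 and 729 = 9 times 81. *)
Lemma Lam_exp_sum : Cmod (\csum_(n <- gbox M) (Lam n * F n)) <=
  18 * L * B1 + 729 * L * IZR Y + 18 * L * L * type2_bound M s c0 u.
Proof.
set T := \csum_(n <- _) _; have hv := vaughan Y hM F_supported; rewrite -/T in hv.
have h1 := nunits_ge1; have h9 := nunits_le9; have hL := L_ge3 hM; rewrite -/L in hL.
have hm := m_ge1 hM; rewrite -/m in hm.
have hB : 0 <= B1.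
  apply: Rmult_le_pos; first by apply: Rmult_le_pos; lra.
  by apply: Rmult_le_pos; [lra | apply: Rlt_le; apply: Rdiv_lt_0_compat; lra].
have hYp : 1 <= IZR Y by apply: IZR_le.
have tA := log_term_bound; have tB := unit_term_bound; have tC := gamma_term_bound; have tD := bilinear_term_bound.
apply: (@Rle_trans _ (Cmod (nunits * (nunits * T))%C)).
  rewrite !Cmod_mult Cmod_R Rabs_pos_eq; last lra.
  have hT := Cmod_ge_0 T; have h2 : Cmod T <= nunits * Cmod T by nra.
  by nra.
rewrite hv; apply: Rle_trans (Cmod_triangle _ _) _.
have -> : 18 * L * B1 + 729 * L * IZR Y + 18 * L * L * type2_bound M s c0 u =
  (9 * (L * B1) + 9 * (81 * L * IZR Y) + 9 * L * B1) + 18 * L * L * type2_bound M s c0 u by ring.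
apply: Rplus_le_compat => //; apply: Rle_trans (Cmod_triangle _ _) _.
rewrite Cmod_opp; apply: Rplus_le_compat => //; apply: Rle_trans (Cmod_triangle _ _) _.
rewrite !Cmod_mult !Cmod_R (Rabs_pos_eq nunits); last by lra.
by apply: Rplus_le_compat; apply: Rmult_le_compat => //; try lra; exact: Cmod_ge_0.
Qed.

End PrimeSum.

(** * Bounded variation of the weights of sectors, and the sums over primes *)

Lemma rsum_iotaS n (F : nat -> R) :
  \rsum_(i <- iota 0 n.+1) F i = (\rsum_(i <- iota 0 n) F i) + F n.
Proof. exact: sum_iotaS. Qed.

(** After a strict increase f never decreases again, so its variation is f(start) + f(end) - 2 min
    <= 2. In the induction [mn] is the minimum so far: it is the current value until f has increased
    once, and is frozen afterwards. *)
Lemma bv_unimodal (f : Z -> R) : (forall y, 0 <= f y <= 1) ->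
  (forall y y', (y <= y')%Z -> f y < f (y + 1)%Z -> f y' <= f (y' + 1)%Z) -> bv 2 f.
Proof.
move=> h01 hu a n.
suff [mn [hm [hs _]]] : exists mn, 0 <= mn <= 1 /\
    \rsum_(i <- iota 0 n) Rabs (f (a + Z.of_nat i + 1)%Z - f (a + Z.of_nat i)%Z) =
    f a + f (a + Z.of_nat n)%Z - 2 * mn /\
    (mn = f (a + Z.of_nat n)%Z \/
     exists i, (i < n)%N /\ f (a + Z.of_nat i)%Z < f (a + Z.of_nat i + 1)%Z).
  by rewrite hs; have := h01 a; have := h01 (a + Z.of_nat n)%Z; lra.
elim: n => [|n [mn [hm [hs hor]]]].
  exists (f a); split; first exact: h01.
  by rewrite big_nil Z.add_0_r; split; [ring | left].
have e1 : (a + Z.of_nat n.+1 = a + Z.of_nat n + 1)%Z by lia.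
rewrite rsum_iotaS hs e1; set p := f (a + Z.of_nat n)%Z; set q := f (a + Z.of_nat n + 1)%Z.
case: (Rlt_le_dec p q) => hpq.
  rewrite Rabs_pos_eq; last lra.
  case: hor => [->|[i [hi hfi]]].
    exists p; split; first exact: h01.
    by split; [rewrite -/p; ring | right; exists n].
  exists mn; split=> //; split; first by rewrite -/p; ring.
  by right; exists i; split=> //; lia.
case: hor => [->|[i [hi hfi]]].
  exists q; split; first exact: h01.
  by rewrite Rabs_left1; [split; [rewrite -/p; ring | left] | lra].
have hq : p <= q by apply: (hu _ _ _ hfi); lia.
have -> : q = p by lra.
rewrite (_ : p - p = 0) ?Rabs_R0; last by ring.
exists mn; split=> //; split; first by rewrite -/p; ring.
by right; exists i; split=> //; lia.
Qed.

Lemma bv_le c c' f : c <= c' -> bv c f -> bv c' f.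
Proof. by move=> h hf a n; apply: Rle_trans (hf a n) h. Qed.

Lemma bv_mul c c' f g : (forall y, Rabs (f y) <= 1) -> (forall y, Rabs (g y) <= 1) ->
  bv c f -> bv c' g -> bv (c + c') (fun y => f y * g y).
Proof.
move=> hf hg bf bg a n.
apply: Rle_trans (Rplus_le_compat _ _ _ _ (bf a n) (bg a n)).
rewrite -big_split; apply: rsum_le => i /=.
set u := (a + Z.of_nat i)%Z.
have -> : f (u + 1)%Z * g (u + 1)%Z - f u * g u =
  (f (u + 1)%Z - f u) * g (u + 1)%Z + f u * (g (u + 1)%Z - g u) by ring.
apply: Rle_trans (Rabs_triang _ _) _; rewrite !Rabs_mult.
have := hf u; have := hg (u + 1)%Z; have := Rabs_pos (f u); have := Rabs_pos (g (u + 1)%Z).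
have := Rabs_pos (f (u + 1)%Z - f u); have := Rabs_pos (g (u + 1)%Z - g u).
by nra.
Qed.

Lemma bv_ext c f g : (forall y, f y = g y) -> bv c f -> bv c g.
Proof.
by move=> h hf a n; apply: Rle_trans (hf a n); right; apply: eq_bigr => i _; rewrite !h.
Qed.

Lemma bvW_le c c' f : c <= c' -> bvW c f -> bvW c' f.
Proof. by move=> h [h1 h2]; split=> x; apply: bv_le h _. Qed.

Lemma bvW_ext c f g : (forall y, f y = g y) -> bvW c f -> bvW c g.
Proof. by move=> h [h1 h2]; split=> x; [apply: bv_ext (h1 x) | apply: bv_ext (h2 x)]. Qed.

Lemma bvW_mul c c' f g : (forall y, Rabs (f y) <= 1) -> (forall y, Rabs (g y) <= 1) ->
  bvW c f -> bvW c' g -> bvW (c + c') (fun y => f y * g y).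
Proof. by move=> hf hg [f1 f2] [g1 g2]; split=> x; apply: bv_mul. Qed.

Definition incr_convex (q : Z -> R) : Prop := forall y y', (y <= y')%Z ->
  q (y + 1)%Z - q y <= q (y' + 1)%Z - q y'.

Definition convex2 (q : gint -> R) : Prop :=
  (forall x, incr_convex (fun y => q (x, y))) /\ (forall y, incr_convex (fun x => q (x, y))).

Definition mono01 (G : R -> R) : Prop :=
  (forall t, 0 <= G t <= 1) /\ (forall s t, s <= t -> G s <= G t).

Lemma bv_mono_convex G q : mono01 G -> incr_convex q -> bv 2 (fun y => G (q y)).
Proof.
move=> [h01 hG] hq; apply: bv_unimodal => [y|y y' hy hlt]; first exact: h01.
apply: (hG); have := hq y y' hy.
suff : q y < q (y + 1)%Z by lra.
by apply: Rnot_le_lt => /hG; lra.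
Qed.

Lemma bvW_mono_convex G q : mono01 G -> convex2 q -> bvW 2 (fun z => G (q z)).
Proof.
by move=> hG [h1 h2]; split=> x; [apply: bv_mono_convex hG (h1 x) | apply: bv_mono_convex hG (h2 x)].
Qed.

Lemma bvW_compl c f : bvW c f -> bvW c (fun z => 1 - f z).
Proof.
move=> [h1 h2]; split=> x a n; [apply: Rle_trans (h1 x a n) | apply: Rle_trans (h2 x a n)];
  by right; apply: eq_bigr => i _; rewrite -Rabs_Ropp; congr Rabs; ring.
Qed.

Lemma mono_gt t0 : mono01 (fun t => ind (t0 < t)).
Proof.
split=> [t|s t hst]; first exact: ind_bound.
case: (classic (t0 < s)) => h; first by rewrite !indT; lra.
by rewrite (indF h); have := ind_bound (t0 < t); lra.
Qed.

Lemma convex2_nrm_dil d : convex2 (fun z => nrm (gmul d z)).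
Proof.
have hd : 0 <= nrm d by rewrite nrmE; nra.
by split=> x y y' /IZR_le hy; rewrite !nrm_mul !nrmE /= !plus_IZR; nra.
Qed.

(** For z = r e^(it) this is r sin(t - g), so its sign tells on which side of the line of direction
    g the point lies; being linear it is convex along rows and columns. *)
Definition half (g : R) (z : gint) : R := IZR z.2 * cos g - IZR z.1 * sin g.

Lemma convex2_half_dil g d : convex2 (fun z => half g (gmul d z)).
Proof.
by split=> x y y' /IZR_le hy; rewrite /half /= !(plus_IZR, minus_IZR, mult_IZR); lra.
Qed.

Section Region.
Variables (M : nat) (P1 P2 g1 g2 : R).
Hypotheses (hM : (1 <= M)%N) (h01 : 0 <= P1) (h12 : P1 < P2) (h2M : P2 <= INR M).
Let m : R := INR M.
Let L : R := 3 + 2 * ln (INR M).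

Definition region (z : gint) : Prop :=
  P1 * P1 < nrm z /\ nrm z <= P2 * P2 /\ 0 < half g1 z /\ half g2 z <= 0.

(* With the factor [lnw] the von Mangoldt weight of a prime becomes the constant [ln 2], so no
   partial summation is needed; [lnw] is monotone in the norm and costs only bounded variation. *)
Definition lnw (t : R) : R := ln 2 / ln (Rmax 2 t).

Definition pweight (z : gint) : R := ind (region z) * lnw (nrm z).

Fact ln2_bound : 1/2 <= ln 2 <= 1.
Proof.
split; first by have := ln_lt_2; lra.
by have := exp_ineq1_le (ln 2); rewrite exp_ln; lra.
Qed.

Lemma lnw_mono : mono01 (fun t => 1 - lnw t).
Proof.
have h2 := ln2_bound.
have hl t : ln 2 <= ln (Rmax 2 t) by apply: ln_le; [lra | exact: Rmax_l].
split=> [t|s t hst].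
  have := hl t; rewrite /lnw; move: (ln (Rmax 2 t)) => x hx.
  have h3 : 0 < ln 2 / x by apply: Rdiv_lt_0_compat; lra.
  suff : ln 2 / x <= 1 by lra.
  by apply: (Rmult_le_reg_r x); [lra | rewrite /Rdiv Rmult_assoc Rinv_l; lra].
suff : lnw t <= lnw s by lra.
apply: Rmult_le_compat_l; first lra.
apply: Rinv_le_contravar; first by have := hl s; lra.
apply: ln_le; first by have := Rmax_l 2 s; lra.
by apply: Rle_max_compat_l.
Qed.

Lemma lnw_bound t : 0 <= lnw t <= 1.
Proof. by have := lnw_mono.1 t; lra. Qed.

Lemma region_ind z : ind (region z) = ind (P1 * P1 < nrm z) *
  ((1 - ind (P2 * P2 < nrm z)) * (ind (0 < half g1 z) * (1 - ind (0 < half g2 z)))).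
Proof.
rewrite /region !ind_and -!ind_not.
by rewrite (@ind_iff (~ P2 * P2 < nrm z) (nrm z <= P2 * P2)) ?(@ind_iff (~ 0 < half g2 z) (half g2 z <= 0)) //;
  split=> h; lra.
Qed.

Lemma ind_abs P : Rabs (ind P) <= 1.
Proof. by rewrite Rabs_pos_eq; have := ind_bound P; lra. Qed.

Lemma indc_abs P : Rabs (1 - ind P) <= 1.
Proof. by rewrite Rabs_pos_eq; have := ind_bound P; lra. Qed.

Lemma mul_abs a b : Rabs a <= 1 -> Rabs b <= 1 -> Rabs (a * b) <= 1.
Proof. by rewrite Rabs_mult; have := Rabs_pos a; have := Rabs_pos b; nra. Qed.

Lemma pweight_abs z : Rabs (pweight z) <= 1.
Proof.
apply: mul_abs; first exact: ind_abs.
by have := lnw_bound (nrm z) => h; rewrite Rabs_pos_eq; lra.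
Qed.

(** The weight is a product of five factors bounded by 1: two conditions on the norm, two half
    planes, and [lnw]. Each is a monotone function of a convex form, or 1 minus such a function, and
    has variation at most 2. *)
Lemma pweight_bv d : bvW 10 (fun z => pweight (gmul d z)).
Proof.
have hn := convex2_nrm_dil d.
have e1 z : ind (P1 * P1 < nrm (gmul d z)) *
    ((1 - ind (P2 * P2 < nrm (gmul d z))) * (ind (0 < half g1 (gmul d z)) *
      (1 - ind (0 < half g2 (gmul d z))))) * lnw (nrm (gmul d z)) = pweight (gmul d z).
  by rewrite -region_ind.
apply: bvW_ext e1 _.
have hl z : Rabs (lnw (nrm (gmul d z))) <= 1.
  by have := lnw_bound (nrm (gmul d z)) => h; rewrite Rabs_pos_eq; lra.
have b1 t := bvW_mono_convex (mono_gt t) hn.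
have b2 g := bvW_mono_convex (mono_gt 0) (convex2_half_dil g d).
have b3 : bvW 2 (fun z => lnw (nrm (gmul d z))).
  have := bvW_compl (bvW_mono_convex lnw_mono hn); apply: bvW_ext => z; ring.
have -> : 10 = 2 + (2 + (2 + 2)) + 2 by ring.
apply: bvW_mul => // [z|].
  by do 3 (apply: mul_abs; try exact: ind_abs; try exact: indc_abs).
apply: bvW_mul => //; [by move=> z; exact: ind_abs | |].
  by move=> z; do 2 (apply: mul_abs; try exact: ind_abs; try exact: indc_abs).
apply: bvW_mul; [by move=> z; exact: indc_abs | | exact: bvW_compl |].
  by move=> z; apply: mul_abs; try exact: ind_abs; exact: indc_abs.
by apply: bvW_mul; [move=> z; exact: ind_abs | move=> z; exact: indc_abs | | exact: bvW_compl].
Qed.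

Lemma region_supp z : region z -> z <> gzero /\ nrm z <= m * m.
Proof.
move=> [h1 [h2 _]]; split; last by have := h2M; rewrite -/m; nra.
by move=> h0; rewrite h0 nrmE /= in h1; nra.
Qed.

Lemma pweight_supp : weight_supp M pweight.
Proof.
split; first exact: pweight_abs.
by move=> z h; apply: region_supp; apply: NNPP => h0; apply: h; rewrite /pweight (indF h0); ring.
Qed.

Lemma pweight_bv2 n1 n2 : bvW 20 (fun z => pweight (gmul n1 z) * pweight (gmul n2 z)).
Proof.
have -> : 20 = 10 + 10 by ring.
by apply: bvW_mul; try exact: pweight_bv; move=> z; exact: pweight_abs.
Qed.

(** Clamping makes ln t / L a monotone function into [0,1] on the whole line, as [mono01] demands;
    on the support of the weight nothing changes. *)
Definition clampln (t : R) : R := Rmax 0 (Rmin 1 (ln t / L)).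

Lemma clampln_mono : mono01 clampln.
Proof.
have hL := L_ge3 hM; rewrite -/L in hL.
split=> [t|s t hst].
  by rewrite /clampln; split; [exact: Rmax_l | apply: Rmax_lub; [lra | exact: Rmin_l]].
case: (Rle_dec s 1) => hs.
  rewrite {1}/clampln Rmax_left; first exact: Rmax_l.
  have h0 : ln s <= 0.
    case: (Rlt_dec 0 s) => h; first by rewrite -ln_1; apply: ln_le.
    by rewrite /ln; case: Rlt_dec => h' //; lra.
  apply: Rle_trans (Rmin_r _ _) _.
  have := Rinv_0_lt_compat L ltac:(lra); rewrite /Rdiv; nra.
apply: Rle_max_compat_l; apply: Rle_min_compat_l; apply: Rmult_le_compat_r.
  by apply: Rlt_le; apply: Rinv_0_lt_compat; lra.
by apply: ln_le; lra.
Qed.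

Lemma pweight_bvln d : bvW 20 (fun z => pweight (gmul d z) * (ln (nrm z) / L)).
Proof.
have hL := L_ge3 hM; rewrite -/L in hL.
apply: (@bvW_le (10 + 2)); first lra.
apply: (@bvW_ext _ (fun z => pweight (gmul d z) * clampln (nrm (gmul gone z)))).
  move=> z; have -> : gmul gone z = z by ring.
  case: (classic (pweight (gmul d z) = 0)) => [->|h]; first by ring.
  have [h1 h2] := pweight_supp.2 _ h.
  have hd : d <> gzero by move=> h0; apply: h1; rewrite h0; ring.
  have hz : z <> gzero by move=> h0; apply: h1; rewrite h0; ring.
  have hz2 : nrm z <= m * m.
    by rewrite nrm_mul -/m in h2; have := nrm_ge1 hd; have := nrm_ge1 hz; nra.
  have [h3 h4] := nrm_le_ln hM hz hz2; rewrite -/L in h4.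
  have hLi := Rinv_0_lt_compat L ltac:(lra).
  have h5 : 0 <= ln (nrm z) / L by rewrite /Rdiv; nra.
  have h6 : ln (nrm z) / L <= 1.
    by apply: (Rmult_le_reg_r L); [lra | rewrite /Rdiv Rmult_assoc Rinv_l; lra].
  by rewrite /clampln Rmin_right // Rmax_right.
apply: bvW_mul; [by move=> z; exact: pweight_abs | | exact: pweight_bv |].
  by move=> z; have := clampln_mono.1 (nrm (gmul gone z)) => h; rewrite Rabs_pos_eq; lra.
exact: (bvW_mono_convex clampln_mono (convex2_nrm_dil gone)).
Qed.

Lemma rsum_ge_term (I : eqType) (l : seq I) (F : I -> R) i : (forall j, 0 <= F j) ->
  i \in l -> F i <= \rsum_(j <- l) F j.
Proof.
move=> h; elim: l => [//|a l ih]; rewrite inE big_cons => /orP [/eqP <-|/ih].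
  by have := @rsum_ge0 _ l F h; lra.
by have := h a; lra.
Qed.

Lemma prime_unitM p v : gprime p -> gunit v -> gprime (gmul p v).
Proof.
move=> [hp0 [hpu hp]] hv; case: (hv) => w hw.
have hd x : gdvd (gmul p v) x <-> gdvd p x.
  split=> [[t ->]|[t ->]]; first by exists (gmul v t); ring.
  by exists (gmul w t); rewrite -[t in LHS](gmulK t hw); ring.
split; first by apply: gmul_neq0 => //; apply: gunit_neq0.
split; first by move/gunit_mull.
by move=> a b; rewrite !hd; apply: hp.
Qed.

Lemma gpow_normE p j : gnorm (gpow p j) = (gnorm p ^ Z.of_nat j)%Z.
Proof.
elim: j => [//|j ih]; rewrite [gpow _ _]/= gnorm_mul ih Nat2Z.inj_succ Z.pow_succ_r //.
exact: Zle_0_nat.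
Qed.

Definition proper_prime_power (n : gint) : Prop := [/\ Lam n <> 0, ~ gprime n & nrm n <= m * m].

(** Such n is p^j v with j >= 2, so N(p) <= m and p lies in a box of at most 9 m points; v is one of
    9 points and j takes at most 2 L values. *)
Lemma proper_prime_power_count : \rsum_(n <- gbox M) ind (proper_prime_power n) <= 162 * m * L.
Proof.
have hm := m_ge1 hM; rewrite -/m in hm; have hL := L_ge3 hM; rewrite -/L in hL.
have hq : sqrt m * sqrt m = m by apply: sqrt_sqrt; lra.
have hq1 : 1 <= sqrt m by rewrite -sqrt_1; apply: sqrt_le_1_alt.
have [K [hK hKb]] := @inball_floor (sqrt m) ltac:(lra).
have [J hJ] := @nat_floor (2 * L) ltac:(lra).
apply: (@Rle_trans _ (\rsum_(n <- gbox M) \rsum_(v <- gbox 1) \rsum_(p <- gbox K)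
    \rsum_(j <- iota 0 J) ind (n = gmul (gpow p j) v))).
  apply: rsum_le => n; case: (classic (proper_prime_power n)) => hb; last first.
    rewrite (indF hb); apply: rsum_ge0 => v; apply: rsum_ge0 => p; apply: rsum_ge0 => j.
    by have := ind_bound (n = gmul (gpow p j) v); lra.
  rewrite (indT hb); case: hb => hLn hnp hN.
  have [p hp] : exists p, primary p n by apply: NNPP => /Lam_not.
  have [v [j [hv e0]]] := primary_pow hp; have [hpp hn0 _ _] := hp.
  have hN' : (gnorm p ^ Z.of_nat j = gnorm n)%Z.
    by rewrite e0 gnorm_mul gpow_normE; move/gunitP: hv => ->; lia.
  have hp2 := prime_norm hpp.
  have hj : (2 <= j)%N.
    case: j e0 {hN'} => [|[|j]] // e0.
    - by exfalso; apply: hLn; apply: Lam_not; apply: primary_unit; rewrite e0 /= (_ : gmul gone v = v) //; ring.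
    - exfalso; apply: hnp; rewrite e0 /= (_ : gmul p gone = p); [exact: prime_unitM | ring].
  have hJj : j \in iota 0 J.
    rewrite mem_iota /= add0n.
    have h1 : ln (2 ^ j) <= ln (m * m).
      apply: ln_le; first by apply: pow_lt; lra.
      apply: Rle_trans hN; rewrite /nrm -hN' -(pow_IZR _ j).
      by apply: pow_incr; split; [lra | apply: IZR_le].
    rewrite ln_pow in h1; last lra.
    rewrite ln_mult in h1; try lra.
    have h2 := ln2_bound; have h3 := pos_INR j.
    have h4 : INR j + 1 <= 2 * L by rewrite /L -/m; nra.
    have : INR j < INR J by lra.
    by move/INR_lt; lia.
  have hpK : p \in gbox K.
    apply: hKb; apply: inball_nrm; first lra.
    rewrite hq; have h1 : (gnorm p * gnorm p <= gnorm n)%Z.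
      rewrite -hN'; have -> : (gnorm p * gnorm p = gnorm p ^ 2)%Z by ring.
      by apply: Z.pow_le_mono_r; lia.
    have : nrm p * nrm p <= nrm n by rewrite /nrm -mult_IZR; apply: IZR_le.
    by have := nrm_ge1 (prime_neq0 hpp); nra.
  have hv1 : v \in gbox 1 by apply: norm_gbox; move/gunitP: hv => ->.
  have hi q w k := ind_bound (n = gmul (gpow q k) w).
  apply: (@Rle_trans _ (\rsum_(q <- gbox K) \rsum_(k <- iota 0 J) ind (n = gmul (gpow q k) v))); last first.
    apply: (@rsum_ge_term _ (gbox 1) (fun w => \rsum_(q <- gbox K) \rsum_(k <- iota 0 J)
      ind (n = gmul (gpow q k) w))) => // w.
    by apply: rsum_ge0 => q; apply: rsum_ge0 => k; have := hi q w k; lra.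
  apply: (@Rle_trans _ (\rsum_(k <- iota 0 J) ind (n = gmul (gpow p k) v))); last first.
    apply: (@rsum_ge_term _ (gbox K) (fun q => \rsum_(k <- iota 0 J)
      ind (n = gmul (gpow q k) v))) => // q.
    by apply: rsum_ge0 => k; have := hi q v k; lra.
  apply: (@Rle_trans _ (ind (n = gmul (gpow p j) v))); first by rewrite (indT e0); lra.
  by apply: (@rsum_ge_term _ (iota 0 J) (fun k => ind (n = gmul (gpow p k) v))) => // k;
    have := hi p v k; lra.
rewrite exchange_big /=.
apply: (@Rle_trans _ (\rsum_(v <- gbox 1) \rsum_(p <- gbox K) \rsum_(j <- iota 0 J) 1)).
  apply: rsum_le => v; rewrite exchange_big /=; apply: rsum_le => p.
  rewrite exchange_big /=; apply: rsum_le => j.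
  by apply: sum_at_most_one; [exact: gbox_uniq | move=> a b -> ->].
rewrite !rsum_const size_iota !size_gbox.
have hK9 : INR ((2 * K + 1) * (2 * K + 1)) <= 9 * m.
  rewrite mult_INR plus_INR mult_INR /=; have := pos_INR K; nra.
have -> : INR ((2 * 1 + 1) * (2 * 1 + 1)) = 9 by rewrite /=; lra.
have hJ0 := pos_INR J; have hK0 := pos_INR ((2 * K + 1) * (2 * K + 1)).
rewrite Rmult_1_r; have : INR ((2 * K + 1) * (2 * K + 1)) * INR J <= 9 * m * (2 * L).
  by apply: Rmult_le_compat; lra.
by lra.
Qed.

Variables (th : cplx) (r s : R) (Y : Z).
Hypotheses (hsp : spaced th r s) (hs : 0 < s) (hsM : / (2 * s) + 1 <= INR M)
  (hY1 : (1 <= Y)%Z) (hYm : IZR Y <= m) (hYr : 2 * IZR Y <= r) (hmr : 8 * sqrt m <= r).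

(** The bound of [Lam_exp_sum] for variation 20, where 66 = 3 (20 + 2), plus the proper prime
    powers; the factor 2 comes from division by ln 2 >= 1/2. *)
Definition prime_bound : R :=
  2 * (18 * L * (66 * m * (L * (L / s))) + 729 * L * IZR Y +
       18 * L * L * type2_bound M s 20 (sqrt (IZR Y)) + 162 * m * L).

Lemma prime_exp_sum :
  Cmod (\csum_(n <- gbox M) (ind (gprime n /\ region n) * e (fst (gmulC n th)))) <= prime_bound.
Proof.
have hm := m_ge1 hM; rewrite -/m in hm; have hL := L_ge3 hM; rewrite -/L in hL.
have hc0 : 0 <= 20 by lra.
have h10 d : bvW 20 (fun z => pweight (gmul d z)) by apply: bvW_le (pweight_bv d); lra.
have H := @Lam_exp_sum M th r s 20 hM hsp hs hsM hc0 pweight pweight_supp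
  (fun n1 n2 _ _ => pweight_bv2 n1 n2) (fun d _ => h10 d) (fun d _ => pweight_bvln d) Y hY1 hYm hYr hmr.
rewrite -/m -/L in H; set S := \csum_(n <- _) _.
have h2 := ln2_bound.
have hsplit : (ln 2 * S)%C = (\csum_(n <- gbox M) (Lam n * (pweight n * e (fst (gmulC n th)))) -
    \csum_(n <- gbox M) (RtoC (Lam n * pweight n * ind (~ gprime n)) * e (fst (gmulC n th))))%C.
  rewrite -csum_sub /S csum_distl; apply: eq_bigr => n _.
  case: (classic (gprime n)) => hn.
    rewrite ind_not ind_and (indT hn) /pweight (Lam_primary (prime_primary hn)) -/(nrm n).
    have hp2 : 2 <= nrm n by apply: IZR_le; apply: prime_norm.
    have hln : ln 2 <= ln (nrm n) by apply: ln_le; lra.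
    have -> : ln (nrm n) * (ind (region n) * lnw (nrm n)) * (1 - 1) = 0 by ring.
    have -> : RtoC (ind (region n) * lnw (nrm n)) =
        (RtoC (ind (region n)) * RtoC (ln 2 / ln (nrm n)))%C.
      by rewrite -RtoC_mult /lnw Rmax_right.
    have e3 : (RtoC (ln (nrm n)) * RtoC (ln 2 / ln (nrm n)))%C = RtoC (ln 2).
      by rewrite -RtoC_mult; congr RtoC; field; lra.
    rewrite Rmult_1_l -[in LHS]e3; ring.
  rewrite ind_and ind_not (indF hn) !RtoC_mult (_ : 1 - 0 = 1); [ring | ring].
(* Each proper prime power contributes at most 1, since Lam n <= ln(nrm n) and ln 2 <= 1. *)
have hbad : Cmod (\csum_(n <- gbox M) (RtoC (Lam n * pweight n * ind (~ gprime n)) *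
    e (fst (gmulC n th)))) <= 162 * m * L.
  apply: Rle_trans (csum_mod _ _) _; apply: Rle_trans proper_prime_power_count; apply: rsum_le => n.
  rewrite Cmod_mult e_mod Rmult_1_r Cmod_R.
  case: (classic (Lam n * pweight n * ind (~ gprime n) = 0)) => [->|h].
    by rewrite Rabs_R0; have := ind_bound (proper_prime_power n); lra.
  have hl : Lam n <> 0 by move=> h0; apply: h; rewrite h0; ring.
  have hw : pweight n <> 0 by move=> h0; apply: h; rewrite h0; ring.
  have hnp : ~ gprime n.
    by move=> h0; apply: h; rewrite ind_not (indT h0); ring.
  have [hn0 hN] := pweight_supp.2 _ hw.
  rewrite (@indT (proper_prime_power n)) //.
  apply: mul_abs; last exact: ind_abs.
  have hLn := Lam_le n; rewrite -/(nrm n) in hLn; have hL0 := Lam_ge0 n.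
  have hn2 : 2 <= nrm n.
    apply: Rnot_lt_le => hlt; apply: hl; apply: Lam_not; apply: primary_unit; apply/gunitP.
    by have := gnorm_gt0 hn0; have := lt_IZR _ 2 hlt; lia.
  have hln : ln 2 <= ln (nrm n) by apply: ln_le; lra.
  rewrite /pweight /lnw Rmax_right //.
  have -> : Lam n * (ind (region n) * (ln 2 / ln (nrm n))) =
      ind (region n) * ((Lam n / ln (nrm n)) * ln 2) by field; lra.
  apply: mul_abs; first exact: ind_abs.
  have h4 : 0 <= Lam n / ln (nrm n).
    by apply: Rmult_le_pos => //; apply: Rlt_le; apply: Rinv_0_lt_compat; lra.
  have h5 : Lam n / ln (nrm n) <= 1.
    by apply: (Rmult_le_reg_r (ln (nrm n))); [lra | rewrite /Rdiv Rmult_assoc Rinv_l; lra].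
  by rewrite Rabs_pos_eq; nra.
have hS0 := Cmod_ge_0 S.
have : ln 2 * Cmod S = Cmod (ln 2 * S)%C by rewrite Cmod_mult Cmod_R Rabs_pos_eq; lra.
rewrite hsplit => hS1.
have := Cmod_triangle (\csum_(n <- gbox M) (Lam n * (pweight n * e (fst (gmulC n th)))))
  (- (\csum_(n <- gbox M) (RtoC (Lam n * pweight n * ind (~ gprime n)) * e (fst (gmulC n th)))))%C.
rewrite Cmod_opp => hS2; rewrite /prime_bound.
have -> : 66 * m * (L * (L / s)) = 3 * m * (20 + 2) * (L * (L / s)) by ring.
have hS3 := Rle_trans _ _ _ hS2 (Rplus_le_compat _ _ _ _ H hbad).
by move: hS3; rewrite -[X in Cmod X <= _]/(_ - _)%C -hS1; nra.
Qed.

End Region.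

(** * Sectors *)

(** The angle is measured from w and taken in (0, 2 PI], to match sectors open at their lower and
    closed at their upper side; a point on the ray of direction w therefore gets 2 PI and not 0. *)
Lemma polar_pos (w x y : R) : ~ (x = 0 /\ y = 0) -> exists r phi, [/\ 0 < r, 0 < phi <= 2 * PI,
  x = r * cos (w + phi) & y = r * sin (w + phi)].
Proof.
move=> hxy; pose x' := x * cos w + y * sin w; pose y' := y * cos w - x * sin w.
have hcs : cos w * cos w + sin w * sin w = 1.
  by have := sin2_cos2 w; rewrite /Rsqr; lra.
have hN : x' * x' + y' * y' = x * x + y * y.
  transitivity ((x * x + y * y) * (cos w * cos w + sin w * sin w)); first by rewrite /x' /y'; ring.
  by rewrite hcs; ring.
have hpos : 0 < x * x + y * y.
  case: (Req_dec x 0) => hx; case: (Req_dec y 0) => hy; try nra; by case: hxy.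
pose r := sqrt (x * x + y * y); have hr : 0 < r by apply: sqrt_lt_R0.
have hrr : r * r = x' * x' + y' * y' by rewrite hN; apply: sqrt_sqrt; lra.
have hb : -1 <= x' / r <= 1.
  have hx : - r <= x' <= r by split; nra.
  by split; apply: (Rmult_le_reg_r r) => //; rewrite /Rdiv Rmult_assoc Rinv_l; lra.
have hc := cos_acos _ hb; have hs := sin_acos _ hb; have [a0 a1] := acos_bound (x' / r).
have hs' : r * sin (acos (x' / r)) = Rabs y'.
  rewrite hs -{1}(sqrt_Rsqr r) -?sqrt_mult_alt; [|exact: Rle_0_sqr|lra].
  rewrite -sqrt_Rsqr_abs; congr sqrt; rewrite /Rsqr.
  have -> : r * r * (1 - x' / r * (x' / r)) = r * r - x' * x' by field; lra.
  by rewrite hrr; ring.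
suff [phi [hphi [e1 e2]]] : exists phi, 0 < phi <= 2 * PI /\ x' = r * cos phi /\ y' = r * sin phi.
  exists r, phi; split=> //.
    rewrite cos_plus; transitivity (x' * cos w - y' * sin w); last by rewrite e1 e2; ring.
    transitivity (x * (cos w * cos w + sin w * sin w)); first by rewrite hcs; ring.
    by rewrite /x' /y'; ring.
  rewrite sin_plus; transitivity (y' * cos w + x' * sin w); last by rewrite e1 e2; ring.
  transitivity (y * (cos w * cos w + sin w * sin w)); first by rewrite hcs; ring.
  by rewrite /x' /y'; ring.
have hx' : x' = r * cos (acos (x' / r)) by rewrite hc; field; lra.
have hpi := PI_RGT_0.
case: (Rle_lt_dec 0 y') => hy.
  case: (Req_dec (acos (x' / r)) 0) => h0.
    exists (2 * PI); split; first lra.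
    rewrite cos_2PI sin_2PI; rewrite h0 in hx' hs'; rewrite cos_0 in hx'.
    by rewrite sin_0 Rabs_pos_eq in hs'; lra.
  exists (acos (x' / r)); split; first lra.
  by split=> //; rewrite hs' Rabs_pos_eq.
exists (2 * PI - acos (x' / r)); split; first lra.
have -> : 2 * PI - acos (x' / r) = - acos (x' / r) + 2 * INR 1 * PI by rewrite /=; ring.
rewrite cos_period sin_period cos_neg sin_neg; split=> //.
by rewrite Rabs_left // in hs'; lra.
Qed.

Lemma sin_zero_small d : - PI < d < PI -> sin d = 0 -> d = 0.
Proof.
move=> hd h; case: (Rtotal_order d 0) => [hlt|[//|hgt]].
  by have := sin_gt_0 (- d) ltac:(lra) ltac:(lra); rewrite sin_neg; lra.
by have := sin_gt_0 d ltac:(lra) ltac:(lra); lra.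
Qed.

Lemma angle_uniq a b : - (2 * PI) < a - b < 2 * PI -> cos a = cos b -> sin a = sin b -> a = b.
Proof.
move=> hab hc hs.
have h1 : cos (a - b) = 1.
  by rewrite cos_minus hc hs; have := sin2_cos2 b; rewrite /Rsqr; lra.
have h2 : sin ((a - b) / 2) = 0.
  have e2 : cos (2 * ((a - b) / 2)) = 1 - 2 * sin ((a - b) / 2) * sin ((a - b) / 2).
    exact: cos_2a_sin.
  have e3 : 2 * ((a - b) / 2) = a - b by field.
  by rewrite e3 h1 in e2; nra.
by have := @sin_zero_small ((a - b) / 2) ltac:(lra) h2; lra.
Qed.

Lemma sq_lt a b : 0 <= a -> 0 <= b -> (a < b <-> a * a < b * b).
Proof. by move=> ha hb; split=> h; nra. Qed.

Lemma sq_le a b : 0 <= a -> 0 <= b -> (a <= b <-> a * a <= b * b).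
Proof. by move=> ha hb; split=> h; nra. Qed.

Lemma polar_scale_uniq r r' a b : 0 < r -> 0 < r' -> r * cos a = r' * cos b ->
  r * sin a = r' * sin b -> [/\ r = r', cos a = cos b & sin a = sin b].
Proof.
move=> hr hr' hc hs.
have h : r * r = r' * r'.
  have e1 := sin2_cos2 a; have e2 := sin2_cos2 b; rewrite /Rsqr in e1 e2.
  transitivity ((r * sin a) * (r * sin a) + (r * cos a) * (r * cos a)).
    by transitivity (r * r * (sin a * sin a + cos a * cos a)); [rewrite e1|]; ring.
  rewrite hc hs; transitivity (r' * r' * (sin b * sin b + cos b * cos b)); first by ring.
  by rewrite e2; ring.
have hrr : r = r' by nra.
split=> //; [apply: (Rmult_eq_reg_l r) | apply: (Rmult_eq_reg_l r)]; try lra;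
  by rewrite ?hc ?hs hrr.
Qed.

Lemma sector_region (P1 P2 w1 w2 d : R) (j : nat) (z : gint) r phi :
  0 <= P1 -> 0 <= P2 -> 0 < r -> 0 < phi <= 2 * PI -> 0 < d <= PI / 2 -> (j < 4)%N ->
  IZR z.1 = r * cos (w1 + phi) -> IZR z.2 = r * sin (w1 + phi) ->
  region P1 P2 (w1 + INR j * d) (w1 + INR j.+1 * d) z <->
  P1 < r <= P2 /\ INR j * d < phi <= INR j.+1 * d.
Proof.
move=> h1 h2 hr hphi hd hj hx hy.
have e0 : nrm z = r * r.
  rewrite nrmE hx hy; have e1 := sin2_cos2 (w1 + phi); rewrite /Rsqr in e1.
  by transitivity (r * r * (sin (w1 + phi) * sin (w1 + phi) + cos (w1 + phi) * cos (w1 + phi)));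
    [|rewrite e1]; ring.
have eh g : half g z = r * sin (w1 + phi - g).
  by rewrite /half hx hy sin_minus; ring.
have hj3 : INR j <= 3 by have := le_INR j 3 ltac:(lia); rewrite /=; lra.
have hj0 := pos_INR j; have hjd : 0 <= INR j * d <= 3 * d by nra.
have hpi := PI_RGT_0.
rewrite /region e0 !eh S_INR; set psi := phi - INR j * d.
have -> : w1 + phi - (w1 + INR j * d) = psi by rewrite /psi; ring.
have -> : w1 + phi - (w1 + (INR j + 1) * d) = psi - d by rewrite /psi; ring.
have hs1 : (P1 * P1 < r * r /\ r * r <= P2 * P2) <-> P1 < r <= P2.
  by rewrite -(sq_lt h1 (Rlt_le _ _ hr)) -(sq_le (Rlt_le _ _ hr) h2).
have hang : (0 < r * sin psi /\ r * sin (psi - d) <= 0) <-> 0 < psi <= d.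
  split=> [[k1 k2]|k]; last first.
    have s1 : 0 < sin psi by apply: sin_gt_0; lra.
    have s2 : 0 <= sin (d - psi) by apply: sin_ge_0; lra.
    have -> : psi - d = - (d - psi) by ring.
    by rewrite sin_neg; split; nra.
  have s1 : 0 < sin psi by nra.
  have s2 : sin (psi - d) <= 0 by nra.
  have per x : sin (x + 2 * PI) = sin x.
    by have := sin_period x 1; rewrite /= !Rmult_1_r.
  have hp1 : - (3 * d) < psi <= 2 * PI by rewrite /psi; lra.
  (* The angle psi may be as low as -3 d. Between -PI and 0 the first half plane excludes it; below
     -PI the second one does, because psi - d + 2 PI lies in (0, PI) thanks to 4 d <= 2 PI. *)
  case: (Rle_lt_dec psi 0) => hp0.
    exfalso; case: (Rle_lt_dec (- PI) psi) => hp2.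
      by have := sin_ge_0 (- psi) ltac:(lra) ltac:(lra); rewrite sin_neg; lra.
    by have := sin_gt_0 (psi - d + 2 * PI) ltac:(lra) ltac:(lra); rewrite per; lra.
  split=> //; apply: Rnot_lt_le => hgt.
  case: (Rlt_le_dec psi PI) => hp2.
    by have := sin_gt_0 (psi - d) ltac:(lra) ltac:(lra); lra.
  have := sin_ge_0 (psi - PI) ltac:(lra) ltac:(lra).
  by rewrite sin_minus cos_PI sin_PI; lra.
have -> : INR j * d < phi <= (INR j + 1) * d <-> 0 < psi <= d by rewrite /psi; split; lra.
by tauto.
Qed.

Lemma ind_interval4 d phi : 0 < d ->
  ind (INR 0 * d < phi <= INR 1 * d) + ind (INR 1 * d < phi <= INR 2 * d) +
  ind (INR 2 * d < phi <= INR 3 * d) + ind (INR 3 * d < phi <= INR 4 * d) =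
  ind (0 < phi <= 4 * d).
Proof.
move=> hd; have -> : INR 4 = 4 by rewrite /=; ring.
have -> : INR 3 = 3 by rewrite /=; ring.
have -> : INR 2 = 2 by rewrite /=; ring.
have -> : INR 1 = 1 by []; have -> : INR 0 = 0 by [].
case: (classic (0 < phi <= 4 * d)) => h; last by rewrite !indF; lra.
rewrite (indT h); case: (Rle_lt_dec phi d) => h1.
  by rewrite (@indT (0 * d < phi <= _)) ?(@indF (1 * d < _ <= _)) ?(@indF (2 * d < _ <= _))
    ?(@indF (3 * d < _ <= _)); lra.
case: (Rle_lt_dec phi (2 * d)) => h2.
  by rewrite (@indF (0 * d < phi <= _)) ?(@indT (1 * d < _ <= _)) ?(@indF (2 * d < _ <= _))
    ?(@indF (3 * d < _ <= _)); lra.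
case: (Rle_lt_dec phi (3 * d)) => h3.
  by rewrite (@indF (0 * d < phi <= _)) ?(@indF (1 * d < _ <= _)) ?(@indT (2 * d < _ <= _))
    ?(@indF (3 * d < _ <= _)); lra.
by rewrite (@indF (0 * d < phi <= _)) ?(@indF (1 * d < _ <= _)) ?(@indF (2 * d < _ <= _))
    ?(@indT (3 * d < _ <= _)); lra.
Qed.

(* A sector is the intersection of two half planes only when its opening is less than [PI],
   hence the quarters. *)
Lemma inD_split (P1 P2 w1 w2 : R) (z : gint) : 0 <= P1 -> P1 < P2 -> w1 < w2 ->
  w2 <= w1 + 2 * PI -> let d := (w2 - w1) / 4 in
  ind (inD P1 P2 w1 w2 (gtoC z)) =
  ind (region P1 P2 (w1 + INR 0 * d) (w1 + INR 1 * d) z) +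
  ind (region P1 P2 (w1 + INR 1 * d) (w1 + INR 2 * d) z) +
  ind (region P1 P2 (w1 + INR 2 * d) (w1 + INR 3 * d) z) +
  ind (region P1 P2 (w1 + INR 3 * d) (w1 + INR 4 * d) z).
Proof.
move=> h1 h2 hw hw2 d.
have hd : 0 < d <= PI / 2 by rewrite /d; lra.
case: (classic (z = gzero)) => hz.
  have hr g g' : ~ region P1 P2 g g' z.
    by move=> [hn _]; rewrite hz nrmE /= in hn; nra.
  rewrite !(indF (hr _ _)) indF; first by ring.
  move=> [r [t [[hr1 _] [_ [e1 e2]]]]]; rewrite hz /= in e1 e2.
  by have := sin2_cos2 t; rewrite /Rsqr; nra.
have hxy : ~ (IZR z.1 = 0 /\ IZR z.2 = 0).
  by move=> [/eq_IZR a /eq_IZR b]; apply: hz; case: z a b => x y /= -> ->.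
have [r [phi [hr hphi e1 e2]]] := polar_pos w1 hxy.
have H j hj := ind_iff (@sector_region P1 P2 w1 w2 d j z r phi h1 ltac:(lra) hr hphi hd hj e1 e2).
rewrite (H 0%N isT) (H 1%N isT) (H 2%N isT) (H 3%N isT) (ind_and _ (INR 0 * d < _ <= _))
  (ind_and _ (INR 1 * d < _ <= _)) (ind_and _ (INR 2 * d < _ <= _)) (ind_and _ (INR 3 * d < _ <= _)).
rewrite -!Rmult_plus_distr_l ind_interval4; last lra.
rewrite -ind_and; apply: ind_iff; rewrite /inD /gtoC /=; split.
  move=> [r' [t [hr' [ht [k1 k2]]]]].
  have [er ec es] := @polar_scale_uniq r r' (w1 + phi) t hr ltac:(lra)
    ltac:(congruence) ltac:(congruence).
  have ht' : w1 + phi = t by apply: angle_uniq => //; lra.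
  by subst r' t; rewrite /d; split; lra.
move=> [k1 k2]; exists r, (w1 + phi); split=> //; split; last by [].
by rewrite /d in k2; lra.
Qed.

Lemma count_sum (P : gint -> Prop) (l : seq gint) :
  INR (List.length (List.filter (fun z => decP (P z)) l)) = \rsum_(z <- l) ind (P z).
Proof.
elim: l => [|z l ih]; first by rewrite big_nil.
rewrite big_cons -ih [List.filter _ _]/= /ind; case: decPP => _ /=; last by ring.
by case: (List.length _) => [|n]; rewrite /=; ring.
Qed.

Lemma count_upto_sum b M (P : gint -> Prop) : 0 <= b -> b <= INR M ->
  (forall z, P z -> nrm z <= b * b) ->
  INR (count_upto b P) = \rsum_(z <- gbox M) ind (P z).
Proof.
move=> hb hbM hP; rewrite /count_upto count_sum; apply: sum_support; try exact: gbox_uniq.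
move=> z hz; have {}hz : P z by apply: NNPP => /indF.
have hin : inball b z by apply: inball_nrm => //; apply: hP.
have -> : z \in gbox M by apply/inball_gbox; apply: inball_le hin.
apply/inball_gbox; apply: inball_le hin; have [a1 a2] := archimed b.
rewrite INR_IZR_INZ Z2Nat.id; first by lra.
by apply: le_IZR; lra.
Qed.

Lemma inD_nrm P1 P2 w1 w2 z : 0 <= P1 -> inD P1 P2 w1 w2 (gtoC z) -> nrm z <= P2 * P2.
Proof.
move=> h1 [r [t [hr [_ [e1 e2]]]]]; rewrite /gtoC /= in e1 e2; rewrite nrmE e1 e2.
have e3 := sin2_cos2 t; rewrite /Rsqr in e3.
have -> : r * cos t * (r * cos t) + r * sin t * (r * sin t) = r * r.
  by transitivity (r * r * (sin t * sin t + cos t * cos t)); [|rewrite e3]; ring.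
by nra.
Qed.

Lemma sector_exp_sum M P1 P2 w1 w2 th r s Y : (1 <= M)%N -> 0 <= P1 -> P1 < P2 ->
  P2 <= INR M -> w1 < w2 -> w2 <= w1 + 2 * PI ->
  spaced th r s -> 0 < s -> / (2 * s) + 1 <= INR M ->
  (1 <= Y)%Z -> IZR Y <= INR M -> 2 * IZR Y <= r -> 8 * sqrt (INR M) <= r ->
  Cmod (\csum_(n <- gbox M) (ind (gprime n /\ inD P1 P2 w1 w2 (gtoC n)) *
    e (fst (gmulC n th)))) <= 4 * prime_bound M s Y.
Proof.
move=> hM h1 h12 h2M hw hw2 hsp hs hsM hY1 hYm hYr hmr.
pose d := (w2 - w1) / 4; pose g j := w1 + INR j * d.
pose S j := \csum_(n <- gbox M) (ind (gprime n /\ region P1 P2 (g j) (g j.+1) n) *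
  e (fst (gmulC n th))).
have hS j : Cmod (S j) <= prime_bound M s Y by apply: prime_exp_sum hsp _ _ _ _ _ _.
have -> : \csum_(n <- gbox M) (ind (gprime n /\ inD P1 P2 w1 w2 (gtoC n)) *
    e (fst (gmulC n th))) = (S 0%N + S 1%N + S 2%N + S 3%N)%C.
  rewrite /S -!csum_add; apply: eq_bigr => n _.
  have hr j : RtoC (ind (gprime n /\ region P1 P2 (g j) (g j.+1) n)) =
      (ind (gprime n) * ind (region P1 P2 (g j) (g j.+1) n))%C.
    by rewrite -RtoC_mult; congr RtoC; exact: ind_and.
  have -> : RtoC (ind (gprime n /\ inD P1 P2 w1 w2 (gtoC n))) =
      (ind (gprime n) * ind (inD P1 P2 w1 w2 (gtoC n)))%C.
    by rewrite -RtoC_mult; congr RtoC; exact: ind_and.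
  rewrite (inD_split n h1 h12 hw hw2) !RtoC_plus.
  rewrite (hr 0%N) (hr 1%N) (hr 2%N) (hr 3%N) /g /d; move: (e _) => x.
  by ring.
have t1 := Cmod_triangle (S 0%N + S 1%N + S 2%N)%C (S 3%N).
have t2 := Cmod_triangle (S 0%N + S 1%N)%C (S 2%N).
have t3 := Cmod_triangle (S 0%N) (S 1%N).
by have := hS 0%N; have := hS 1%N; have := hS 2%N; have := hS 3%N; lra.
Qed.

(** * Trigonometric approximation of boxes *)

Definition tpoly (n : nat) (b : nat -> R) (x : R) : C :=
  \csum_(i <- iota 0 n) (b i * e (INR i * x)).

Definition is_tpoly (n : nat) (f : R -> C) : Prop := exists b, forall x, f x = tpoly n b x.

Lemma csum_iotaS n (F : nat -> C) :
  \csum_(i <- iota 0 n.+1) F i = ((\csum_(i <- iota 0 n) F i) + F n)%C.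
Proof. exact: sum_iotaS. Qed.

Lemma tpoly_widen n k f : is_tpoly n f -> is_tpoly (n + k) f.
Proof.
move=> [b hb]; exists (fun i => if (i < n)%N then b i else 0) => x; rewrite hb /tpoly.
rewrite iotaD big_cat /= [X in _ = Cplus _ X]big_seq [X in _ = Cplus _ X]big1 => [|i].
  rewrite Cplus_0_r big_seq [RHS]big_seq; apply: eq_bigr => i; rewrite mem_iota /= add0n => ->.
  by [].
by rewrite mem_iota => /andP [hi _]; rewrite ltnNge hi /=; ring.
Qed.

Lemma tpoly_add n f g : is_tpoly n f -> is_tpoly n g -> is_tpoly n (fun x => f x + g x)%C.
Proof.
move=> [b hb] [c hc]; exists (fun i => b i + c i) => x; rewrite hb hc /tpoly -csum_add.
by apply: eq_bigr => i _; rewrite RtoC_plus; ring.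
Qed.

Lemma tpoly_shift n f : is_tpoly n f -> is_tpoly n.+1 (fun x => e x * f x)%C.
Proof.
move=> [b hb]; exists (fun i => if i is j.+1 then b j else 0) => x; rewrite hb /tpoly.
elim: n {hb} => [|n ih].
  by rewrite /= big_cons !big_nil; ring.
rewrite csum_iotaS [in RHS]csum_iotaS -ih S_INR Rmult_plus_distr_r Rmult_1_l e_add; ring.
Qed.

Lemma tpoly_shiftn j n f : is_tpoly n f -> is_tpoly (n + j) (fun x => e (INR j * x) * f x)%C.
Proof.
elim: j => [|j ih] h.
  case: h => b hb; rewrite addn0; exists b => x; rewrite -hb Rmult_0_l e0; ring.
rewrite addnS; have [b hb] := tpoly_shift (ih h); exists b => x; rewrite -hb S_INR.
by rewrite Rmult_plus_distr_r Rmult_1_l e_add; ring.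
Qed.

Definition dker (l : nat) (x : R) : C := \csum_(j <- iota 0 l) e (INR j * x).

Lemma tpoly_dker l n f : (1 <= n)%N -> is_tpoly n f -> is_tpoly (n + l) (fun x => dker l x * f x)%C.
Proof.
move=> hn hf; elim: l => [|l ih].
  exists (fun _ => 0) => x; rewrite /dker /= big_nil /tpoly big1; first by ring.
  by move=> i _; ring.
have h1 := tpoly_widen 1 ih; have h2 := tpoly_widen 1 (tpoly_shiftn l hf).
rewrite addnS -addn1; have [b hb] := tpoly_add h1 h2; exists b => x; rewrite -hb.
by rewrite /dker csum_iotaS; ring.
Qed.

Fixpoint dpow (l r : nat) (x : R) : C := if r is q.+1 then (dker l x * dpow l q x)%C else RtoC 1.

Lemma tpoly_dpow l r : is_tpoly (r * l + 1) (dpow l r).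
Proof.
elim: r => [|r ih].
  by exists (fun _ => 1) => x; rewrite /tpoly /= big_cons big_nil Rmult_0_l e0; ring.
have -> : (r.+1 * l + 1 = r * l + 1 + l)%N by lia.
by apply: tpoly_dker => //; lia.
Qed.

Lemma dpow_mod l r x : Cmod (dpow l r x) = Cmod (dker l x) ^ r.
Proof. by elim: r => [|r ih] /=; rewrite ?Cmod_1 // Cmod_mult ih. Qed.

Lemma dker0 l : dker l 0 = RtoC (INR l).
Proof.
elim: l => [|l ih]; first by rewrite /dker /= big_nil.
by rewrite /dker csum_iotaS -/(dker l 0) ih S_INR RtoC_plus Rmult_0_r e0.
Qed.

Lemma geom_sum b phi l :
  ((1 - e phi) * \csum_(j <- iota 0 l) e (b + INR j * phi))%C = (e b - e (b + INR l * phi))%C.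
Proof.
elim: l => [|l ih]; first by rewrite /= big_nil Rmult_0_l Rplus_0_r; ring.
rewrite csum_iotaS Cmult_plus_distr_l ih S_INR.
have -> : b + (INR l + 1) * phi = (b + INR l * phi) + phi by ring.
by rewrite (e_add _ phi); ring.
Qed.

Lemma dker_bound l s x : 0 < s -> ~ near s x -> Cmod (dker l x) <= / s.
Proof.
move=> hs hn; have hd := dis_not_near hn.
have h := geom_sum 0 x l; rewrite e0 Rplus_0_l in h.
have hl : \csum_(j <- iota 0 l) e (0 + INR j * x) = dker l x.
  by apply: eq_bigr => j _; rewrite Rplus_0_l.
rewrite hl in h; have h2 : dis x * Cmod (dker l x) <= 2.
  rewrite /dis -Cmod_mult h; apply: Rle_trans (Cmod_triangle _ _) _.
  by rewrite Cmod_opp Cmod_1 e_mod; lra.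
have h3 := Cmod_ge_0 (dker l x); apply: (Rmult_le_reg_l s) => //.
by rewrite Rinv_r; [nra | lra].
Qed.

Section Kernel.
Variables (n : nat) (b : nat -> R) (T' : nat).
Hypotheses (hn : (1 <= n)%N) (hT : (n <= T')%N).

Let T : R := INR (2 * T' + 1).
Let k0 : R := \rsum_(i <- iota 0 n) (b i * b i).
Hypothesis hk0 : 0 < k0.

(** Nonnegative as a squared modulus, whatever the coefficients; division by k0 gives it mean 1 over
    the grid of T points ([full_period]). *)
Definition kern (x : R) : R := Cmod (tpoly n b x) * Cmod (tpoly n b x) / k0.

Lemma T_gt0 : 0 < T. Proof. by apply: lt_0_INR; lia. Qed.

Lemma kern_ge0 x : 0 <= kern x.
Proof.
by apply: Rmult_le_pos; [have := Cmod_ge_0 (tpoly n b x); nra | apply: Rlt_le; apply: Rinv_0_lt_compat].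
Qed.

Lemma kern_exp x : RtoC (k0 * kern x) =
  \csum_(i <- iota 0 n) \csum_(j <- iota 0 n) (RtoC (b i * b j) * e ((INR i - INR j) * x)).
Proof.
have -> : k0 * kern x = Cmod (tpoly n b x) * Cmod (tpoly n b x) by rewrite /kern; field; lra.
rewrite -Cmod_sqr {2}/tpoly csum_conj /tpoly csum_distr; apply: eq_bigr => i _.
rewrite csum_distl; apply: eq_bigr => j _.
have -> : (INR i - INR j) * x = INR i * x + - (INR j * x) by ring.
rewrite e_add e_opp RtoC_mult.
have -> : Cconj (b j * e (INR j * x))%C = (b j * Cconj (e (INR j * x)))%C.
  by rewrite /Cconj /Cmult /RtoC /=; f_equal; ring.
by ring.
Qed.

Lemma kern_period x (k : Z) : kern (x - IZR k) = kern x.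
Proof.
suff h : tpoly n b (x - IZR k) = tpoly n b x by rewrite /kern h.
apply: eq_bigr => i _; congr (_ * _)%C.
have -> : INR i * (x - IZR k) = INR i * x + IZR (- (Z.of_nat i * k)).
  by rewrite opp_IZR mult_IZR -INR_IZR_INZ; ring.
by rewrite e_add e_int; ring.
Qed.

(** Orthogonality of characters modulo T: frequencies i - j have absolute value below n <= T' < T,
    so only i = j survives in the sum over a full period. *)
Lemma full_period x : \rsum_(t <- zrange T') kern (x - IZR t / T) = T.
Proof.
have hTp := T_gt0.
suff h : RtoC (k0 * \rsum_(t <- zrange T') kern (x - IZR t / T)) = RtoC (k0 * T).
  by move/(f_equal fst): h => /= h; apply: (Rmult_eq_reg_l k0) => //; lra.
rewrite rsum_distl -csum_RtoC.
under eq_bigr => t _ do rewrite kern_exp.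
rewrite exchange_big /= /k0 Rmult_comm rsum_distl -csum_RtoC.
rewrite big_seq [RHS]big_seq; apply: eq_bigr => i; rewrite mem_iota /= add0n => hi.
rewrite exchange_big /= (bigD1_seq i) ?iota_uniq ?mem_iota //=.
have -> : \csum_(t <- zrange T') (RtoC (b i * b i) * e ((INR i - INR i) * (x - IZR t / T))) =
    RtoC (T * (b i * b i)).
  have -> : \csum_(t <- zrange T') (RtoC (b i * b i) * e ((INR i - INR i) * (x - IZR t / T))) =
     \csum_(t <- zrange T') (RtoC (b i * b i)).
    by apply: eq_bigr => t _; rewrite Rminus_diag Rmult_0_l e0; ring.
  by rewrite csum_RtoC rsum_const size_zrange.
rewrite big_seq_cond big1 ?Cplus_0_r // => j; rewrite mem_iota /= add0n => /andP [hj hji].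
rewrite sum_zrange.
set phi := - (INR i - INR j) / T.
have hphi0 : 0 < dis phi.
  have [k hk] := round_int phi; have := dis_lower hk.
  have : 0 < Rabs (phi - IZR k); last lra.
  apply: Rabs_pos_lt => h0.
  have hkT : IZR (k * Z.of_nat (2 * T' + 1)) = IZR (Z.of_nat j - Z.of_nat i).
    rewrite mult_IZR minus_IZR -!INR_IZR_INZ -/T.
    have -> : IZR k = phi by lra.
    by rewrite /phi; field; lra.
  move/eq_IZR: hkT => hkT; have : (k = 0 \/ 1 <= Z.abs k)%Z by lia.
  by move: hji => /eqP; nia.
set cst := b i * b j.
have -> : \csum_(t <- iota 0 (2 * T' + 1)) (RtoC cst * e ((INR i - INR j) *
     (x - IZR (Z.of_nat t - Z.of_nat T') / T))) =
   (cst * \csum_(t <- iota 0 (2 * T' + 1)) e (((INR i - INR j) * (x + INR T' / T)) + INR t * phi))%C.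
  rewrite csum_distl; apply: eq_bigr => t _; congr (_ * e _)%C.
  by rewrite minus_IZR -!INR_IZR_INZ /phi; field; lra.
set a := (INR i - INR j) * _.
have hg := geom_sum a phi (2 * T' + 1).
have hint : INR (2 * T' + 1) * phi = IZR (Z.of_nat j - Z.of_nat i).
  by rewrite -/T minus_IZR -!INR_IZR_INZ /phi; field; lra.
rewrite hint e_add e_int in hg.
have hnz : (1 - e phi)%C <> RtoC 0.
  by move=> h0; move: hphi0; rewrite /dis h0 Cmod_0; lra.
have -> : \csum_(t <- iota 0 (2 * T' + 1)) e (a + INR t * phi) = RtoC 0; last by ring.
apply: NNPP => h1; apply: (Cmult_neq_0 _ _ hnz h1).
by rewrite hg; ring.
Qed.

(* Discrete convolution of [kern] with the indicator of [|t| <= tau / T]; as [T = 2 T' + 1], the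
   range [zrange T'] is a full period. *)
Definition smooth (tau : nat) (x : R) : R := / T * \rsum_(t <- zrange tau) kern (x - IZR t / T).

Lemma smooth_ge0 tau x : 0 <= smooth tau x.
Proof.
apply: Rmult_le_pos; first by apply: Rlt_le; apply: Rinv_0_lt_compat; exact: T_gt0.
by apply: rsum_ge0 => t; apply: kern_ge0.
Qed.

Lemma zrange_mono_sum tau tau' (f : Z -> R) : (tau <= tau')%N -> (forall t, 0 <= f t) ->
  \rsum_(t <- zrange tau) f t <= \rsum_(t <- zrange tau') f t.
Proof.
move=> h hf; apply: (@rsum_le_inj _ _ _ _ id) => //; first exact: zrange_uniq.
move=> t ht _; split; last by lra.
by apply: (introT (mem_zrange tau' t)); have := elimT (mem_zrange tau t) ht; lia.
Qed.

Lemma smooth_le1 tau x : (tau <= T')%N -> smooth tau x <= 1.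
Proof.
move=> h; have hTp := T_gt0.
have h1 : \rsum_(t <- zrange tau) kern (x - IZR t / T) <= T.
  by rewrite -[X in _ <= X](full_period x); apply: zrange_mono_sum => // t; apply: kern_ge0.
apply: (Rmult_le_reg_l T) => //; rewrite /smooth -Rmult_assoc Rinv_r; lra.
Qed.

Lemma smooth_small tau x e1 : (forall t, t \in zrange tau -> kern (x - IZR t / T) <= e1) ->
  (tau <= T')%N -> 0 <= e1 -> smooth tau x <= e1.
Proof.
move=> h htau he; have hTp := T_gt0; apply: (Rmult_le_reg_l T) => //.
rewrite /smooth -Rmult_assoc Rinv_r; last lra.
rewrite Rmult_1_l; apply: (@Rle_trans _ (\rsum_(t <- zrange tau) e1)); first exact: rsum_le_in.
rewrite rsum_const size_zrange; apply: Rmult_le_compat_r => //.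
by apply: le_INR; lia.
Qed.

Lemma smooth_large tau x e1 : 0 <= e1 -> (forall t, t \in zrange T' -> t \notin zrange tau ->
  kern (x - IZR t / T) <= e1) -> 1 - e1 <= smooth tau x.
Proof.
move=> he h; have hTp := T_gt0; apply: (Rmult_le_reg_l T) => //.
rewrite /smooth -Rmult_assoc Rinv_r; last lra.
rewrite Rmult_1_l.
have -> : T * (1 - e1) = T - T * e1 by ring.
suff : T <= (\rsum_(t <- zrange tau) kern (x - IZR t / T)) + T * e1 by lra.
rewrite -[X in X <= _](full_period x).
apply: (@Rle_trans _ (\rsum_(t <- zrange T') ((if t \in zrange tau then kern (x - IZR t / T) else 0) + e1))).
  apply: rsum_le_in => t ht; case: ifP => hin; first lra.
  by have := h t ht (negbT hin); lra.
rewrite big_split rsum_const size_zrange /=; apply: Rplus_le_compat; last by rewrite -/T; lra.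
apply: (@rsum_le_inj _ _ _ _ id) => //; first exact: zrange_uniq.
- by move=> t _; case: ifP => // ht _; split=> //; lra.
- by move=> t; apply: kern_ge0.
Qed.

(** Fourier coefficients indexed by pairs (i,j) rather than by the frequency i - j, so that equal
    frequencies never have to be collected. *)
Definition gam (tau : nat) (ij : nat * nat) : C :=
  (RtoC (b ij.1 * b ij.2 * / (T * k0)) *
   \csum_(t <- zrange tau) e (- ((INR ij.1 - INR ij.2) * (IZR t / T))))%C.

Definition freqs : seq (nat * nat) := list_prod (iota 0 n) (iota 0 n).

Lemma smooth_exp tau x : RtoC (smooth tau x) =
  \csum_(ij <- freqs) (gam tau ij * e (IZR (Z.of_nat ij.1 - Z.of_nat ij.2) * x)).
Proof.
have hTp := T_gt0.
have -> : smooth tau x = / (T * k0) * \rsum_(t <- zrange tau) (k0 * kern (x - IZR t / T)).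
  by rewrite -rsum_distl /smooth; field; lra.
rewrite RtoC_mult -csum_RtoC.
under eq_bigr => t _ do rewrite kern_exp.
rewrite list_prod_big exchange_big csum_distl; apply: eq_bigr => i _.
rewrite exchange_big csum_distl; apply: eq_bigr => j _.
rewrite /gam [(i, j).1]/= [(i, j).2]/= minus_IZR -!INR_IZR_INZ.
rewrite [LHS]csum_distl [in RHS]csum_distl csum_distr; apply: eq_bigr => t _.
have -> : (INR i - INR j) * (x - IZR t / T) =
  - ((INR i - INR j) * (IZR t / T)) + (INR i - INR j) * x by ring.
by rewrite e_add !RtoC_mult; ring.
Qed.

Lemma gam_diag tau : \csum_(ij <- freqs) (ind (Z.of_nat ij.1 - Z.of_nat ij.2 = 0)%Z * gam tau ij) =
  RtoC (INR (2 * tau + 1) / T).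
Proof.
have hTp := T_gt0.
rewrite list_prod_big.
have -> : INR (2 * tau + 1) / T = \rsum_(i <- iota 0 n) (b i * b i * (/ k0 * (INR (2 * tau + 1) / T))).
  by rewrite -rsum_distr -/k0; field; lra.
rewrite -csum_RtoC big_seq [RHS]big_seq; apply: eq_bigr => i; rewrite mem_iota /= add0n => hi.
rewrite (bigD1_seq i) ?iota_uniq ?mem_iota //= indT; last by lia.
rewrite big1 => [|j /eqP hji]; last by rewrite indF; [ring | lia].
rewrite Cplus_0_r /gam /=.
have -> : \csum_(t <- zrange tau) e (- ((INR i - INR i) * (IZR t / T))) = RtoC (INR (2 * tau + 1)).
  transitivity (\csum_(t <- zrange tau) (RtoC 1)).
    by apply: eq_bigr => t _; rewrite Rminus_diag Rmult_0_l Ropp_0 e0.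
  by rewrite csum_RtoC rsum_const size_zrange Rmult_1_r.
by rewrite -!RtoC_mult; congr RtoC; field; lra.
Qed.

(** By Cauchy's inequality the square of the sum of the |b i| is at most n k0; the exponential sums
    over t are bounded trivially. *)
Lemma gam_l1 tau : \rsum_(ij <- freqs) Cmod (gam tau ij) <= INR n * (INR (2 * tau + 1) / T).
Proof.
have hTp := T_gt0; have hi0 : 0 < / (T * k0) by apply: Rinv_0_lt_compat; nra.
set N := INR (2 * tau + 1); have hN : 0 <= N by exact: pos_INR.
apply: (@Rle_trans _ (\rsum_(ij <- freqs) (Rabs (b ij.1) * Rabs (b ij.2) * (/ (T * k0) * N)))).
  apply: rsum_le => -[i j]; rewrite /gam Cmod_mult Cmod_R !Rabs_mult (Rabs_pos_eq (/ _)) /=; last lra.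
  rewrite -!Rmult_assoc; apply: Rmult_le_compat_l.
    apply: Rmult_le_pos; last lra.
    by apply: Rmult_le_pos; exact: Rabs_pos.
  apply: Rle_trans (csum_mod _ _) _; right.
  transitivity (\rsum_(t <- zrange tau) 1); first by apply: eq_bigr => t _; exact: e_mod.
  by rewrite rsum_const size_zrange Rmult_1_r.
set A := \rsum_(i <- iota 0 n) Rabs (b i).
have -> : \rsum_(ij <- freqs) (Rabs (b ij.1) * Rabs (b ij.2) * (/ (T * k0) * N)) =
    A * A * (/ (T * k0) * N).
  rewrite list_prod_big /A !rsum_distr; apply: eq_bigr => i _.
  by rewrite rsum_distl rsum_distr; apply: eq_bigr => j _ /=.
have hA : A * A <= INR n * k0.
  have := rsum_CS (iota 0 n) (fun _ => 1) (fun i => Rabs (b i)).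
  have -> : \rsum_(i <- iota 0 n) (1 * Rabs (b i)) = A by apply: eq_bigr => i _; ring.
  have -> : \rsum_(i <- iota 0 n) (Rabs (b i) * Rabs (b i)) = k0.
    by apply: eq_bigr => i _; rewrite -Rabs_mult Rabs_pos_eq; nra.
  rewrite rsum_const size_iota !Rmult_1_r Rabs_pos_eq; last by apply: rsum_ge0 => i; exact: Rabs_pos.
  rewrite -sqrt_mult; [|exact: pos_INR|lra] => h.
  have hA0 : 0 <= A by apply: rsum_ge0 => i; exact: Rabs_pos.
  have hnk : 0 <= INR n * k0 by apply: Rmult_le_pos; [exact: pos_INR | lra].
  by rewrite -(sqrt_sqrt _ hnk); apply: Rmult_le_compat.
have -> : INR n * (N / T) = INR n * k0 * (/ (T * k0) * N) by field; lra.
by apply: Rmult_le_compat_r => //; apply: Rmult_le_pos; lra.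
Qed.

End Kernel.

(** * Sandwiching the indicator of a box *)

Lemma Rabs_def2_le x y : Rabs x <= y -> - y <= x /\ x <= y.
Proof. by rewrite /Rabs; case: Rcase_abs; lra. Qed.

Definition close (d x : R) : Prop := exists k : Z, Rabs (x - IZR k) <= d.

Section Sandwich.
Variables (n : nat) (b : nat -> R) (T' : nat) (del nu e1 : R).
Hypotheses (hn : (1 <= n)%N) (hT : (n <= T')%N) (hdel : 0 < del <= 1/2) (hnu : 0 < nu <= 1)
  (he1 : 0 <= e1 <= 1).
Let T : R := INR (2 * T' + 1).
Hypotheses (hk0 : 0 < \rsum_(i <- iota 0 n) (b i * b i)) (hTd : / T <= del * nu)
  (hkern : forall x, ~ near (del * nu) x -> kern n b x <= e1).

Let sm := smooth n b T'.

Lemma smooth_shift tau x (k : Z) : sm tau (x - IZR k) = sm tau x.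
Proof.
congr (_ * _); apply: eq_bigr => t _.
have -> : x - IZR k - IZR t / INR (2 * T' + 1) = x - IZR t / INR (2 * T' + 1) - IZR k by ring.
exact: kern_period.
Qed.

Lemma grid_abs (t : Z) tau : Rabs (IZR t / T) = IZR (Z.abs t) / T /\
  (t \in zrange tau -> IZR (Z.abs t) <= INR tau) /\
  (t \notin zrange tau -> INR tau + 1 <= IZR (Z.abs t)).
Proof.
have hTp := T_gt0 hn hT; rewrite -/T in hTp; split.
  rewrite /Rdiv Rabs_mult -abs_IZR (Rabs_pos_eq (/ T)) //.
  by apply: Rlt_le; apply: Rinv_0_lt_compat.
split=> ht.
  by rewrite INR_IZR_INZ; apply: IZR_le; exact: (elimT (mem_zrange tau t) ht).
rewrite INR_IZR_INZ -plus_IZR; apply: IZR_le.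
have : ~ (Z.abs t <= Z.of_nat tau)%Z; last by lia.
by move=> h; move: ht; rewrite (introT (mem_zrange tau t) h).
Qed.

Lemma smooth_inner tau x : T * (del * (1 + nu)) < INR tau + 1 -> close del x ->
  1 - e1 <= sm tau x.
Proof.
have hTp := T_gt0 hn hT; rewrite -/T in hTp.
move=> htau [k hk]; rewrite -(smooth_shift tau x k); set y := x - IZR k in hk *.
apply: smooth_large => //; first lra.
move=> t ht1 ht2; apply: hkern => -[l hl].
have [ea [_ h2]] := grid_abs t tau; have [_ [h1 _]] := grid_abs t T'.
have {}h1 := h1 ht1; have {}h2 := h2 ht2; rewrite -/T in hl.
have hTT : T = 2 * INR T' + 1 by rewrite /T plus_INR mult_INR /=; ring.
set q := IZR t / T in ea hl.
have eq : T * Rabs q = IZR (Z.abs t) by rewrite ea; field; lra.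
have hq1 : Rabs q < 1/2 by apply: (Rmult_lt_reg_l T); lra.
have hq2 : del * (1 + nu) < Rabs q by apply: (Rmult_lt_reg_l T); lra.
(* A grid point q outside the window still has |q| < 1/2, which forces del (1 + nu) < 1/2; then y -
   q cannot be near a nonzero integer. For l = 0 the window is wide enough by itself. *)
case: (Z.eq_dec l 0) => hl0.
  rewrite hl0 Rminus_0_r in hl.
  have := Rabs_triang (- (y - q)) y; rewrite Rabs_Ropp.
  have -> : - (y - q) + y = q by ring.
  by nra.
have hl1 : 1 <= Rabs (IZR l) by rewrite -abs_IZR; apply: IZR_le; lia.
have h3 := Rabs_triang (- (y - q - IZR l)) (y - q); rewrite Rabs_Ropp in h3.
have h4 := Rabs_triang y (- q); rewrite Rabs_Ropp in h4.
have e2 : - (y - q - IZR l) + (y - q) = IZR l by ring.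
by rewrite e2 in h3; have e3 : y + - q = y - q by []; rewrite e3 in h4; nra.
Qed.

Lemma tau_small tau : INR tau <= T * (del * (1 - nu)) -> (tau <= T')%N.
Proof.
move=> h; have hTp := T_gt0 hn hT; rewrite -/T in hTp.
have hTT : T = 2 * INR T' + 1 by rewrite /T plus_INR mult_INR /=; ring.
have h2 : del * (1 - nu) <= 1/2 by nra.
have h3 : T * (del * (1 - nu)) <= T * (1/2) by apply: Rmult_le_compat_l; lra.
have : INR tau < INR (T' + 1) by rewrite plus_INR /=; lra.
by move/INR_lt; lia.
Qed.

Lemma smooth_outer tau x : INR tau <= T * (del * (1 - nu)) -> ~ close del x ->
  sm tau x <= e1.
Proof.
have hTp := T_gt0 hn hT; rewrite -/T in hTp.
move=> htau hx; apply: smooth_small => //; [move=> t ht | exact: tau_small | lra].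
apply: hkern => -[l hl]; apply: hx; exists l.
have [ea [h1 _]] := grid_abs t tau; have {}h1 := h1 ht; rewrite -/T in hl.
set q := IZR t / T in ea hl.
have eq : T * Rabs q = IZR (Z.abs t) by rewrite ea; field; lra.
have hq : Rabs q <= del * (1 - nu) by apply: (Rmult_le_reg_l T); lra.
have := Rabs_triang (x - q - IZR l) q.
have -> : x - q - IZR l + q = x - IZR l by ring.
by lra.
Qed.

Variables (I : Type) (l : seq I) (a X Y : I -> R) (E : R).
Hypotheses (ha : forall p, 0 <= a p) (hE0 : 0 <= E)
  (hE : forall h1 h2 : Z, (Z.abs h1 <= Z.of_nat n)%Z -> (Z.abs h2 <= Z.of_nat n)%Z ->
    ~ (h1 = 0%Z /\ h2 = 0%Z) ->
    Cmod (\csum_(p <- l) (a p * e (IZR h1 * X p + IZR h2 * Y p))) <= E).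

Let S : R := \rsum_(p <- l) a p.

(** The pairs with both frequencies zero produce the main term through [gam_diag]; every other pair
    costs E, weighted by the square of the l1 norm of the coefficients. *)
Lemma fourier2 tau :
  Rabs ((\rsum_(p <- l) (a p * (sm tau (X p) * sm tau (Y p)))) -
    (INR (2 * tau + 1) / T) ^ 2 * S) <= (INR n * (INR (2 * tau + 1) / T)) ^ 2 * E.
Proof.
pose h (ij : nat * nat) := (Z.of_nat ij.1 - Z.of_nat ij.2)%Z.
pose g := gam n b T' tau.
pose Q u v := \csum_(p <- l) (a p * e (IZR (h u) * X p + IZR (h v) * Y p)).
pose z u := ind (h u = 0%Z).
have e2 : RtoC (\rsum_(p <- l) (a p * (sm tau (X p) * sm tau (Y p)))) =
    \csum_(u <- freqs n) \csum_(v <- freqs n) (g u * g v * Q u v).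
  rewrite -csum_RtoC.
  have es x : RtoC (sm tau x) = \csum_(u <- freqs n) (g u * e (IZR (h u) * x)).
    exact: smooth_exp.
  transitivity (\csum_(p <- l) (\csum_(u <- freqs n) (RtoC (a p) *
      ((g u * e (IZR (h u) * X p)) * \csum_(v <- freqs n) (g v * e (IZR (h v) * Y p)))))).
    by apply: eq_bigr => p _; rewrite (RtoC_mult (a p)) (RtoC_mult (sm tau (X p))) !es csum_distr csum_distl.
  rewrite exchange_big; apply: eq_bigr => u _.
  under eq_bigr => p _ do rewrite csum_distl csum_distl.
  rewrite exchange_big; apply: eq_bigr => v _; rewrite csum_distl.
  by apply: eq_bigr => p _; rewrite e_add -/(h u) -/(h v) -/(g u) -/(g v); ring.
have e3 : RtoC ((INR (2 * tau + 1) / T) ^ 2 * S) =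
    \csum_(u <- freqs n) \csum_(v <- freqs n) (g u * g v * RtoC (z u * z v * S)).
  transitivity (RtoC (INR (2 * tau + 1) / T) * (RtoC (INR (2 * tau + 1) / T) * RtoC S))%C.
    by rewrite -!RtoC_mult; congr RtoC; ring.
  rewrite -(gam_diag hn hT hk0) csum_distr; apply: eq_bigr => u _.
  rewrite csum_distr csum_distl; apply: eq_bigr => v _; rewrite !RtoC_mult.
  by rewrite -/(h u) -/(h v) -/(g u) -/(g v) -/(z u) -/(z v); ring.
rewrite -Cmod_R RtoC_minus e2 e3 -csum_sub; apply: Rle_trans (csum_mod _ _) _.
apply: (@Rle_trans _ (\rsum_(u <- freqs n) \rsum_(v <- freqs n) (Cmod (g u) * Cmod (g v) * E))).
  rewrite /freqs !list_prod_big.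
  apply: rsum_le_in => i hi; apply: rsum_le_in => j hj.
  rewrite -csum_sub; apply: Rle_trans (csum_mod _ _) _; rewrite !list_prod_big.
  apply: rsum_le_in => i' hi'; apply: rsum_le_in => j' hj'.
  move: hi hj hi' hj'; rewrite !mem_iota /= !add0n => hi hj hi' hj'.
  set u := (i, j); set v := (i', j').
  have -> : (g u * g v * Q u v - g u * g v * RtoC (z u * z v * S))%C =
    (g u * g v * (Q u v - RtoC (z u * z v * S)))%C by ring.
  rewrite (Cmod_mult (g u * g v)%C) (Cmod_mult (g u)); apply: Rmult_le_compat_l.
    by apply: Rmult_le_pos; exact: Cmod_ge_0.
  case: (classic (h u = 0%Z /\ h v = 0%Z)) => [[h1 h2]|h0].
    rewrite /Q h1 h2 /z (indT h1) (indT h2).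
    have -> : \csum_(p <- l) (a p * e (0 * X p + 0 * Y p)) = RtoC S.
      rewrite /S -csum_RtoC; apply: eq_bigr => p _.
      by rewrite !Rmult_0_l Rplus_0_l e0; ring.
    have -> : (RtoC S - RtoC (1 * 1 * S))%C = RtoC 0 by rewrite !Rmult_1_l; ring.
    by rewrite Cmod_0.
  have -> : z u * z v * S = 0.
    rewrite /z; case: (classic (h u = 0%Z)) => h1; last by rewrite (indF h1); ring.
    by rewrite (@indF (h v = 0%Z)); [ring | tauto].
  have -> : (Q u v - RtoC 0)%C = Q u v by ring.
  by apply: hE => //; rewrite /h /u /v /=; lia.
have hl1 := @gam_l1 n b T' hn hT hk0 tau; rewrite -/g -/T in hl1.
have -> : \rsum_(u <- freqs n) \rsum_(v <- freqs n) (Cmod (g u) * Cmod (g v) * E) =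
    (\rsum_(u <- freqs n) Cmod (g u)) * (\rsum_(u <- freqs n) Cmod (g u)) * E.
  rewrite !rsum_distr; apply: eq_bigr => u _; rewrite rsum_distl rsum_distr.
  by apply: eq_bigr => v _.
apply: Rmult_le_compat_r => //.
have h0 : 0 <= \rsum_(u <- freqs n) Cmod (g u) by apply: rsum_ge0 => u; exact: Cmod_ge_0.
by nra.
Qed.

Lemma count_bound :
  Rabs ((\rsum_(p <- l) (a p * ind (close del (X p) /\ close del (Y p)))) - 4 * del ^ 2 * S) <=
  21 * nu * del ^ 2 * S + 25 * (INR n) ^ 2 * del ^ 2 * E + 2 * e1 * S.
Proof.
have hTp := T_gt0 hn hT; rewrite -/T in hTp.
have hS : 0 <= S by apply: rsum_ge0.
set star := \rsum_(p <- l) _.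
have hn0 := pos_INR n.
have hdn : 0 < del * nu by nra.
have grid tau x : INR tau <= T * x -> T * x < INR tau + 1 -> 0 <= x ->
    Rabs (INR (2 * tau + 1) / T - 2 * x) <= del * nu.
  move=> k1 k2 hx; rewrite plus_INR mult_INR [INR 2]/= [INR 1]/=.
  have -> : ((1 + 1) * INR tau + 1) / T - 2 * x = ((1 + 1) * INR tau + 1 - 2 * (T * x)) * / T.
    by field; lra.
  rewrite Rabs_mult (Rabs_pos_eq (/ T)); last by apply: Rlt_le; apply: Rinv_0_lt_compat.
  apply: Rle_trans (_ : 1 * / T <= _); last by lra.
  apply: Rmult_le_compat_r; first by apply: Rlt_le; apply: Rinv_0_lt_compat.
  by apply: Rabs_le; lra.
(* The width w of the window differs from 2 del by at most 3 del nu, and w <= 5 del. So |w^2 - 4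
   del^2| <= (3 del nu)(7 del), which gives 21, and w^2 <= 25 del^2. *)
have err tau x : Rabs (INR (2 * tau + 1) / T - 2 * x) <= del * nu ->
    Rabs (x - del) <= del * nu ->
    Rabs ((INR (2 * tau + 1) / T) ^ 2 * S - 4 * del ^ 2 * S) <= 21 * nu * del ^ 2 * S /\
    (INR n * (INR (2 * tau + 1) / T)) ^ 2 * E <= 25 * (INR n) ^ 2 * del ^ 2 * E.
  move=> /Rabs_def2_le [k1 k2] /Rabs_def2_le [k3 k4].
  have hw0 : 0 <= INR (2 * tau + 1) / T.
    by apply: Rmult_le_pos; [exact: pos_INR | apply: Rlt_le; apply: Rinv_0_lt_compat].
  move: (INR (2 * tau + 1) / T) hw0 k1 k2 => w hw0 k1 k2.
  have w1 : w <= 2 * del + 3 * (del * nu) by lra.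
  have w2 : 2 * del - 3 * (del * nu) <= w by lra.
  have hdd : del * nu <= del by nra.
  split; last first.
    have h5 : w ^ 2 <= 25 * del ^ 2 by nra.
    have -> : (INR n * w) ^ 2 * E = w ^ 2 * ((INR n) ^ 2 * E) by ring.
    have -> : 25 * INR n ^ 2 * del ^ 2 * E = 25 * del ^ 2 * (INR n ^ 2 * E) by ring.
    by apply: Rmult_le_compat_r => //; apply: Rmult_le_pos => //; nra.
  have -> : w ^ 2 * S - 4 * del ^ 2 * S = (w ^ 2 - 4 * del ^ 2) * S by ring.
  rewrite Rabs_mult (Rabs_pos_eq S) //; apply: Rmult_le_compat_r => //.
  have -> : w ^ 2 - 4 * del ^ 2 = (w - 2 * del) * (w + 2 * del) by ring.
  rewrite Rabs_mult (Rabs_pos_eq (w + _)); last lra.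
  have k5 : Rabs (w - 2 * del) <= 3 * (del * nu) by apply: Rabs_le; lra.
  have k6 := Rabs_pos (w - 2 * del).
  have -> : 21 * nu * del ^ 2 = (3 * (del * nu)) * (7 * del) by ring.
  by apply: Rmult_le_compat; lra.
(* [tp] and [tm] are half-widths, in grid steps, of windows slightly wider and slightly narrower
   than del, for the upper and the lower bound. *)
have [tp [p1 p2]] := @nat_floor (T * (del * (1 + nu))) ltac:(nra).
have [tm [m1 m2]] := @nat_floor (T * (del * (1 - nu))) ltac:(apply: Rmult_le_pos; nra).
have [ep1 ep2] := err tp (del * (1 + nu)) (grid _ _ p1 p2 ltac:(nra)) ltac:(apply: Rabs_le; nra).
have [em1 em2] := err tm (del * (1 - nu)) (grid _ _ m1 m2 ltac:(nra)) ltac:(apply: Rabs_le; nra).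
have fp := fourier2 tp; have fm := fourier2 tm.
have sp x := smooth_ge0 hn hT hk0 tp x; have sq x := smooth_ge0 hn hT hk0 tm x.
have up : star <= (\rsum_(p <- l) (a p * (sm tp (X p) * sm tp (Y p)))) + 2 * e1 * S.
  rewrite /star /S rsum_distl -big_split; apply: rsum_le => p /=.
  have -> : a p * (sm tp (X p) * sm tp (Y p)) + 2 * e1 * a p =
    a p * (sm tp (X p) * sm tp (Y p) + 2 * e1) by ring.
  apply: Rmult_le_compat_l => //.
  have s1 := sp (X p); have s2 := sp (Y p); rewrite -/sm in s1 s2.
  case: (classic (close del (X p) /\ close del (Y p))) => hc; last by rewrite indF //; nra.
  rewrite indT //; have c1 := smooth_inner p2 hc.1; have c2 := smooth_inner p2 hc.2.
  by nra.
have lw : (\rsum_(p <- l) (a p * (sm tm (X p) * sm tm (Y p)))) - e1 * S <= star.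
  rewrite /star /S rsum_distl -rsum_sub; apply: rsum_le => p.
  have -> : a p * (sm tm (X p) * sm tm (Y p)) - e1 * a p =
    a p * (sm tm (X p) * sm tm (Y p) - e1) by ring.
  apply: Rmult_le_compat_l => //.
  have s1 := sq (X p); have s2 := sq (Y p); rewrite -/sm in s1 s2.
  have htm := tau_small m1.
  have b1 : sm tm (X p) <= 1 by apply: smooth_le1.
  have b2 : sm tm (Y p) <= 1 by apply: smooth_le1.
  case: (classic (close del (X p))) => hx; last first.
    by rewrite indF; [have := smooth_outer m1 hx; nra | tauto].
  case: (classic (close del (Y p))) => hy; last first.
    by rewrite indF; [have := smooth_outer m1 hy; nra | tauto].
  by rewrite indT //; nra.
have he1S : 0 <= e1 * S by nra.
move: fp fm ep1 em1 => /Rabs_def2_le [fp1 fp2] /Rabs_def2_le [fm1 fm2]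
  /Rabs_def2_le [ep3 ep4] /Rabs_def2_le [em3 em4].
by apply: Rabs_le; lra.
Qed.

End Sandwich.

(** The r-th power of the Dirichlet kernel has value l^r at 0, so l^(2r) <= n k0 by Cauchy's
    inequality; at points not near 0 the kernel itself is at most 1/s. *)
Lemma dirichlet_kernel l r n : n = (r * l + 1)%N -> (1 <= l)%N -> exists b : nat -> R,
  0 < \rsum_(i <- iota 0 n) (b i * b i) /\
  forall s x, 0 < s -> ~ near s x -> kern n b x <= INR n * (/ (INR l * s)) ^ (2 * r).
Proof.
move=> en hl; have [b hb] := tpoly_dpow l r; rewrite -en in hb; exists b.
set k0 := \rsum_(i <- _) _.
have hl0 : 0 < INR l by apply: lt_0_INR; lia.
have hn0 : 0 < INR n by apply: lt_0_INR; lia.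
have hk : INR l ^ (2 * r) <= INR n * k0.
  have h1 : \rsum_(i <- iota 0 n) b i = INR l ^ r.
    have := hb 0; rewrite /tpoly.
    have -> : \csum_(i <- iota 0 n) (b i * e (INR i * 0)) = RtoC (\rsum_(i <- iota 0 n) b i).
      by rewrite -csum_RtoC; apply: eq_bigr => i _; rewrite Rmult_0_r e0; ring.
    have -> : dpow l r 0 = RtoC (INR l ^ r).
      by elim: r {en hb} => [|r ih] //=; rewrite ih dker0 RtoC_mult.
    by move=> /(f_equal fst) /=.
  have := rsum_CS (iota 0 n) (fun _ => 1) b.
  have -> : \rsum_(i <- iota 0 n) (1 * b i) = INR l ^ r.
    by rewrite -h1; apply: eq_bigr => i _; ring.
  have hp : 0 <= INR l ^ r by apply: pow_le; lra.
  rewrite rsum_const size_iota !Rmult_1_r Rabs_pos_eq // -/k0.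
  have hk0 : 0 <= k0 by apply: rsum_ge0 => i; nra.
  rewrite -sqrt_mult; try lra.
  move=> h; have hnk : 0 <= INR n * k0 by nra.
  have -> : INR l ^ (2 * r) = INR l ^ r * INR l ^ r by rewrite -pow_add; congr (_ ^ _); lia.
  by rewrite -(sqrt_sqrt _ hnk); apply: Rmult_le_compat.
have hlp : 0 < INR l ^ (2 * r) by apply: pow_lt.
have hk0 : 0 < k0 by nra.
split=> // s x hs hx; rewrite /kern -/k0 -hb dpow_mod.
have hd := dker_bound l hs hx; have hd0 := Cmod_ge_0 (dker l x).
have h2 : Cmod (dker l x) ^ r <= (/ s) ^ r by apply: pow_incr.
have h3 : 0 <= Cmod (dker l x) ^ r by apply: pow_le.
have e2 : (/ s) ^ (2 * r) = (/ s) ^ r * (/ s) ^ r by rewrite -pow_add; congr (_ ^ _); lia.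
have h4 : Cmod (dker l x) ^ r * Cmod (dker l x) ^ r <= (/ s) ^ (2 * r).
  by rewrite e2; apply: Rmult_le_compat.
rewrite Rinv_mult Rpow_mult_distr pow_inv.
apply: (Rmult_le_reg_r k0) => //; rewrite /Rdiv Rmult_assoc Rinv_l ?Rmult_1_r; last lra.
apply: Rle_trans h4 _.
have h5 : 0 <= (/ s) ^ (2 * r) by apply: pow_le; apply: Rlt_le; apply: Rinv_0_lt_compat.
have -> : INR n * (/ INR l ^ (2 * r) * (/ s) ^ (2 * r)) * k0 =
   ((/ s) ^ (2 * r)) * ((INR n * k0) * / INR l ^ (2 * r)) by ring.
rewrite -[X in X <= _]Rmult_1_r; apply: Rmult_le_compat_l => //.
apply: (Rmult_le_reg_r (INR l ^ (2 * r))) => //.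
by rewrite Rmult_assoc Rinv_l; lra.
Qed.

(** * Diophantine approximation in Q(i) *)

Definition cn (z : cplx) : R := fst z * fst z + snd z * snd z.
Definition cerr (q a : gint) (c : cplx) : cplx :=
  (fst (gmulC q c) - IZR a.1, snd (gmulC q c) - IZR a.2).

Lemma cn_gmulC q z : cn (gmulC q z) = nrm q * cn z.
Proof. by rewrite nrmE /cn /gmulC /=; ring. Qed.

Lemma cn_ge0 z : 0 <= cn z. Proof. by rewrite /cn; nra. Qed.

Definition floor (x : R) : Z := (up x - 1)%Z.

Lemma floorP x : IZR (floor x) <= x < IZR (floor x) + 1.
Proof. by rewrite /floor minus_IZR; have := archimed x; lra. Qed.

Lemma pigeonhole (I J : eqType) (A : seq I) (B : seq J) (f : I -> J) : uniq A ->
  (forall i, i \in A -> f i \in B) -> (size B < size A)%N ->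
  exists i j, [/\ i \in A, j \in A, i <> j & f i = f j].
Proof.
move=> uA hf hlt; apply: NNPP => hno.
have hu : uniq (map f A).
  rewrite map_inj_in_uniq // => i j hi hj hij; apply: NNPP => h; apply: hno.
  by exists i, j.
have := uniq_leq_size hu (s2 := B).
rewrite size_map leqNgt hlt => h; suff : false by [].
by apply: h => j /mapP [i hi ->]; apply: hf.
Qed.

(** Pigeonhole: (N+1)^2 Gaussian integers with coordinates in [0,N] are multiplied by c and reduced
    into N^2 cells of side 1/N; q is the difference of two of them in one cell. *)
Lemma dirichlet (c : cplx) (N : nat) : (1 <= N)%N ->
  exists q a, [/\ q <> gzero, nrm q <= 2 * (INR N * INR N) & cn (cerr q a c) * (INR N * INR N) <= 2].
Proof.
move=> hN; have hN0 : 0 < INR N by apply: lt_0_INR; lia.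
pose fr x := x - IZR (floor x).
have frP x : 0 <= fr x < 1 by rewrite /fr; have := floorP x; lra.
pose cl x := Z.to_nat (floor (INR N * fr x)).
have clP x : (cl x < N)%N /\ INR (cl x) <= INR N * fr x < INR (cl x) + 1.
  have h1 := frP x; have h2 := floorP (INR N * fr x).
  have h0 : (0 <= floor (INR N * fr x))%Z.
    suff : (-1 < floor (INR N * fr x))%Z by lia.
    by apply: lt_IZR; nra.
  have e1 : INR (cl x) = IZR (floor (INR N * fr x)) by rewrite /cl INR_IZR_INZ Z2Nat.id.
  rewrite e1; split=> //.
  have : INR (cl x) < INR N by rewrite e1; nra.
  by move/INR_lt; lia.
pose g (ij : nat * nat) : gint := (Z.of_nat ij.1, Z.of_nat ij.2).
have hmem x y : (cl x, cl y) \in [seq (i, j) | i <- iota 0 N, j <- iota 0 N].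
  apply/allpairsP; exists (cl x, cl y); rewrite !mem_iota /= !add0n; split=> //; exact: (clP _).1.
have [u [v [hu hv huv hf]]] := @pigeonhole _ _
  [seq (i, j) | i <- iota 0 N.+1, j <- iota 0 N.+1] [seq (i, j) | i <- iota 0 N, j <- iota 0 N]
  (fun ij => (cl (fst (gmulC (g ij) c)), cl (snd (gmulC (g ij) c))))
  ltac:(by apply: allpairs_uniq; rewrite ?iota_uniq //; move=> [? ?] [? ?])
  ltac:(by move=> ij _; apply: hmem)
  ltac:(by rewrite !size_allpairs !size_iota; nia).
have bd w : w \in [seq (i, j) | i <- iota 0 N.+1, j <- iota 0 N.+1] -> (w.1 <= N)%N /\ (w.2 <= N)%N.
  move=> /allpairsP [[i j] [hi hj ->]]; move: hi hj.
  by rewrite [(i, j).1]/= [(i, j).2]/= !mem_iota !add0n !ltnS.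
have [u1 u2] := bd u hu; have [v1 v2] := bd v hv.
have key x y : cl x = cl y -> Rabs ((x - y) - IZR (floor x - floor y)) * INR N <= 1.
  move=> h; have [_ k1] := clP x; have [_ k2] := clP y; rewrite h in k1.
  rewrite minus_IZR; have -> : x - y - (IZR (floor x) - IZR (floor y)) = fr x - fr y by rewrite /fr; ring.
  have -> : Rabs (fr x - fr y) * INR N = Rabs ((fr x - fr y) * INR N).
    by rewrite Rabs_mult (Rabs_pos_eq (INR N)); lra.
  by apply: Rabs_le; lra.
case: hf => f1 f2; have k1 := key _ _ f1; have k2 := key _ _ f2.
exists (gsub (g u) (g v)), (floor (fst (gmulC (g u) c)) - floor (fst (gmulC (g v) c)),
  floor (snd (gmulC (g u) c)) - floor (snd (gmulC (g v) c)))%Z.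
split.
- move/gsub_eq0 => [] /Nat2Z.inj h1 /Nat2Z.inj h2; apply: huv.
  by case: u v {hu hv f1 f2 k1 k2 u1 u2 v1 v2} h1 h2 => a b [a' b'] /= -> ->.
- rewrite nrmE /gsub /gadd /gopp /g /= !plus_IZR !opp_IZR -!INR_IZR_INZ.
  have q1 : INR u.1 <= INR N by apply: le_INR; lia.
  have q2 : INR u.2 <= INR N by apply: le_INR; lia.
  have q3 : INR v.1 <= INR N by apply: le_INR; lia.
  have q4 : INR v.2 <= INR N by apply: le_INR; lia.
  have p1 := pos_INR u.1; have p2 := pos_INR u.2; have p3 := pos_INR v.1; have p4 := pos_INR v.2.
  have sq s t n : 0 <= s <= n -> 0 <= t <= n -> (s + - t) * (s + - t) <= n * n by move=> *; nra.
  apply: Rle_trans (Rplus_le_compat _ _ _ _ (sq _ _ _ (conj p1 q1) (conj p3 q3))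
    (sq _ _ _ (conj p2 q2) (conj p4 q4))) _; lra.
- rewrite /cn /cerr gmulC_sub [fst (_, _)]/= [snd (_, _)]/=.
  move: k1 k2; set x := _ - _ - _; set y := _ - _ - _ => k1 k2.
  have sq z : z * z = Rabs z * Rabs z.
    by rewrite -Rabs_mult Rabs_pos_eq //; exact: Rle_0_sqr.
  rewrite (sq x) (sq y); have := Rabs_pos x; have := Rabs_pos y => a1 a2.
  have sq1 t : 0 <= t -> t <= 1 -> t * t <= 1 by nra.
  have b1 := sq1 _ (Rmult_le_pos _ _ a2 (Rlt_le _ _ hN0)) k1.
  have b2 := sq1 _ (Rmult_le_pos _ _ a1 (Rlt_le _ _ hN0)) k2.
  by lra.
Qed.

Lemma cerr_mul t q a c : cerr (gmul q t) (gmul a t) c = gmulC t (cerr q a c).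
Proof.
by rewrite /cerr /gmulC /gmul /= !(plus_IZR, minus_IZR, mult_IZR); f_equal; ring.
Qed.

(** The x with q | x a form an ideal. Its generator g is the denominator of a/q in lowest terms,
    with q = g t and a = a0 t; cancelling t decreases both the norm and the error. *)
Lemma dirichlet_reduced (c : cplx) (N : nat) : (1 <= N)%N ->
  exists q a, [/\ q <> gzero, nrm q <= 2 * (INR N * INR N),
    cn (cerr q a c) * (INR N * INR N) <= 2 & forall x, gdvd q (gmul x a) -> gdvd q x].
Proof.
move=> hN; have [q [a [hq0 hqN hc]]] := dirichlet c hN.
case: (@ideal_gen (fun x => gdvd q (gmul x a)) q) => //.
- by exists a.
- by move=> x y [s hs] [t ht]; exists (gsub s t); transitivity (gsub (gmul x a) (gmul y a));
    [|rewrite hs ht]; ring.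
- by move=> x y [s hs]; exists (gmul s y); transitivity (gmul (gmul x a) y); [|rewrite hs]; ring.
move=> g [[a0 ha0] hg0 hg].
have [t ht] : gdvd g q by apply: hg; exists a.
have ea : a = gmul a0 t by apply: (gmulI hg0); rewrite ha0 ht; ring.
have ht0 : t <> gzero by move=> h; apply: hq0; rewrite ht h; ring.
have ht1 := nrm_ge1 ht0; have hc0 := cn_ge0 (cerr g a0 c).
exists g, a0; split=> //.
- by rewrite ht nrm_mul in hqN; have := nrm_ge1 hg0; nra.
- move: hc; rewrite ht ea cerr_mul cn_gmulC => hc.
  have : 0 <= cn (cerr g a0 c) * (INR N * INR N) by apply: Rmult_le_pos => //; nra.
  by nra.
- move=> x [w hw]; apply: hg; exists w.
  by rewrite ea ht; transitivity (gmul (gmul x a0) t); [|rewrite hw]; ring.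
Qed.

Lemma noninteger_gap x : (forall k : Z, x <> IZR k) ->
  exists eta, 0 < eta /\ forall k : Z, eta <= (x - IZR k) * (x - IZR k).
Proof.
move=> h; have [k1 k2] := floorP x; have hk := h (floor x).
set f := x - IZR (floor x).
have f0 : 0 < f by rewrite /f; lra.
have f1 : f < 1 by rewrite /f; lra.
exists (Rmin f (1 - f) * Rmin f (1 - f)); have m1 := Rmin_l f (1 - f); have m2 := Rmin_r f (1 - f).
have m0 : 0 < Rmin f (1 - f) by apply: Rmin_pos; lra.
split=> [|k]; first by nra.
case: (Z_le_dec k (floor x)) => hkf.
  have h1 : f <= x - IZR k by have := IZR_le _ _ hkf; rewrite /f; lra.
  by apply: Rmult_le_compat; lra.
have h1 : 1 - f <= - (x - IZR k).
  have : IZR (floor x + 1) <= IZR k by apply: IZR_le; lia.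
  by rewrite plus_IZR /f; lra.
by rewrite -[X in _ <= X]Rmult_opp_opp; apply: Rmult_le_compat; lra.
Qed.

Lemma in_Qi_of_mult (c : cplx) q a : q <> gzero -> cerr q a c = (0, 0) -> in_Qi c.
Proof.
move=> hq [] e1 e2; have hN := nrm_ge1 hq.
pose d := Z.to_pos (gnorm q).
have hd : IZR (Z.pos d) = nrm q by rewrite /d Z2Pos.id //; have := gnorm_gt0 hq; lia.
exists (Qmake (a.1 * q.1 + a.2 * q.2) d), (Qmake (a.2 * q.1 - a.1 * q.2) d).
rewrite /Q2R [Qnum _]/= [Qden _]/= [Qnum _]/= [Qden _]/= hd.
rewrite plus_IZR minus_IZR !mult_IZR.
have -> : IZR a.1 = fst (gmulC q c) by move: e1; rewrite /gmulC /=; lra.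
have -> : IZR a.2 = snd (gmulC q c) by move: e2; rewrite /gmulC /=; lra.
have hE := nrmE q; rewrite /gmulC /=.
by split; apply: (Rmult_eq_reg_r (nrm q)); try lra; rewrite Rmult_assoc Rinv_l; try lra;
  rewrite hE; ring.
Qed.

Lemma approx_gap (c : cplx) q : ~ in_Qi c -> q <> gzero ->
  exists eta, 0 < eta /\ forall a, eta <= cn (cerr q a c).
Proof.
move=> hc hq; set x := fst (gmulC q c); set y := snd (gmulC q c).
have e0 a : cn (cerr q a c) = (x - IZR a.1) * (x - IZR a.1) + (y - IZR a.2) * (y - IZR a.2) by [].
have sq t : 0 <= t * t by exact: Rle_0_sqr.
case: (classic (exists k : Z, x = IZR k)) => [[k hk]|h1]; last first.
  have [eta [h0 h]] := @noninteger_gap x (fun k hk => h1 (ex_intro _ k hk)).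
  by exists eta; split=> // a; rewrite e0; have := h a.1; have := sq (y - IZR a.2); lra.
case: (classic (exists k : Z, y = IZR k)) => [[l hl]|h1]; last first.
  have [eta [h0 h]] := @noninteger_gap y (fun k hk => h1 (ex_intro _ k hk)).
  by exists eta; split=> // a; rewrite e0; have := h a.2; have := sq (x - IZR a.1); lra.
case: hc; apply: (@in_Qi_of_mult c q (k, l) hq).
by rewrite /cerr -/x -/y hk hl /= !Rminus_diag.
Qed.

(** Finitely many denominators cannot approximate c arbitrarily well; so better and better
    approximations have unbounded denominators. This is where c outside Q(i) enters. *)
Lemma uniform_gap (c : cplx) (l : seq gint) : ~ in_Qi c ->
  exists eta, 0 < eta /\ forall q a, q \in l -> q <> gzero -> eta <= cn (cerr q a c).
Proof.
move=> hc; elim: l => [|q l [eta [h0 h]]]; first by exists 1; split; [lra |].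
case: (classic (q = gzero)) => hq.
  exists eta; split=> // x a; rewrite inE => /orP [/eqP -> /(_ hq) //|hx]; exact: h.
have [et [k0 k]] := approx_gap hc hq.
exists (Rmin eta et); split; first by apply: Rmin_pos.
move=> x a; rewrite inE => /orP [/eqP -> _|hx hx0].
  by apply: Rle_trans (Rmin_r _ _) _.
by apply: Rle_trans (Rmin_l _ _) _; apply: h.
Qed.

(** If l c were near k, then l a - k q = q (l c - k) - l (q c - a) would have norm at most 2/8 + 2/8
    < 1 and vanish. Then q divides l a, hence l, although 0 < |l| < |q|. *)
Lemma spaced_of_reduced (c : cplx) q a (n : R) : q <> gzero -> 0 < n -> nrm q <= 2 * n ->
  cn (cerr q a c) * n <= 2 -> (forall x, gdvd q (gmul x a) -> gdvd q x) ->
  spaced c (sqrt (nrm q) / 8) (/ (4 * sqrt (nrm q))).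
Proof.
move=> hq hn hqn hc hred l hl hin [[k1 hk1] [k2 hk2]].
have hq1 := nrm_ge1 hq; set Q := sqrt (nrm q) in hin hk1 hk2.
have hQQ : Q * Q = nrm q by apply: sqrt_sqrt; lra.
have hQ : 0 < Q by apply: sqrt_lt_R0; lra.
pose k : gint := (k1, k2); pose w := gsub (gmul l a) (gmul k q).
set s := / (4 * Q) in hk1 hk2; have hs : s * (4 * Q) = 1 by rewrite /s Rinv_l; lra.
have hs0 : 0 < s by apply: Rinv_0_lt_compat; lra.
have hA : cn (gmulC q (cerr l k c)) < 1/8.
  have h1 : cn (cerr l k c) < 2 * (s * s).
    have sq t : Rabs t < s -> t * t < s * s by move=> /Rabs_def2 [? ?]; nra.
    rewrite [2 * _]Rmult_plus_distr_r !Rmult_1_l.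
    exact: Rplus_lt_compat (sq _ hk1) (sq _ hk2).
  rewrite cn_gmulC -hQQ.
  have : Q * Q * cn (cerr l k c) < Q * Q * (2 * (s * s)) by apply: Rmult_lt_compat_l; nra.
  have -> : Q * Q * (2 * (s * s)) = (s * (4 * Q)) * (s * (4 * Q)) / 8 by field.
  by rewrite hs; lra.
have hll : nrm l <= 2 * ((Q / 8) * (Q / 8)).
  case: hin => /Rabs_def2_le [? ?] /Rabs_def2_le [? ?]; rewrite nrmE; nra.
have hB : cn (gmulC l (cerr q a c)) <= 1/8.
  rewrite cn_gmulC; have c0 := cn_ge0 (cerr q a c).
  have h1 : cn (cerr q a c) * (Q * Q) <= 4 by rewrite hQQ; nra.
  apply: (@Rle_trans _ (2 * ((Q / 8) * (Q / 8)) * cn (cerr q a c))).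
    by apply: Rmult_le_compat_r.
  by lra.
have hw : nrm w <= 2 * cn (gmulC q (cerr l k c)) + 2 * cn (gmulC l (cerr q a c)).
  set u := gmulC q (cerr l k c) in hA *; set v := gmulC l (cerr q a c) in hB *.
  have -> : nrm w = (fst u - fst v) * (fst u - fst v) + (snd u - snd v) * (snd u - snd v).
    rewrite nrmE /w /u /v /cerr /gmulC /gsub /gadd /gopp /gmul /k /=.
    by rewrite !(plus_IZR, minus_IZR, opp_IZR, mult_IZR); ring.
  rewrite /cn; have := Rle_0_sqr (fst u + fst v); have := Rle_0_sqr (snd u + snd v).
  by rewrite /Rsqr; lra.
have hw0 : w = gzero.
  by apply: NNPP => h; have := nrm_ge1 h; lra.
have hd : gdvd q l.
  by apply: hred; exists k; rewrite (gsub_eq0 hw0) gmul_comm.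
have := gdvd_norm hl hd => /IZR_le; rewrite -/(nrm q) -/(nrm l) -hQQ; nra.
Qed.

Lemma good_approx (c : cplx) (B : R) : ~ in_Qi c ->
  exists Q, B < Q /\ 0 < Q /\ spaced c (Q / 8) (/ (4 * Q)).
Proof.
move=> hc; have [K hK] := @nat_floor (Rabs B) (Rabs_pos B).
have [eta [h0 h]] := uniform_gap (gbox K) hc.
(* With such N the bound eta N^2 <= 2 fails, so the denominator cannot lie in the box where the gap
   eta holds. *)
have [N hN] := INR_unbounded (Rmax 1 (2 / eta)).
have N1 : 1 < INR N by have := Rmax_l 1 (2 / eta); lra.
have N2 : 2 / eta < INR N by have := Rmax_r 1 (2 / eta); lra.
have hN1 : (1 <= N)%N by have := INR_lt 1 N N1; lia.
have [q [a [hq hqN hcn hred]]] := dirichlet_reduced c hN1.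
have hq1 := nrm_ge1 hq.
have hQ : 0 < sqrt (nrm q) by apply: sqrt_lt_R0; lra.
exists (sqrt (nrm q)); split; last first.
  by split=> //; apply: (@spaced_of_reduced c q a (INR N * INR N)) => //; nra.
apply: Rnot_le_lt => hle.
have hin : q \in gbox K.
  have hin : inball (Rabs B) q.
    apply: inball_nrm; first exact: Rabs_pos.
    have := Rle_abs B; have := sqrt_sqrt (nrm q) ltac:(lra); nra.
  by case: hin => g1 g2; apply/mem_gbox; split; apply: zabs_le_nat hK _.
have h1 := h q a hin hq.
have h2 : 2 < INR N * eta.
  by have -> : 2 = 2 / eta * eta; [field; lra | apply: Rmult_lt_compat_r].
have h3 : eta * (INR N * INR N) <= 2.
  by apply: Rle_trans hcn; apply: Rmult_le_compat_r => //; nra.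
by nra.
Qed.

(** * Choice of parameters *)

(** With u about a and 1/s about a^3, both terms under the root of [type2_bound] have order a^8, so
    the bilinear part is a^9, while the linear sums are a^8. The total is 2 (9504 + 729 + 18900 +
    162) = 58590. *)
Lemma prime_bound_est M s Y a : 1 <= a -> INR M = a ^ 5 -> 0 < s -> / s <= 8 * a ^ 3 ->
  IZR Y <= a ^ 2 -> a ^ 2 <= 2 * IZR Y ->
  prime_bound M s Y <= 60000 * ((3 + 2 * ln (INR M)) ^ 3 * a ^ 9).
Proof.
move=> ha hm hs hsa hY1 hY2.
have ha5 : 1 <= a ^ 5 by apply: pow_R1_Rle.
have ha2 : 1 <= a ^ 2 by apply: pow_R1_Rle.
have hM : (1 <= M)%N.
  have : INR 0 < INR M by rewrite hm /=; lra.
  by move/INR_lt; lia.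
have hL := L_ge3 hM; rewrite /prime_bound /type2_bound; set L := 3 + 2 * ln (INR M) in hL *.
rewrite hm.
have pw i j : (i <= j)%N -> a ^ i <= a ^ j by move=> hij; apply: Rle_pow => //; lia.
have p0 i : 0 < a ^ i by apply: pow_lt; lra.
have hs0 : 0 < / s by apply: Rinv_0_lt_compat.
have hL1 : L <= L ^ 3 by rewrite -{1}(pow_1 L); apply: Rle_pow; [lra | lia].
have hL3 : 0 < L ^ 3 by apply: pow_lt; lra.
have t1 : 18 * L * (66 * a ^ 5 * (L * (L / s))) <= 9504 * (L ^ 3 * a ^ 9).
  have -> : 18 * L * (66 * a ^ 5 * (L * (L / s))) = 1188 * (L ^ 3 * a ^ 5) * / s.
    by field; lra.
  have h : 0 < L ^ 3 * a ^ 5 by apply: Rmult_lt_0_compat.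
  apply: (@Rle_trans _ (1188 * (L ^ 3 * a ^ 5) * (8 * a ^ 3))).
    by apply: Rmult_le_compat_l => //; lra.
  have -> : 1188 * (L ^ 3 * a ^ 5) * (8 * a ^ 3) = 9504 * (L ^ 3 * a ^ 8) by ring.
  by apply: Rmult_le_compat_l; [lra | apply: Rmult_le_compat_l; [lra | apply: pw]].
have mon k x : 0 <= x -> x <= a ^ 9 -> 0 <= k -> k * L * x <= k * (L ^ 3 * a ^ 9).
  move=> hx hxa hk; rewrite Rmult_assoc; apply: Rmult_le_compat_l => //.
  by apply: Rmult_le_compat; lra.
have hYp : 0 < IZR Y by lra.
have t2 : 729 * L * IZR Y <= 729 * (L ^ 3 * a ^ 9).
  by apply: mon; [lra | have := pw 2%N 9%N isT; lra | lra].
have t4 : 162 * a ^ 5 * L <= 162 * (L ^ 3 * a ^ 9).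
  have -> : 162 * a ^ 5 * L = 162 * L * a ^ 5 by ring.
  by apply: mon; [have := p0 5%N; lra | exact: pw | lra].
have hu : sqrt (IZR Y) * sqrt (IZR Y) = IZR Y by apply: sqrt_sqrt; lra.
have hu0 : 0 < sqrt (IZR Y) by apply: sqrt_lt_R0.
have hsq : sqrt (9 * (a ^ 5 / sqrt (IZR Y)) ^ 2 + 27 * a ^ 5 * (20 + 2) * (L / s)) <= 70 * (L * a ^ 4).
  have h4 : 0 <= 70 * (L * a ^ 4) by have := p0 4%N; nra.
  rewrite -(sqrt_Rsqr (70 * (L * a ^ 4))) //; apply: sqrt_le_1_alt; rewrite /Rsqr.
  have e1 : (a ^ 5 / sqrt (IZR Y)) ^ 2 <= 2 * a ^ 8.
    have -> : (a ^ 5 / sqrt (IZR Y)) ^ 2 = a ^ 10 * / (sqrt (IZR Y) * sqrt (IZR Y)).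
      by field; lra.
    rewrite hu; apply: (Rmult_le_reg_r (IZR Y)) => //; rewrite Rmult_assoc Rinv_l ?Rmult_1_r; last lra.
    have -> : a ^ 10 = a ^ 8 * a ^ 2 by ring.
    have -> : 2 * a ^ 8 * IZR Y = a ^ 8 * (2 * IZR Y) by ring.
    by apply: Rmult_le_compat_l => //; have := p0 8%N; lra.
  have e2 : 27 * a ^ 5 * (20 + 2) * (L / s) <= 4752 * (L * a ^ 8).
    have -> : 27 * a ^ 5 * (20 + 2) * (L / s) = 594 * (L * a ^ 5) * / s by field; lra.
    have -> : 4752 * (L * a ^ 8) = 594 * (L * a ^ 5) * (8 * a ^ 3) by ring.
    apply: Rmult_le_compat_l => //; have := p0 5%N => h5.
    have h6 : 0 < L * a ^ 5 by apply: Rmult_lt_0_compat; lra.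
    by lra.
  have -> : 70 * (L * a ^ 4) * (70 * (L * a ^ 4)) = 4900 * (L * (L * a ^ 8)) by ring.
  have h8 : 0 < a ^ 8 by exact: p0.
  have h9 : a ^ 8 <= L * a ^ 8 by nra.
  by nra.
have t3 : 18 * L * L * (15 * a ^ 5 * sqrt (9 * (a ^ 5 / sqrt (IZR Y)) ^ 2 +
    27 * a ^ 5 * (20 + 2) * (L / s))) <= 18900 * (L ^ 3 * a ^ 9).
  have -> : 18900 * (L ^ 3 * a ^ 9) = 18 * L * L * (15 * a ^ 5 * (70 * (L * a ^ 4))) by ring.
  apply: Rmult_le_compat_l; first by nra.
  by apply: Rmult_le_compat_l => //; have := p0 5%N; lra.
by have hp : 0 < L ^ 3 * a ^ 9; [apply: Rmult_lt_0_compat | lra].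
Qed.

(** The exponents 3/5, 1/12 and 1/5 of M become the integers 180, 25 and 60 for x = M^(1/300), and
    single powers of x remain as room for small losses. The factor 2 allows for M being an integer
    part. *)
Definition good (c : cplx) (M : nat) : Prop := exists Q,
  let x := Rpower (INR M) (1 / 300) in
  [/\ x ^ 180 <= Q, Q <= 2 * x ^ 180 & spaced c (Q / 8) (/ (4 * Q))].

(** Multiples of h c are multiples of c; a coordinate of l h is a sum of two products, hence the
    loss of 2 n in the range, with no loss in s. *)
Lemma spaced_mul c R0 s h n : spaced c R0 s -> h <> gzero -> inball n h -> 0 < n ->
  spaced (gmulC h c) (R0 / (2 * n)) s.
Proof.
move=> hsp hh [h1 h2] hn l hl [l1 l2]; rewrite -gmulC_mul; apply: hsp; first exact: gmul_neq0.
have hr : R0 / (2 * n) * n + R0 / (2 * n) * n = R0 by field; lra.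
have bd x y : Rabs x <= R0 / (2 * n) -> Rabs y <= n -> Rabs (x * y) <= R0 / (2 * n) * n.
  by move=> hx hy; rewrite Rabs_mult; apply: Rmult_le_compat => //; exact: Rabs_pos.
have b11 := bd _ _ l1 h1; have b12 := bd _ _ l1 h2; have b21 := bd _ _ l2 h1; have b22 := bd _ _ l2 h2.
rewrite /inball /gmul [(_, _).1]/= [(_, _).2]/= minus_IZR plus_IZR !mult_IZR.
split; apply: Rle_trans (Rabs_triang _ _) _; rewrite ?Rabs_Ropp; lra.
Qed.

Lemma close_iff c del p : close_to_lattice del c p <->
  close del (fst (gmulC p c)) /\ close del (snd (gmulC p c)).
Proof.
split=> [[q hq]|[[k1 h1] [k2 h2]]].
  split; [exists q.1 | exists q.2]; apply: Rle_trans hq; [exact: Rmax_l | exact: Rmax_r].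
by exists (k1, k2); apply: Rmax_lub.
Qed.

(* In terms of [x = M^(1/300)]: [Q ~ x^180], [u^2 ~ x^120], [delta >= x^-25], the kernel has degree
   about [x^2 / delta], and the prime sums are [O(x^540)] up to logarithms. *)
Lemma estimate c M x P1 P2 w1 w2 del : good c M -> x = Rpower (INR M) (1 / 300) ->
  11000 <= x -> 0 <= P1 -> P1 < P2 -> P2 <= INR M -> w1 < w2 -> w2 <= w1 + 2 * PI ->
  / x ^ 25 <= del -> del <= 1/2 ->
  Rabs (INR (pi_star P1 P2 w1 w2 del c) - 4 * del ^ 2 * INR (pi_count P1 P2 w1 w2)) <=
  4 * 10 ^ 10 * ((3 + 2 * ln (INR M)) ^ 3 / x) * (del ^ 2 * (INR M) ^ 2).
Proof.
move=> [Q [hQ1 hQ2 hsp]] ex hx h1 h12 h2M hw hw2 hd1 hd2; rewrite -ex in hQ1 hQ2.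
have p0 i : 0 < x ^ i by apply: pow_lt; lra.
have pw i j : (i <= j)%N -> x ^ i <= x ^ j by move=> hij; apply: Rle_pow; [lra | lia].
have pa i j : x ^ (i + j) = x ^ i * x ^ j by exact: pow_add.
have hM0 : 0 < INR M by lra.
have hm : INR M = x ^ 300.
  rewrite ex -Rpower_pow; last exact: exp_pos.
  rewrite Rpower_mult [INR 300](_ : _ = 300); last by rewrite INR_IZR_INZ.
  by rewrite (_ : 1 / 300 * 300 = 1) ?Rpower_1 //; field.
have hm1 : 1 <= INR M by rewrite hm; apply: pow_R1_Rle; lra.
have hM : (1 <= M)%N by have := INR_lt 0 M hM0; lia.
have hd0 : 0 < del by apply: Rlt_le_trans hd1; apply: Rinv_0_lt_compat.
have x25 : / del <= x ^ 25.
  by rewrite -(Rinv_inv (x ^ 25)); apply: Rinv_le_contravar => //; apply: Rinv_0_lt_compat.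
have hid : 0 < / del by apply: Rinv_0_lt_compat.
have hid1 : 1 <= / del by rewrite -Rinv_1; apply: Rinv_le_contravar; lra.
have [l [hl hl2]] : exists l : nat, x ^ 2 * / del <= INR l /\ INR l <= x ^ 2 * / del + 1.
  have [k hk] := @nat_floor (x ^ 2 * / del) ltac:(apply: Rmult_le_pos; [have := p0 2%N; lra | lra]).
  by exists k.+1; rewrite S_INR; lra.
have x2 : 1 <= x ^ 2 by apply: pow_R1_Rle; lra.
have hxd : 1 <= x ^ 2 * / del by nra.
have hl0 : (1 <= l)%N by have := INR_lt 0 l ltac:(rewrite /=; lra); lia.
(* The power 40 of the Dirichlet kernel gives decay x^(-80); with n <= 81 x^27 the tail is at most
   81 x^(-53), negligible against delta^2 >= x^(-50). *)
pose n := (40 * l + 1)%N.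
have hn27 : INR n <= 81 * x ^ 27.
  have h27 : x ^ 2 * / del <= x ^ 27.
    by rewrite (pa 2 25)%N; apply: Rmult_le_compat_l => //; lra.
  have h27' : 1 <= x ^ 27 by apply: pow_R1_Rle; lra.
  rewrite /n plus_INR mult_INR [INR 40](_ : _ = 40) ?[INR 1]/=; last by rewrite INR_IZR_INZ.
  by lra.
have hn1 : (1 <= n)%N by rewrite /n; lia.
have hn0 : 1 <= INR n by have := le_INR 1 n ltac:(lia).
have [b [hb0 hb]] := @dirichlet_kernel l 40 n erefl hl0.
pose nu := / x; have hnu : 0 < nu <= 1.
  split; first by apply: Rinv_0_lt_compat; lra.
  by rewrite -Rinv_1; apply: Rinv_le_contravar; lra.
have hdn : 0 < del * nu by nra.
have hldn : x <= INR l * (del * nu).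
  have -> : x = (x ^ 2 * / del) * (del * nu) by rewrite /nu; field; lra.
  by apply: Rmult_le_compat_r; lra.
pose e1 := INR n * (/ x) ^ 80.
have hkern y : ~ near (del * nu) y -> kern n b y <= e1.
  move=> hy; apply: Rle_trans (hb _ _ hdn hy) _.
  apply: Rmult_le_compat_l; first lra.
  apply: pow_incr; split; first by apply: Rlt_le; apply: Rinv_0_lt_compat; lra.
  by apply: Rinv_le_contravar; lra.
have he1x : e1 <= 81 * / x ^ 53.
  apply: (@Rle_trans _ (81 * x ^ 27 * (/ x) ^ 80)).
    apply: Rmult_le_compat_r => //; apply: pow_le; apply: Rlt_le; apply: Rinv_0_lt_compat; lra.
  rewrite pow_inv; have -> : x ^ 80 = x ^ 27 * x ^ 53 by rewrite -pa.
  move: (x ^ 27) (x ^ 53) (p0 27%N) (p0 53%N) => y z hy hz.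
  by right; field; lra.
have he1 : 0 <= e1 <= 1.
  split; first by apply: Rmult_le_pos; [lra | apply: pow_le; apply: Rlt_le; apply: Rinv_0_lt_compat; lra].
  apply: Rle_trans he1x _; have := pw 1%N 53%N isT; rewrite pow_1 => h.
  apply: (Rmult_le_reg_r (x ^ 53)) => //; rewrite Rmult_assoc Rinv_l; last by apply: Rgt_not_eq.
  by lra.
have hT : / INR (2 * n + 1) <= del * nu.
  rewrite -(Rinv_inv (del * nu)); apply: Rinv_le_contravar; first by apply: Rinv_0_lt_compat.
  have -> : / (del * nu) = x * / del by rewrite /nu; field; lra.
  apply: (@Rle_trans _ (INR l)); last by apply: le_INR; rewrite /n; lia.
  apply: Rle_trans hl; apply: Rmult_le_compat_r; first lra.
  by have := pw 1%N 2%N isT; rewrite pow_1.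
pose ap p := ind (gprime p /\ inD P1 P2 w1 w2 (gtoC p)).
have hap p : 0 <= ap p <= 1 by exact: ind_bound.
pose a := x ^ 60.
have ha : 1 <= a by apply: pow_R1_Rle; lra.
have ham : INR M = a ^ 5 by rewrite hm /a -pow_mult.
have x180 : x ^ 180 = a ^ 3 by rewrite /a -pow_mult.
have hQ0 : 0 < Q by have := p0 180%N; lra.
pose s := / (4 * Q); have hs : 0 < s by apply: Rinv_0_lt_compat; lra.
have his : / s = 4 * Q by rewrite /s Rinv_inv.
have ha2 : 1 <= a ^ 2 by apply: pow_R1_Rle.
have [Y0 hY] := @nat_floor (a ^ 2) ltac:(lra).
pose Y := Z.of_nat Y0; have eY : IZR Y = INR Y0 by rewrite INR_IZR_INZ.
have hY1 : (1 <= Y)%Z.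
  by suff : (0 < Y)%Z by [lia]; apply: lt_IZR; lra.
have hY1' : 1 <= IZR Y by apply: IZR_le.
have hE := @prime_bound_est M s Y a ha ham hs ltac:(lra) ltac:(lra) ltac:(lra).
set L := 3 + 2 * ln (INR M) in hE *.
have hL : 3 <= L by apply: L_ge3.
pose E := 4 * (60000 * (L ^ 3 * a ^ 9)).
have hL3 : 0 < L ^ 3 by apply: pow_lt; lra.
have ha9 : 0 < a ^ 9 by apply: pow_lt; lra.
have hE0 : 0 < E by rewrite /E; have := Rmult_lt_0_compat _ _ hL3 ha9; lra.
pose r := Q / 8 / (2 * INR n).
(* Here r = Q/(16 n) >= x^153/1296, so that x^3 >= 8 times 1296 = 10368 is needed; this explains the
   threshold 11000. *)
have hr : 8 * x ^ 150 <= r.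
  apply: (Rmult_le_reg_r (2 * INR n)); first lra.
  have -> : r * (2 * INR n) = Q / 8 by rewrite /r; field; lra.
  have h3 : x ^ 180 = x ^ 150 * x ^ 27 * x ^ 3.
    by rewrite -!pa.
  have h4 : 0 < x ^ 150 * x ^ 27 by apply: Rmult_lt_0_compat.
  have h5 : 11000 <= x ^ 3 by have := pw 1%N 3%N isT; rewrite pow_1; lra.
  have h6 : x ^ 150 * INR n <= 81 * (x ^ 150 * x ^ 27).
    by have := p0 150%N => h; nra.
  by nra.
have hsqrt : sqrt (INR M) = x ^ 150.
  rewrite hm (_ : x ^ 300 = Rsqr (x ^ 150)); first by apply: sqrt_Rsqr; have := p0 150%N; lra.
  by rewrite /Rsqr -pa.
have h120 : a ^ 2 <= x ^ 150 by rewrite /a -pow_mult; apply: pw.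
have hEh (k1 k2 : Z) : (Z.abs k1 <= Z.of_nat n)%Z -> (Z.abs k2 <= Z.of_nat n)%Z ->
    ~ (k1 = 0%Z /\ k2 = 0%Z) ->
    Cmod (\csum_(p <- gbox M) (ap p *
      e (IZR k1 * fst (gmulC p c) + IZR k2 * snd (gmulC p c)))) <= E.
  (* For h = k1 - i k2 the real part of h p c is k1 Re(p c) + k2 Im(p c). *)
  move=> hk1 hk2 hk; pose h : gint := (k1, (- k2)%Z).
  have hh : h <> gzero by move=> [] hh1 hh2; apply: hk; lia.
  have hin : inball (INR n) h.
    by rewrite /inball /h -!abs_IZR !INR_IZR_INZ /=; split; apply: IZR_le; lia.
  have hspt := @spaced_mul c (Q / 8) s h (INR n) hsp hh hin ltac:(lra).
  rewrite -/r in hspt.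
  have -> : \csum_(p <- gbox M) (ap p *
      e (IZR k1 * fst (gmulC p c) + IZR k2 * snd (gmulC p c))) =
     \csum_(p <- gbox M) (ap p * e (fst (gmulC p (gmulC h c)))).
    apply: eq_bigr => p _; congr (_ * e _)%C.
    by rewrite /gmulC /h [(_, _).1]/= [(_, _).2]/= /= opp_IZR; ring.
  apply: Rle_trans (Rmult_le_compat_l 4 _ _ _ hE); last lra.
  apply: (sector_exp_sum hM h1 h12 h2M hw hw2 hspt hs).
  - have -> : / (2 * s) = 2 * Q by rewrite /s; field; lra.
    have : x ^ 300 = x ^ 180 * x ^ 120 by rewrite -pa.
    have : 11000 <= x ^ 120 by have := pw 1%N 120%N isT; rewrite pow_1; lra.
    have : 1 <= x ^ 180 by apply: pow_R1_Rle; lra.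
    by rewrite hm => k3 k4 k5; nra.
  - exact: hY1.
  - by rewrite eY ham; have : a ^ 2 <= a ^ 5; [apply: Rle_pow => //; lia | lra].
  - by rewrite eY; lra.
  - by rewrite hsqrt.
have hcount := @count_bound n b n del nu e1 hn1 (leqnn n) (conj hd0 hd2) hnu he1 hb0 hT hkern
  gint (gbox M) ap (fun p => fst (gmulC p c)) (fun p => snd (gmulC p c)) E
  (fun p => (hap p).1) (Rlt_le _ _ hE0) hEh.
have ecount : INR (pi_count P1 P2 w1 w2) = \rsum_(p <- gbox M) ap p.
  apply: count_upto_sum; [lra | lra |].
  by move=> z [_ hz]; apply: inD_nrm hz.
have estar : INR (pi_star P1 P2 w1 w2 del c) = \rsum_(p <- gbox M) (ap p *
    ind (close del (fst (gmulC p c)) /\ close del (snd (gmulC p c)))).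
  rewrite /pi_star (@count_upto_sum P2 M) //; try lra.
    apply: eq_bigr => p _; rewrite /ap -ind_and; apply: ind_iff.
    by have := close_iff c del p; tauto.
  by move=> z [_ [hz _]]; apply: inD_nrm hz.
rewrite -ecount -estar in hcount; apply: Rle_trans hcount _.
set S := INR (pi_count _ _ _ _) in ecount *.
(* Counting all lattice points instead of primes loses only a logarithm, which the factors nu = 1/x
   and [e1] more than compensate. *)
have hS : 0 <= S <= 9 * INR M ^ 2.
  split; first exact: pos_INR.
  rewrite ecount; apply: (@Rle_trans _ (\rsum_(p <- gbox M) 1)).
    by apply: rsum_le => p; have := hap p; lra.
  rewrite rsum_const size_gbox mult_INR plus_INR mult_INR [INR 2]/= [INR 1]/=; nra.
have hM2 : 0 < INR M ^ 2 by apply: pow_lt.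
set D := del ^ 2 * INR M ^ 2.
have hD : 0 < D by apply: Rmult_lt_0_compat => //; apply: pow_lt.
have hix : 0 < / x by apply: Rinv_0_lt_compat; lra.
have hL27 : 27 <= L ^ 3 by nra.
have T1 : 21 * nu * del ^ 2 * S <= 7 * (L ^ 3 / x) * D.
  have hd22 : 0 < del ^ 2 by apply: pow_lt.
  have : del ^ 2 * S <= 9 * D by rewrite /D; nra.
  rewrite /nu => k1; have : 21 * / x * (del ^ 2 * S) <= 21 * / x * (9 * D).
    by apply: Rmult_le_compat_l; lra.
  have -> : 7 * (L ^ 3 / x) * D = 7 * / x * D * L ^ 3 by rewrite /Rdiv; ring.
  have hxD : 0 < / x * D by apply: Rmult_lt_0_compat.
  by nra.
have T2 : 25 * INR n ^ 2 * del ^ 2 * E <= 3937 * 10 ^ 7 * (L ^ 3 / x) * D.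
  have k1 : INR n ^ 2 <= 6561 * x ^ 54.
    have -> : x ^ 54 = x ^ 27 * x ^ 27 by rewrite -pa.
    by have := p0 27%N; nra.
  have k2 : D = del ^ 2 * (x ^ 599 * x).
    by rewrite /D hm -pow_mult (Rmult_comm (x ^ 599)).
  have k3 : E = 240000 * (L ^ 3 * x ^ 540).
    have -> : x ^ 540 = a ^ 9 by rewrite /a -pow_mult.
    by rewrite /E; ring.
  rewrite k2 k3; have -> : 3937 * 10 ^ 7 * (L ^ 3 / x) * (del ^ 2 * (x ^ 599 * x)) =
     3937 * 10 ^ 7 * (L ^ 3 * del ^ 2) * x ^ 599 by field; lra.
  have hc : 0 < L ^ 3 * del ^ 2 by apply: Rmult_lt_0_compat => //; apply: pow_lt.
  have -> : 25 * INR n ^ 2 * del ^ 2 * (240000 * (L ^ 3 * x ^ 540)) =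
     6000000 * (L ^ 3 * del ^ 2) * (INR n ^ 2 * x ^ 540) by ring.
  have k4 : INR n ^ 2 * x ^ 540 <= 6561 * x ^ 599.
    apply: (@Rle_trans _ (6561 * x ^ 54 * x ^ 540)).
      by apply: Rmult_le_compat_r => //; apply: Rlt_le; apply: p0.
    by rewrite Rmult_assoc -pa; apply: Rmult_le_compat_l; [lra | apply: pw].
  apply: (@Rle_trans _ (6000000 * (L ^ 3 * del ^ 2) * (6561 * x ^ 599))).
    by apply: Rmult_le_compat_l; lra.
  have hz : 0 < (L ^ 3 * del ^ 2) * x ^ 599 by apply: Rmult_lt_0_compat.
  have -> : 10 ^ 7 = 10000000 by ring.
  by lra.
have T3 : 2 * e1 * S <= 54 * (L ^ 3 / x) * D.
  have k1 : / x ^ 50 <= del ^ 2.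
    have -> : / x ^ 50 = / x ^ 25 * / x ^ 25.
      by rewrite -Rinv_mult -pa.
    have : 0 < / x ^ 25 by apply: Rinv_0_lt_compat.
    by nra.
  have k2 : e1 <= 81 * (/ x * del ^ 2).
    apply: Rle_trans he1x _; apply: Rmult_le_compat_l; first lra.
    have -> : / x ^ 53 = / x ^ 3 * / x ^ 50 by rewrite -Rinv_mult -pa.
    apply: Rmult_le_compat => //; try (apply: Rlt_le; apply: Rinv_0_lt_compat; exact: p0).
    by apply: Rinv_le_contravar; [lra | have := pw 1%N 3%N isT; rewrite pow_1].
  have k3 : 0 < / x * del ^ 2 by apply: Rmult_lt_0_compat => //; apply: pow_lt.
  apply: (@Rle_trans _ (2 * (81 * (/ x * del ^ 2)) * (9 * INR M ^ 2))).
    by apply: Rmult_le_compat; lra.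
  have -> : 2 * (81 * (/ x * del ^ 2)) * (9 * INR M ^ 2) = 1458 * (/ x * D).
    by rewrite /D; ring.
  have -> : 54 * (L ^ 3 / x) * D = 54 * L ^ 3 * (/ x * D) by rewrite /Rdiv; ring.
  have hxD : 0 < / x * D by apply: Rmult_lt_0_compat.
  by apply: Rmult_le_compat_r; lra.
have hz : 0 < L ^ 3 / x * D.
  by apply: Rmult_lt_0_compat => //; apply: Rdiv_lt_0_compat; lra.
have -> : 4 * 10 ^ 10 * (L ^ 3 / x) * D = 40000000000 * (L ^ 3 / x * D) by ring.
have e7 : 10 ^ 7 = 10000000 by ring.
by rewrite e7 in T2; lra.
Qed.

(** * The sequence of moduli M and the conclusion *)

Lemma good_unbounded c (B : nat) : ~ in_Qi c -> exists M, (B < M)%N /\ good c M.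
Proof.
move=> hc; have [Q [hB [hQ0 hsp]]] := good_approx (INR B + 2) hc.
have hB0 := pos_INR B.
have hQ1 : 1 < Q by lra.
have hQQ : Q <= Rpower Q (5 / 3).
  by rewrite -{1}(Rpower_1 Q) //; apply: Rle_Rpower; lra.
have [M [hM1 hM2]] := @nat_floor (Rpower Q (5 / 3)) ltac:(lra).
have hBM : INR B < INR M by lra.
have hM0 : 1 <= INR M by lra.
exists M; split; first by move/INR_lt: hBM; lia.
exists Q => x.
have hx : x ^ 180 = Rpower (INR M) (3 / 5).
  rewrite /x -Rpower_pow; last exact: exp_pos.
  rewrite Rpower_mult [INR 180](_ : _ = 180); last by rewrite INR_IZR_INZ.
  by congr Rpower; field.
have hQ53 : Rpower (Rpower Q (5 / 3)) (3 / 5) = Q.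
  by rewrite Rpower_mult (_ : 5 / 3 * (3 / 5) = 1) ?Rpower_1 //; field.
split=> //; rewrite hx.
  by rewrite -[X in _ <= X]hQ53; apply: Rle_Rpower_l; lra.
(* Q^(5/3) < M + 1 <= 2 M, and 2^(3/5) <= 2. *)
rewrite -[X in X <= _]hQ53.
apply: (@Rle_trans _ (Rpower (2 * INR M) (3 / 5))).
  by apply: Rle_Rpower_l; lra.
rewrite -Rpower_mult_distr; try lra.
apply: Rmult_le_compat_r; first by apply: Rlt_le; exact: exp_pos.
by rewrite -{2}(Rpower_1 2); [apply: Rle_Rpower; lra | lra].
Qed.

Lemma good_sequence c : ~ in_Qi c ->
  exists M : nat -> nat, (forall k, (M k < M k.+1)%N) /\ forall k, good c (M k).
Proof.
move=> hc; pose nxt B := epsilon (inhabits 0%N) (fun M => (B < M)%N /\ good c M).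
have hnxt B : (B < nxt B)%N /\ good c (nxt B).
  exact: (epsilon_spec (inhabits 0%N) (fun M => (B < M)%N /\ good c M) (good_unbounded B hc)).
exists (fun k => iter k.+1 nxt 0%N); split=> k; first by rewrite [iter k.+2 _ _]iterS; apply: (hnxt _).1.
by rewrite iterS; apply: (hnxt _).2.
Qed.

(** With z = M^(1/2400) the denominator is z^8, while ln z <= z - 1 bounds both 3 + 2 ln M and ln M
    by 4800 z; so the numerator is at most a constant times z^4, and eta absorbs the constant once z
    >= C/eta. *)
Lemma log_bound (eta : R) : 0 < eta -> exists K : nat, forall M : nat, (K <= M)%N ->
  11000 <= Rpower (INR M) (1 / 300) /\ 0 < ln (INR M) /\
  4 * 10 ^ 10 * ((3 + 2 * ln (INR M)) ^ 3 / Rpower (INR M) (1 / 300)) <= eta / ln (INR M).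
Proof.
move=> heta; pose C := 4 * 10 ^ 10 * 4800 ^ 4.
have hC : 0 < C by rewrite /C; lra.
pose A := 11000 + C / eta.
have hA : 11000 < A by have := Rdiv_lt_0_compat _ _ hC heta; rewrite /A; lra.
have [K hK] := INR_unbounded (Rpower A 2400); exists K => M hKM.
have hAM : Rpower A 2400 < INR M by apply: Rlt_le_trans hK _; apply: le_INR; lia.
have hA0 : 0 < Rpower A 2400 by exact: exp_pos.
set m := INR M in hAM *.
pose z := Rpower m (1 / 2400).
have hz : A <= z.
  have -> : A = Rpower (Rpower A 2400) (1 / 2400).
    by rewrite Rpower_mult (_ : 2400 * (1 / 2400) = 1) ?Rpower_1 //; [lra | field].
  by apply: Rle_Rpower_l; lra.
have ex : Rpower m (1 / 300) = z ^ 8.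
  rewrite /z -Rpower_pow; last exact: exp_pos.
  by rewrite Rpower_mult; congr Rpower; rewrite INR_IZR_INZ /=; field.
have em : ln m = 2400 * ln z by rewrite /z /Rpower ln_exp; field.
have hlz : ln z <= z - 1.
  by have := exp_ineq1_le (ln z); rewrite exp_ln; lra.
have hlz0 : 0 < ln z by rewrite -ln_1; apply: ln_increasing; lra.
rewrite ex em; split.
  by rewrite -(pow_1 11000); apply: Rle_trans (pow_incr 11000 z 1 _) (Rle_pow _ _ _ _ _); [lra | lra | lia].
split; first by lra.
set L := 3 + _; have hL : 0 < L <= 4800 * z by rewrite /L; lra.
have hz8 : 0 < z ^ 8 by apply: pow_lt; lra.
apply: (Rmult_le_reg_r (2400 * ln z)); first lra.
have -> : eta / (2400 * ln z) * (2400 * ln z) = eta by field; lra.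
apply: (Rmult_le_reg_r (z ^ 8)) => //.
have -> : 4 * 10 ^ 10 * (L ^ 3 / z ^ 8) * (2400 * ln z) * z ^ 8 = 4 * 10 ^ 10 * (L ^ 3 * (2400 * ln z)).
  by field; lra.
apply: (@Rle_trans _ (4 * 10 ^ 10 * (4800 * z) ^ 4)).
  have -> : (4800 * z) ^ 4 = (4800 * z) ^ 3 * (4800 * z) by ring.
  apply: Rmult_le_compat_l; first lra.
  apply: Rmult_le_compat; [apply: pow_le; lra | lra | apply: pow_incr; lra | lra].
have -> : 4 * 10 ^ 10 * (4800 * z) ^ 4 = C * z ^ 4 by rewrite /C; ring.
have -> : eta * z ^ 8 = (eta * z ^ 4) * z ^ 4 by ring.
apply: Rmult_le_compat_r; first by apply: pow_le; lra.
have h1 : z <= z ^ 4 by rewrite -{1}(pow_1 z); apply: Rle_pow; [lra | lia].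
have h2 : eta * (C / eta) = C by field; lra.
have h3 : C / eta <= z ^ 4 by rewrite /A in hz; lra.
by nra.
Qed.

Lemma equidistribution (c : cplx) : ~ in_Qi c -> exists M : nat -> nat,
  (forall k, Peano.lt (M k) (M k.+1)) /\
  forall eta, 0 < eta -> exists K, forall k, Peano.le K k -> forall P1 P2 w1 w2 delta,
    0 <= P1 -> P1 < P2 -> P2 <= INR (M k) -> w1 < w2 -> w2 <= w1 + 2 * PI ->
    Rpower (INR (M k)) (- (1 / 12)) <= delta -> delta <= 1/2 ->

    Rabs (INR (pi_star P1 P2 w1 w2 delta c) - 4 * delta ^ 2 * INR (pi_count P1 P2 w1 w2)) <=
    eta * (delta ^ 2 * (INR (M k)) ^ 2 / ln (INR (M k))).
Proof.
move=> /good_sequence [M [hM hgood]]; exists M; split; first by move=> k; apply/ltP.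
have hMk k : (k <= M k)%N by elim: k => [//|k ih]; exact: leq_ltn_trans ih (hM k).
move=> eta /log_bound [K hK]; exists K => k /leP hk P1 P2 w1 w2 delta h1 h12 h2 hw hw2 hd hd2.
have [hx [hln hb]] := hK (M k) (leq_trans hk (hMk k)).
have hm0 : 0 < INR (M k) by lra.
apply: Rle_trans (@estimate c (M k) _ P1 P2 w1 w2 delta (hgood k) erefl hx _ _ _ _ _ _ _) _ => //.
  apply: Rle_trans hd; right; rewrite -Rpower_pow; last exact: exp_pos.
  by rewrite Rpower_mult -Rpower_Ropp; congr Rpower; rewrite INR_IZR_INZ /=; field.
set D := delta ^ 2 * INR (M k) ^ 2.
have hD : 0 <= D by apply: Rmult_le_pos; apply: pow2_ge_0.
have -> : eta * (D / ln (INR (M k))) = eta / ln (INR (M k)) * D by rewrite /Rdiv; ring.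
exact: Rmult_le_compat_r.
Qed.

End GaussianPrimes.

Theorem theorem6 :
  forall c : cplx, ~ in_Qi c ->
  exists eps0 : R, 0 < eps0 /\
  forall eps : R, 0 < eps < eps0 ->
  exists M : nat -> nat,
    (forall k : nat, (M k < M (S k))%nat) /\
    (forall eta : R, 0 < eta ->
      exists K : nat, forall k : nat, (K <= k)%nat ->
        forall P1 P2 w1 w2 delta : R,
          0 <= P1 -> P1 < P2 -> P2 <= INR (M k) ->
          w1 < w2 -> w2 <= w1 + 2 * PI ->
          Rpower (INR (M k)) (eps - 1/12) < delta -> delta <= 1/2 ->
          Rabs (INR (pi_star P1 P2 w1 w2 delta c)
                - 4 * delta ^ 2 * INR (pi_count P1 P2 w1 w2))
            <= eta * (delta ^ 2 * (INR (M k)) ^ 2 / ln (INR (M k)))).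
Proof.
  intros c hc; exists 1; split; [lra|].
  intros eps heps.
  destruct (GaussianPrimes.equidistribution hc) as [M [hM h]].
  exists M; split; [exact hM|].
  (* The shift to S K forces k >= 1 and hence M k >= 1, so that [Rpower] is monotone in the
     exponent. *)
  intros eta heta; destruct (h eta heta) as [K hK]; exists (S K).
  intros k hk P1 P2 w1 w2 delta h1 h12 h2 hw hw2 hd hd2.
  assert (hm : 1 <= INR (M k)).
  { assert (hk0 : (1 <= M k)%nat).
    { destruct k as [|k]; [lia|]; specialize (hM k); lia. }
    exact (le_INR 1 (M k) hk0). }
  apply (hK k); try assumption; [lia|].
  apply Rle_trans with (2 := Rlt_le _ _ hd).
  apply Rle_Rpower; lra.
Qed.
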